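(* Let $Z$ be a sequence in $\mathbb{D}$. Suppose that $Z$ can be partitioned as $Z=\bigcup_kZ_k$, such that (a) there exist $\lambda_k\in\mathbb{T}$ and $K(k)>1$ such that $Z_k\subset\Omega_{K(k)}(\lambda_k)$, and (b) setting $a_k=2K(k)^2\sum_{z\in Z_k}(1-|z|)$, we have $$\sum_k\frac{1}{\log\left(1+\frac{1}{a_k}\right)}<\infty.$$ Then $Z$ is a zero set for the Dirichlet space $\mathcal{D}$.
   Context: $\mathbb{D}$ is the open unit disc in $\mathbb{C}$ and $\mathbb{T}$ the unit circle. For $\lambda\in\mathbb{T}$ and $K>1$, $\Omega_K(\lambda)=\{z\in\mathbb{D}:|\lambda-z|\le K(1-|z|)\}$ is the Stolz angle with vertex $\lambda$ and aperture $K$. The Dirichlet space $\mathcal{D}$ is the space of analytic functions $f$ on $\mathbb{D}$ with $\int_{\mathbb{D}}|f'|^2\,dA<\infty$ ($A$ normalized area measure). Sequences may contain each point finitely many times, repetitions encoding multiplicities; sums over $Z_k$ count repetitions. A sequence $Z$ is a zero set for $\mathcal{D}$ if there is $f\in\mathcal{D}$ which has a zero of multiplicity exactly $m$ at each $z$ repeated $m$ times in $Z$ and satisfies $f(z)\ne0$ for all $z\in\mathbb{D}\setminus Z$. Each $a_k$ is understood to be finite; some $Z_k$ may be empty, in which case $a_k=0$ and the corresponding term $1/\log(1+1/a_k)$ is interpreted as $0$. *)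

(* Defs.v *)
From HB Require Import structures.
From mathcomp Require Import all_boot all_order all_algebra.
From mathcomp Require Import all_classical all_reals all_analysis.
From mathcomp Require Import complex finmap.

Set Implicit Arguments.
Unset Strict Implicit.
Unset Printing Implicit Defensive.

Import Order.TTheory GRing.Theory Num.Theory.
Import numFieldNormedType.Exports.
Import Normc.

Local Open Scope classical_set_scope.
Local Open Scope ring_scope.
Local Open Scope complex_scope.

(* [normc z : R] is the modulus of [z : R[i]] as a real number
   (the norm [`|z|] of the library lives in [R[i]]). *)

Definition unit_disc (R : realType) : set R[i] := [set z | normc z < 1].

Definition unit_circle (R : realType) : set R[i] := [set z | normc z = 1].

Definition stolz_angle (R : realType) (K : R) (lambda : R[i]) : set R[i] :=
  [set z | unit_disc z /\ normc (lambda - z) <= K * (1 - normc z)].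

(* Complex differentiability: [R[i]^o] is [R[i]] as a normed module over
   itself, so the difference quotient is taken over complex increments. *)
Definition analytic_on_disc (R : realType) (f : R[i] -> R[i]) : Prop :=
  forall z, unit_disc z -> @derivable R[i] R[i]^o R[i]^o f z 1.

Definition cderive (R : realType) (f : R[i] -> R[i]) : R[i] -> R[i] :=
  @derive1 R[i] R[i]^o f.

(* The integral of [|f'|^2] over the disc for normalized area [dx dy / pi]. *)
Definition dirichlet_integral (R : realType) (f : R[i] -> R[i]) : \bar R :=
  ((pi^-1)%:E *
   \int[(@lebesgue_measure R \x @lebesgue_measure R)%E]_(p in
       [set p : R * R | unit_disc (p.1 +i* p.2)])
     (normc (cderive f (p.1 +i* p.2)) ^+ 2)%:E)%E.

Definition dirichlet_space (R : realType) : set (R[i] -> R[i]) :=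
  [set f | analytic_on_disc f /\ (dirichlet_integral f < +oo)%E].

Definition zero_of_multiplicity (R : realType) (f : R[i] -> R[i]) (w : R[i])
    (m : nat) : Prop :=
  exists g : R[i] -> R[i],
    [/\ analytic_on_disc g, g w != 0 &
        forall z, unit_disc z -> f z = (z - w) ^+ m * g z].

(* A sequence, finite or infinite, is a family indexed by a countable type;
   repetitions are allowed, but each point occurs only finitely often. *)
Definition disc_sequence (R : realType) (I : countType) (Z : I -> R[i]) : Prop :=
  (forall i, unit_disc (Z i)) /\ (forall w, finite_set (Z @^-1` [set w])).

Definition multiplicity (R : realType) (I : countType) (Z : I -> R[i])
    (w : R[i]) : nat := #|` fset_set (Z @^-1` [set w])|%N.

Definition dirichlet_zero_set (R : realType) (I : countType)
    (Z : I -> R[i]) : Prop :=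
  exists f : R[i] -> R[i],
    [/\ dirichlet_space f,
        forall w, range Z w -> zero_of_multiplicity f w (multiplicity Z w) &
        forall w, unit_disc w -> ~ range Z w -> f w != 0].

(* [2 K^2 \sum (1 - |z|)], the sum running over the indices in [A], so that
   repetitions are counted. *)
Definition stolz_size (R : realType) (I : countType) (Z : I -> R[i])
    (A : set I) (K : R) : \bar R :=
  ((2 * K ^+ 2)%:E * \esum_(i in A) (1 - normc (Z i))%:E)%E.

Definition inv_log (R : realType) (a : R) : R :=
  if a == 0 then 0 else (ln (1 + a^-1))^-1.

(* Main.v *)
(** The function is [F = prod_k f_k * B], where [B] is the Blaschke product of
    [Z] and, with [d = sqrt a_k] and [eps ~ 1 / log (1 / d)],
    [f_k z = eps * log ((1 + d - conj lambda_k * z) / d)]. Then [|f_k| <= 1],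
    [f_k = 1 + O(eps)] locally uniformly, and [f_k] vanishes at [lambda_k], with
    [|f_k z| <= 2 eps |lambda_k - z| / d].

    By Green's formula the Dirichlet integral of a function analytic on the
    closed disc is the mean over the circle of its flux [Re (z F' conj F)]. The
    flux of a product is the sum of the fluxes of the factors, weighted by the
    squared moduli of the other factors, all at most [1]. The Poisson kernels
    of the zeros in [Z_k] add up to at most [4 a_k / |lambda_k - z|^2] by the
    Stolz condition, and the weight [|f_k|^2] turns this into [16 eps^2]. The
    flux of [f_k] is at most [2 eps] up to the derivative of a function bounded
    by [2 eps]. Hence the finite products have energy [O(sum_k eps_k)], and
    [eps_k <= 2 / log (1 + 1 / a_k)]. Fatou's lemma finishes the proof. *)

Require Import Defs.
From HB Require Import structures.
From mathcomp Require Import all_boot all_order all_algebra.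
From mathcomp Require Import all_classical all_reals all_analysis.
From mathcomp Require Import measurable_realfun.
From mathcomp Require Import complex finmap.
From mathcomp Require Import ring lra.

Set Implicit Arguments.
Unset Strict Implicit.
Unset Printing Implicit Defensive.

Import Order.TTheory GRing.Theory Num.Theory.
Import numFieldNormedType.Exports.
Import Normc.

Local Open Scope classical_set_scope.
Local Open Scope ring_scope.
Local Open Scope complex_scope.

(** The scale [d = sqrt a_k] balances two demands. The flux of a group, weighted by its logarithmic
    factor, is of order [eps^2 a_k / d^2], which asks for [d^2] at least of the order of [a_k]; on
    the other hand [eps] is about [1 / log (1 / d)], and a square root only halves the logarithm, so
    the price is a factor 2. The positive shift [d] also keeps each logarithm analytic across the
    circle, where Green's formula is applied. Two arrangements of the factors compete. Convergence
    and multiplicities want the zeros in the order of the sequence; the energy estimate wants each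
    logarithmic factor next to the Blaschke factors of its own group. Finite products are therefore
    grouped, with the number of groups chosen after the number of zeros, and then recognised as a
    logarithmic product times a Blaschke product, which converge separately. Analyticity of the
    limits does not come from Cauchy's formula: every factor carries explicit first and second
    derivatives, and locally uniform bounds on the latter let a Taylor estimate pass to the
    limit. *)

Local Notation "z ^*" := (conjc z) : ring_scope.

(** * Complex differentiability with quadratic remainder *)

Section ModulusFacts.
Context {R : realType}.
Implicit Types z w : R[i].

Lemma real_complex0 : (0 : R)%:C = 0 :> R[i]. Proof. exact: rmorph0. Qed.
Lemma real_complex1 : (1 : R)%:C = 1 :> R[i]. Proof. exact: rmorph1. Qed.

Lemma normc_ge0 z : 0 <= normc z.
Proof. by case: z => a b; rewrite sqrtr_ge0. Qed.

Lemma sqr_normcE z : normc z ^+ 2 = complex.Re z ^+ 2 + complex.Im z ^+ 2.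
Proof. by case: z => a b /=; rewrite sqr_sqrtr// addr_ge0// sqr_ge0. Qed.

Lemma normc_eq0 z : (normc z == 0) = (z == 0).
Proof.
apply/eqP/eqP => [/eq0_normc//|->]; exact: normc0.
Qed.

Lemma normc_gt0 z : (0 < normc z) = (z != 0).
Proof. by rewrite lt_neqAle eq_sym normc_eq0 normc_ge0 andbT. Qed.

Lemma normc_realE (x : R) : normc x%:C = `|x|.
Proof. by rewrite /= expr0n /= addr0 sqrtr_sqr. Qed.

Lemma normcX z n : normc (z ^+ n) = normc z ^+ n.
Proof.
by elim: n => [|n ih]; rewrite ?expr0 ?normc1// !exprS normcM ih.
Qed.

Lemma normc_conj z : normc z^* = normc z.
Proof. by case: z => a b /=; rewrite sqrrN. Qed.

Lemma le_normcB z w : normc (z - w) <= normc z + normc w.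
Proof. by rewrite (le_trans (le_normcD _ _))// normcN. Qed.

Lemma ge_normcB z w : normc z - normc w <= normc (z - w).
Proof.
by rewrite lerBlDr -{1}(subrK w z) le_normcD.
Qed.

Lemma normcBC z w : normc (z - w) = normc (w - z).
Proof. by rewrite -normcN opprB. Qed.

Lemma normRe_le z : `|complex.Re z| <= normc z.
Proof.
rewrite -(@ler_pXn2r _ 2)// ?nnegrE ?normc_ge0// sqr_normcE real_normK ?num_real//.
by rewrite lerDl sqr_ge0.
Qed.

Lemma normIm_le z : `|complex.Im z| <= normc z.
Proof.
rewrite -(@ler_pXn2r _ 2)// ?nnegrE ?normc_ge0// sqr_normcE real_normK ?num_real//.
by rewrite lerDr sqr_ge0.
Qed.

Lemma normc_le_ReIm z : normc z <= `|complex.Re z| + `|complex.Im z|.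
Proof.
rewrite -(@ler_pXn2r _ 2)// ?nnegrE ?normc_ge0 ?addr_ge0//.
rewrite sqr_normcE sqrrD !real_normK ?num_real// -addrA lerD2l lerDr.
by rewrite mulrn_wge0// mulr_ge0.
Qed.

Lemma normc_itv (x : R) z : 0 <= x <= 1 -> normc (x%:C * z) <= normc z.
Proof.
move=> /andP[x0 x1]; rewrite normcM normc_realE ger0_norm//.
by rewrite ler_piMl// normc_ge0.
Qed.

Lemma Re_add z w : complex.Re (z + w) = complex.Re z + complex.Re w.
Proof. by case: z w => [a b] [c d]. Qed.
Lemma Im_add z w : complex.Im (z + w) = complex.Im z + complex.Im w.
Proof. by case: z w => [a b] [c d]. Qed.
Lemma Re_opp z : complex.Re (- z) = - complex.Re z.
Proof. by case: z. Qed.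
Lemma Im_opp z : complex.Im (- z) = - complex.Im z.
Proof. by case: z. Qed.
Lemma Re_mul z w : complex.Re (z * w) =
  complex.Re z * complex.Re w - complex.Im z * complex.Im w.
Proof. by case: z w => [a b] [c d]. Qed.
Lemma Im_mul z w : complex.Im (z * w) =
  complex.Re z * complex.Im w + complex.Im z * complex.Re w.
Proof. by case: z w => [a b] [c d]. Qed.
Lemma Re_inv z : complex.Re z^-1 = complex.Re z / normc z ^+ 2.
Proof. by rewrite sqr_normcE; case: z => a b. Qed.
Lemma Im_inv z : complex.Im z^-1 = - complex.Im z / normc z ^+ 2.
Proof. by rewrite sqr_normcE; case: z => a b /=; rewrite mulNr. Qed.

End ModulusFacts.

Section Qdiff.
Context {R : realType}.
Implicit Types (f g : R[i] -> R[i]) (z d : R[i]).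

(* Complex differentiability with a quadratic remainder. Unlike the mere
   existence of the derivative it survives pointwise limits, provided the
   constant is uniform. *)
Definition qdiff f z d := exists M e : R, [/\ 0 <= M, 0 < e &
  forall h, normc h < e ->
    normc (f (z + h) - f z - h * d) <= M * normc h ^+ 2].

Lemma qdiff_lip f z d : qdiff f z d -> exists L e : R, [/\ 0 <= L, 0 < e &
  forall h, normc h < e -> normc (f (z + h) - f z) <= L * normc h].
Proof.
move=> [M [e [M0 e0 H]]]; exists (M + normc d), (Num.min e 1); split.
- by rewrite addr_ge0// normc_ge0.
- by rewrite lt_min e0 ltr01.
move=> h; rewrite lt_min => /andP[he h1].
have := H _ he; rewrite -{2}(subrK (h * d) (f (z + h) - f z)).
move=> Hh; apply: (le_trans (le_normcD _ _)).
rewrite mulrDl lerD//; last by rewrite normcM mulrC.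
apply: (le_trans Hh); rewrite ler_wpM2l// expr2 ler_piMl// ?normc_ge0//.
exact: ltW.
Qed.

Lemma qdiff_cst (c : R[i]) z : qdiff (fun=> c) z 0.
Proof.
exists 0, 1; split=> // h _.
by rewrite subrr mulr0 subr0 normc0 mul0r.
Qed.

Lemma qdiff_id z : qdiff id z 1.
Proof.
exists 0, 1; split=> // h _.
by rewrite mulr1 (addrC z) addrK subrr normc0 mul0r.
Qed.

Lemma qdiffD f g z d d' : qdiff f z d -> qdiff g z d' ->
  qdiff (fun x => f x + g x) z (d + d').
Proof.
move=> [M [e [M0 e0 H]]] [N [k [N0 k0 K]]].
exists (M + N), (Num.min e k); split; rewrite ?addr_ge0 ?lt_min ?e0//.
move=> h; rewrite lt_min => /andP[/H Hh /K Kh].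
rewrite mulrDl (le_trans _ (lerD Hh Kh))//.
apply: le_trans (le_normcD _ _).
by rewrite le_eqVlt; apply/orP; left; apply/eqP; congr normc; ring.
Qed.

Lemma qdiffM f g z d d' : qdiff f z d -> qdiff g z d' ->
  qdiff (fun x => f x * g x) z (d * g z + f z * d').
Proof.
move=> qf qg.
have [L [l [L0 l0 HL]]] := qdiff_lip qg.
move: qf qg => [M [e [M0 e0 H]]] [N [k [N0 k0 K]]].
exists (M * (normc (g z) + L) + normc (f z) * N + normc d * L).
exists (Num.min (Num.min e k) (Num.min l 1)); split.
- by rewrite !addr_ge0// !mulr_ge0 ?addr_ge0 ?normc_ge0.
- by rewrite !lt_min e0 k0 l0 ltr01.
move=> h; rewrite !lt_min => /andP[/andP[/H Hh /K Kh] /andP[/HL Lh h1]].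
have -> : f (z + h) * g (z + h) - f z * g z - h * (d * g z + f z * d') =
   (f (z + h) - f z - h * d) * g (z + h) + f z * (g (z + h) - g z - h * d')
   + h * d * (g (z + h) - g z) by ring.
apply: (le_trans (le_normcD _ _)); rewrite [leRHS]mulrDl; apply: lerD; last first.
  rewrite !normcM -!mulrA mulrCA ler_wpM2l ?normc_ge0//.
  by rewrite expr2 mulrA mulrC ler_wpM2r// normc_ge0.
apply: (le_trans (le_normcD _ _)); rewrite [leRHS]mulrDl; apply: lerD; last first.
  by rewrite normcM -mulrA ler_wpM2l// normc_ge0.
rewrite normcM mulrAC ler_pM ?normc_ge0//.
rewrite -[g (z + h)](subrK (g z)) addrC (le_trans (le_normcD _ _))//.
by rewrite lerD2l (le_trans Lh)// ler_piMr// ltW.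
Qed.

Lemma qdiff_comp f g z d d' : qdiff f (g z) d -> qdiff g z d' ->
  qdiff (fun x => f (g x)) z (d * d').
Proof.
move=> [M [e [M0 e0 H]]] qg.
have [L [l [L0 l0 HL]]] := qdiff_lip qg.
move: qg => [N [k [N0 k0 K]]].
exists (M * L ^+ 2 + normc d * N), (Num.min (Num.min k l) (e / (L + 1))); split.
- by rewrite addr_ge0// mulr_ge0// ?normc_ge0// sqr_ge0.
- by rewrite !lt_min k0 l0 divr_gt0// ltr_wpDl.
move=> h; rewrite !lt_min => /andP[/andP[/K Kh /HL Lh] he].
have He : normc (g (z + h) - g z) < e.
  rewrite (le_lt_trans Lh)//.
  have : (L + 1) * normc h < e by rewrite mulrC -ltr_pdivlMr// ltr_wpDl.
  by apply: le_lt_trans; rewrite mulrDl mul1r lerDl normc_ge0.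
have := H _ He; rewrite [g z + _]addrC subrK => Hg.
have -> : f (g (z + h)) - f (g z) - h * (d * d') =
  (f (g (z + h)) - f (g z) - (g (z + h) - g z) * d) +
  d * (g (z + h) - g z - h * d') by ring.
apply: (le_trans (le_normcD _ _)); rewrite [leRHS]mulrDl lerD//.
  apply: (le_trans Hg); rewrite -mulrA ler_wpM2l// -exprMn.
  by rewrite ler_pXn2r// nnegrE ?normc_ge0// mulr_ge0// normc_ge0.
by rewrite normcM -mulrA ler_wpM2l// normc_ge0.
Qed.

Lemma qdiffV z : z != 0 -> qdiff (fun x => x^-1) z (- z ^- 2).
Proof.
move=> z0; have n0 : 0 < normc z by rewrite normc_gt0.
exists (2 * (normc z) ^- 3), (normc z / 2); split.
- by rewrite mulr_ge0// invr_ge0 exprn_ge0// ltW.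
- by rewrite divr_gt0.
move=> h hz.
have zh : normc z / 2 <= normc (z + h).
  have := ge_normcB z (- h); rewrite opprK normcN => /(le_trans _); apply.
  by rewrite lerBrDl; lra.
have zh0 : z + h != 0 by rewrite -normc_gt0 (lt_le_trans _ zh)// divr_gt0.
have -> : (z + h)^-1 - z^-1 - h * (- z ^- 2) = h ^+ 2 * (z ^- 2 * (z + h)^-1).
  by field; rewrite zh0 z0.
rewrite normcM normcX mulrC ler_wpM2r ?sqr_ge0// normcM !normcV normcX.
have -> : 2 * (normc z) ^- 3 = (normc z) ^- 2 * (normc z / 2)^-1.
  by field; rewrite gt_eqF.
rewrite ler_wpM2l ?invr_ge0 ?sqr_ge0// lef_pV2// posrE ?divr_gt0//.
by rewrite normc_gt0.
Qed.

Lemma qdiff_eq f z d d' : qdiff f z d -> d = d' -> qdiff f z d'.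
Proof. by move=> + <-. Qed.

End Qdiff.

(** Stated over any numeric field because it serves twice: over [R[i]] for complex derivatives, and
    over [R] for real derivatives along lines. *)
Lemma quadratic_is_derive (K : numFieldType) (f : K -> K) (x d M e : K) :
  0 <= M -> 0 < e ->
  (forall h, `|h| < e -> `|f (x + h) - f x - h * d| <= M * `|h| ^+ 2) ->
  is_derive (x : K^o) 1 (f : K^o -> K^o) d.
Proof.
move=> M0 e0 H.
have L : (fun h : K => h^-1 *: (((f : K^o -> K^o) \o shift (x : K^o)) (h *: (1 : K^o)) - f x))
    @ 0^' --> (d : K^o).
  apply/cvgrPdist_le => eps eps0; near=> h.
  have h0 : h != 0 by near: h; exact: nbhs_dnbhs_neq.
  have he : `|h| < e.
    near: h; apply: dnbhs0_lt => //.
  have hM : `|h| < eps / (M + 1).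
    near: h; apply: dnbhs0_lt; rewrite divr_gt0// ltr_wpDl//.
  have := H _ he => {}H.
  rewrite /= [h *: _]mulr1 (addrC h) distrC.
  have -> : h^-1 *: (f (x + h) - f x : K^o) - d = h^-1 * (f (x + h) - f x - h * d).
    by rewrite [RHS]mulrBr mulKf.
  rewrite normrM normfV ler_pdivrMl ?normr_gt0//.
  apply: (le_trans H); rewrite expr2 mulrA mulrC ler_wpM2l//.
  move: hM; rewrite ltr_pdivlMr ?ltr_wpDl// => /ltW; apply: le_trans.
  by rewrite mulrC ler_wpM2l// lerDl.
apply: DeriveDef; first by apply/cvg_ex; exists d.
exact: cvg_lim L.
Unshelve. all: by end_near. Qed.

(** * Derivatives, mean value and Taylor estimates from the quadratic remainder *)

Section Bridges.
Context {R : realType}.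
Implicit Types (f g : R[i] -> R[i]) (z d : R[i]).

Lemma normc_normE (z : R[i]) : `|z| = (normc z)%:C.
Proof. by rewrite normc_def; case: z. Qed.

Lemma qdiff_is_derive f z d : qdiff f z d ->
  is_derive (z : R[i]^o) 1 (f : R[i]^o -> R[i]^o) d.
Proof.
move=> [M [e [M0 e0 H]]].
apply: (@quadratic_is_derive _ _ _ _ M%:C e%:C).
- by rewrite ler0c.
- by rewrite ltcR.
move=> h; rewrite !normc_normE ltcR => /H Hh.
by rewrite -rmorphXn -rmorphM lecR.
Qed.

Lemma qdiff_derivable f z d : qdiff f z d -> @derivable R[i] R[i]^o R[i]^o f z 1.
Proof. by move=> /qdiff_is_derive[]. Qed.

Lemma qdiff_cderive f z d : qdiff f z d -> cderive f z = d.
Proof. by move=> /qdiff_is_derive[_ <-]; rewrite /cderive derive1E. Qed.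

(** The constant [c] lets one statement serve both coordinates: multiplying by [i] or [- i]
    exchanges real and imaginary parts up to sign. *)
Lemma qdiff_line f (z0 h c d : R[i]) (t : R) : qdiff f (z0 + t%:C * h) d ->
  is_derive t 1 (fun s : R => complex.Re (c * f (z0 + s%:C * h)))
    (complex.Re (c * (h * d))).
Proof.
move=> [M [e [M0 e0 H]]].
have h0 : 0 < normc h + 1 by rewrite ltr_wpDl// normc_ge0.
apply: (@quadratic_is_derive _ _ _ _ (normc c * M * normc h ^+ 2)
    (e / (normc h + 1))).
- by rewrite !mulr_ge0 ?normc_ge0.
- by rewrite divr_gt0.
move=> s; rewrite ltr_pdivlMr// => hs.
have Hs : normc (s%:C * h) < e.
  rewrite normcM normc_realE (le_lt_trans _ hs)//.
  by rewrite mulrDr mulr1 lerDl.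
have -> : complex.Re (c * f (z0 + (t + s)%:C * h)) - complex.Re (c * f (z0 + t%:C * h))
  - s * complex.Re (c * (h * d)) =
  complex.Re (c * (f (z0 + t%:C * h + s%:C * h) - f (z0 + t%:C * h) - (s%:C * h) * d)).
  have -> : s * complex.Re (c * (h * d)) = complex.Re (s%:C * (c * (h * d))).
    by rewrite [RHS]Re_mul /= mul0r subr0.
  rewrite -!Re_opp -!Re_add; congr complex.Re.
  rewrite (_ : (t + s)%:C = t%:C + s%:C) ?rmorphD// mulrDl addrA; ring.
apply: (le_trans (normRe_le _)); rewrite normcM -2![leRHS]mulrA ler_wpM2l ?normc_ge0//.
apply: (le_trans (H _ Hs)).
by rewrite normcM normc_realE exprMn [_ ^+ 2 * _]mulrC.
Qed.

Definition segment_pt (z w : R[i]) (t : R) := z + t%:C * (w - z).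

(** The mean value theorem fails for complex values, so it is applied to the real parts of [f] and
    of [i f] along the segment; adding the two bounds gives the factor 2. *)
Lemma qdiff_mean_value f f' (z w : R[i]) (M : R) :
  (forall t : R, 0 <= t <= 1 -> qdiff f (segment_pt z w t) (f' (segment_pt z w t)) /\
     normc (f' (segment_pt z w t)) <= M) ->
  normc (f w - f z) <= 2 * M * normc (w - z).
Proof.
move=> H.
have mv c : normc c = 1 -> `|complex.Re (c * (f w - f z))| <= M * normc (w - z).
  move=> c1.
  pose phi s := complex.Re (c * f (segment_pt z w s)).
  have dphi (t : R) : 0 <= t <= 1 -> is_derive t 1 phi
      (complex.Re (c * ((w - z) * f' (segment_pt z w t)))).
    by move=> /H[/qdiff_line q _]; exact: q.
  have [|||t] := @MVT _ phi (fun t => complex.Re (c * ((w - z) * f' (segment_pt z w t)))) 0 1.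
  - exact: ltr01.
  - by move=> t; rewrite in_itv/= => /andP[t0 t1]; apply: dphi; rewrite !ltW.
  - apply: derivable_within_continuous => t; rewrite in_itv/= => t01.
    by case: (dphi _ t01).
  rewrite in_itv/= => /andP[t0 t1]; rewrite subr0 mulr1.
  have -> : phi 1 - phi 0 = complex.Re (c * (f w - f z)).
    by rewrite /phi /segment_pt mul1r mul0r addr0 [z + _]addrC subrK mulrBr Re_add Re_opp.
  move=> ->; apply: (le_trans (normRe_le _)).
  have [|_ Ht] := H t; first by rewrite !ltW.
  by rewrite !normcM c1 mul1r mulrC ler_wpM2r// normc_ge0.
apply: (le_trans (normc_le_ReIm _)).
have h1 := mv 1 (@normc1 R); rewrite mul1r in h1.
have hi : normc ('i%C : R[i]) = 1 by rewrite /= expr0n expr1n add0r sqrtr1.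
have h2 := mv _ hi; rewrite mulrC ReiNIm normrN in h2.
by lra.
Qed.

(** The mean value inequality used twice, on [f'] and then on [f x - x * f' z], each time at the
    cost of a factor 2. Only the bound on [f''] enters the constant, which is what lets the estimate
    survive pointwise limits. *)
Lemma qdiff_taylor (f f' f'' : R[i] -> R[i]) (z w : R[i]) (M : R) : 0 <= M ->
  (forall t : R, 0 <= t <= 1 -> [/\ qdiff f (segment_pt z w t) (f' (segment_pt z w t)),
     qdiff f' (segment_pt z w t) (f'' (segment_pt z w t)) &
     normc (f'' (segment_pt z w t)) <= M]) ->
  normc (f w - f z - (w - z) * f' z) <= 4 * M * normc (w - z) ^+ 2.
Proof.
move=> M0 H.
have L (t : R) : 0 <= t <= 1 -> normc (f' (segment_pt z w t) - f' z) <= 2 * M * normc (w - z).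
  move=> /andP[t0 t1].
  apply: (@le_trans _ _ (2 * M * normc (segment_pt z w t - z))).
    apply: (@qdiff_mean_value f' f'') => s /andP[s0 s1].
    have -> : segment_pt z (segment_pt z w t) s = segment_pt z w (s * t).
      by rewrite /segment_pt [(s * t)%:C]rmorphM /=; ring.
    have [|//] := H (s * t).
    by rewrite mulr_ge0//= mulr_ile1.
  rewrite ler_wpM2l ?mulr_ge0// /segment_pt [z + _]addrC addrK normc_itv//.
  by rewrite t0 t1.
pose g x := f x - x * f' z.
have -> : f w - f z - (w - z) * f' z = g w - g z by rewrite /g; ring.
apply: (@le_trans _ _ (2 * (2 * M * normc (w - z)) * normc (w - z))); last first.
  by rewrite expr2; lra.
apply: (@qdiff_mean_value g (fun x => f' x - f' z)) => t t01.
split; last exact: L.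
have [q _ _] := H t t01.
apply: qdiff_eq.
  apply: qdiffD; first exact: q.
  have := qdiffM (qdiff_id (segment_pt z w t)) (qdiff_cst (- f' z) (segment_pt z w t)).
  have -> : (fun x : R[i] => id x * - f' z) = (fun x => - (x * f' z)).
    by apply/funext => x /=; rewrite mulrN.
  exact.
by rewrite mul1r mulr0 addr0.
Qed.

End Bridges.

(** * The principal logarithm on the right half-plane *)

Section Clog.
Context {R : realType}.
Implicit Types (a b f g : R -> R) (t : R).

Lemma derD f g t df dg : is_derive t 1 f df -> is_derive t 1 g dg ->
  is_derive t 1 (fun s => f s + g s) (df + dg).
Proof. exact: is_deriveD. Qed.

Lemma derB f g t df dg : is_derive t 1 f df -> is_derive t 1 g dg ->
  is_derive t 1 (fun s => f s - g s) (df - dg).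
Proof. exact: is_deriveB. Qed.

Lemma derM f g t df dg : is_derive t 1 f df -> is_derive t 1 g dg ->
  is_derive t 1 (fun s => f s * g s) (f t * dg + g t * df).
Proof. exact: is_deriveM. Qed.

Lemma der_comp f g t df dg : is_derive (g t) 1 f df -> is_derive t 1 g dg ->
  is_derive t 1 (fun s => f (g s)) (df * dg).
Proof. exact: is_derive1_comp. Qed.

Lemma derV f t df : f t != 0 -> is_derive t 1 f df ->
  is_derive t 1 (fun s => (f s)^-1) (- (f t) ^- 2 * df).
Proof. exact: is_deriveV. Qed.

Lemma derC (c t : R) : is_derive t 1 (fun=> c) 0.
Proof. exact: is_derive_cst. Qed.

Lemma der_eq f t df df' : is_derive t 1 f df -> df = df' -> is_derive t 1 f df'.
Proof. by move=> + <-. Qed.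

Definition half_ln_sqr (x y : R) := ln (x ^+ 2 + y ^+ 2) / 2.

Lemma der_half_ln_sqr a b t da db : 0 < a t ->
  is_derive t 1 a da -> is_derive t 1 b db ->
  is_derive t 1 (fun s => half_ln_sqr (a s) (b s))
    ((a t * da + b t * db) / (a t ^+ 2 + b t ^+ 2)).
Proof.
move=> a0 Da Db; rewrite /half_ln_sqr.
have n0 : 0 < a t ^+ 2 + b t ^+ 2 by rewrite ltr_wpDr ?sqr_ge0// exprn_gt0.
have D2 : is_derive t 1 (fun s => a s ^+ 2 + b s ^+ 2) _ :=
  derD (derM Da Da) (derM Db Db).
have Dl := @der_comp (@ln R) _ t _ _ (is_derive1_ln n0) D2.
apply: (der_eq (derM Dl (derC 2^-1 t))).
by rewrite mulr0 add0r; field; rewrite gt_eqF.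
Qed.

Lemma der_atan_div a b t da db : 0 < a t ->
  is_derive t 1 a da -> is_derive t 1 b db ->
  is_derive t 1 (fun s => atan (b s / a s))
    ((a t * db - da * b t) / (a t ^+ 2 + b t ^+ 2)).
Proof.
move=> a0 Da Db.
have n0 : 0 < a t ^+ 2 + b t ^+ 2 by rewrite ltr_wpDr ?sqr_ge0// exprn_gt0.
have a1 : a t != 0 by rewrite gt_eqF.
have Dq : is_derive t 1 (fun s => b s / a s) _ := derM Db (derV a1 Da).
apply: (der_eq (@der_comp (@atan R) _ t _ _ (is_derive1_atan _) Dq)).
by field; rewrite !gt_eqF.
Qed.

(** [atan] of the slope is the argument only when the real part is positive, which holds wherever
    the logarithm is used below. *)
Definition clog (v : R[i]) : R[i] :=
  half_ln_sqr (complex.Re v) (complex.Im v) +i* atan (complex.Im v / complex.Re v).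

(** The difference equals [- t h^2 / (v (v + t h))], and both moduli in the denominator are
    controlled by real parts, which stay above half of [Re v]. *)
Let remainder_bound (v h : R[i]) (t : R) : 0 < complex.Re v ->
  normc h < complex.Re v / 2 -> 0 <= t <= 1 ->
  0 < complex.Re (v + t%:C * h) /\
  normc (h / (v + t%:C * h) - h / v) <= 2 / complex.Re v ^+ 2 * normc h ^+ 2.
Proof.
move=> v0 hv /[dup] t01 /andP[t0 t1].
have vt : complex.Re v / 2 < complex.Re (v + t%:C * h).
  rewrite Re_add.
  have : `|complex.Re (t%:C * h)| <= normc h.
    exact: le_trans (normRe_le _) (normc_itv _ t01).
  by rewrite ler_norml => /andP[? _]; lra.
have vt0 : 0 < complex.Re (v + t%:C * h) by rewrite (lt_trans _ vt)// divr_gt0.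
have nv : complex.Re v <= normc v.
  by rewrite (le_trans _ (normRe_le _))// ler_norm.
have nvt : complex.Re v / 2 <= normc (v + t%:C * h).
  by rewrite (le_trans (ltW vt))// (le_trans _ (normRe_le _))// ler_norm.
split=> //.
have vn0 : v != 0 by rewrite -normc_gt0 (lt_le_trans v0).
have vtn0 : v + t%:C * h != 0 by rewrite -normc_gt0 (lt_le_trans _ nvt)// divr_gt0.
have -> : h / (v + t%:C * h) - h / v = - (t%:C * h * h) * (v^-1 * (v + t%:C * h)^-1).
  by field; rewrite vn0 vtn0.
rewrite normcM normcN mulrC; apply: ler_pM; rewrite ?normc_ge0//.
  rewrite normcM !normcV (_ : 2 / _ = (complex.Re v)^-1 * (complex.Re v / 2)^-1); last first.
    by field; rewrite gt_eqF.
  by rewrite ler_pM ?invr_ge0 ?normc_ge0// lef_pV2// posrE ?divr_gt0// normc_gt0.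
by rewrite normcM expr2 ler_wpM2r ?normc_ge0// normc_itv.
Qed.

Lemma der_clog_line (v h : R[i]) (t : R) : 0 < complex.Re (v + t%:C * h) ->
  is_derive t 1 (fun s => complex.Re (clog (v + s%:C * h)))
    (complex.Re (h / (v + t%:C * h))) /\
  is_derive t 1 (fun s => complex.Im (clog (v + s%:C * h)))
    (complex.Im (h / (v + t%:C * h))).
Proof.
move=> p0.
have da : is_derive t 1 (fun s => complex.Re (v + s%:C * h)) (complex.Re h).
  rewrite (_ : (fun s => _) = fun s => complex.Re v + s * complex.Re h); last first.
    by apply/funext => s; rewrite Re_add Re_mul /= mul0r subr0.
  apply: (der_eq (derD (derC _ t) (derM (is_derive_id t 1) (derC (complex.Re h) t)))).
  by rewrite mulr0 !add0r mulr1.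
have db : is_derive t 1 (fun s => complex.Im (v + s%:C * h)) (complex.Im h).
  rewrite (_ : (fun s => _) = fun s => complex.Im v + s * complex.Im h); last first.
    by apply/funext => s; rewrite Im_add Im_mul /= mul0r addr0.
  apply: (der_eq (derD (derC _ t) (derM (is_derive_id t 1) (derC (complex.Im h) t)))).
  by rewrite mulr0 !add0r mulr1.
split.
  apply: der_eq; first exact: (der_half_ln_sqr p0 da db).
  rewrite Re_mul Re_inv Im_inv sqr_normcE; ring.
apply: der_eq; first exact: (der_atan_div p0 da db).
rewrite Im_mul Re_inv Im_inv sqr_normcE; ring.
Qed.

(** The real mean value theorem along the segment from [v] to [v + h], once for each coordinate,
    with [remainder_bound] comparing the derivative on the segment to its value at [v]. *)
Lemma qdiff_clog (v : R[i]) : 0 < complex.Re v -> qdiff clog v v^-1.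
Proof.
move=> v0; set M := 2 / complex.Re v ^+ 2.
have M0 : 0 <= M by rewrite divr_ge0// sqr_ge0.
exists (2 * M), (complex.Re v / 2); split; [by rewrite mulr_ge0|by rewrite divr_gt0|].
move=> h hv.
have mv (phi dphi : R -> R) (c : R) : 
    (forall t : R, 0 <= t <= 1 -> is_derive t 1 phi (dphi t)) ->
    (forall t : R, 0 <= t <= 1 -> `|dphi t - c| <= M * normc h ^+ 2) ->
    `|phi 1 - phi 0 - c| <= M * normc h ^+ 2.
  move=> H1 H2.
  have [|||t] := @MVT _ phi dphi 0 1.
  - exact: ltr01.
  - by move=> t; rewrite in_itv/= => /andP[t0 t1]; apply: H1; rewrite !ltW.
  - apply: derivable_within_continuous => t; rewrite in_itv/= => t01.
    by case: (H1 _ t01).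
  by rewrite in_itv/= => /andP[t0 t1]; rewrite subr0 mulr1 => ->; apply: H2; rewrite !ltW.
have R0 : complex.Re (clog (v + h) - clog v - h * v^-1) =
   complex.Re (clog (v + 1%:C * h)) - complex.Re (clog (v + 0%:C * h)) - complex.Re (h / v).
  by rewrite mul1r mul0r addr0 -!Re_opp -!Re_add.
have I0 : complex.Im (clog (v + h) - clog v - h * v^-1) =
   complex.Im (clog (v + 1%:C * h)) - complex.Im (clog (v + 0%:C * h)) - complex.Im (h / v).
  by rewrite mul1r mul0r addr0 -!Im_opp -!Im_add.
apply: (le_trans (normc_le_ReIm _)); rewrite -mulrA [leRHS]mulrDl !mul1r.
rewrite R0 I0; apply: lerD.
  apply: (mv (fun s => complex.Re (clog (v + s%:C * h)))
             (fun t => complex.Re (h / (v + t%:C * h)))) => t t01.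
    by have [/der_clog_line[]] := remainder_bound v0 hv t01.
  have [_] := remainder_bound v0 hv t01; apply: le_trans.
  by rewrite -Re_opp -Re_add normRe_le.
apply: (mv (fun s => complex.Im (clog (v + s%:C * h)))
           (fun t => complex.Im (h / (v + t%:C * h)))) => t t01.
  by have [/der_clog_line[]] := remainder_bound v0 hv t01.
have [_] := remainder_bound v0 hv t01; apply: le_trans.
by rewrite -Im_opp -Im_add normIm_le.
Qed.

End Clog.

(** * Infinite products *)

Section ComplexSequences.
Context {R : realType}.
Implicit Types (u v : nat -> R[i]) (s b : nat -> R).

Definition bounded_series s :=
  (forall n, 0 <= s n) /\ exists S, forall n, \sum_(0 <= i < n) s i <= S.

Lemma bounded_series_cvg s : bounded_series s -> cvgn (series s).
Proof.
move=> [s0 [S HS]]; apply: nondecreasing_is_cvgn.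
  apply/nondecreasing_seqP => n.
  by rewrite !seriesEnat /= big_nat_recr//= lerDl.
by exists S => _ [n _ <-]; rewrite seriesEnat/=.
Qed.

Lemma bounded_seriesZ s (c : R) : 0 <= c -> bounded_series s ->
  bounded_series (fun n => c * s n).
Proof.
move=> c0 [s0 [S HS]]; split=> [n|]; first by rewrite mulr_ge0.
by exists (c * S) => n; rewrite -mulr_sumr ler_wpM2l.
Qed.

Lemma bounded_series_le s b : (forall n, 0 <= s n <= b n) ->
  bounded_series b -> bounded_series s.
Proof.
move=> sb [b0 [S HS]]; split=> [n|]; first by case/andP: (sb n).
by exists S => n; apply: le_trans (HS n); apply: ler_sum => i _; case/andP: (sb i).
Qed.

Lemma bounded_series_tail s (eps : R) : bounded_series s -> 0 < eps ->
  exists N, forall n, \sum_(N <= i < N + n) s i <= eps.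
Proof.
move=> [s0 [S HS]] e0.
have hs : has_sup (range (fun n => \sum_(0 <= i < n) s i)).
  by split; [exists (\sum_(0 <= i < 0) s i), 0%N|exists S => _ [n _ <-]].
have [_ [N _ <-] HN] := sup_adherent e0 hs.
exists N => n.
have : \sum_(0 <= i < N + n) s i <= sup (range (fun n => \sum_(0 <= i < n) s i)).
  by apply: ub_le_sup; [case: hs|exists (N + n)%N].
rewrite (@big_cat_nat _ _ _ N)//= ?leq_addr//.
by move: HN; set x := sup _; lra.
Qed.

(** Componentwise, so that the limit theorems for real sequences apply directly. *)
Definition ccvg u (l : R[i]) :=
  (fun n => complex.Re (u n)) @ \oo --> complex.Re l /\
  (fun n => complex.Im (u n)) @ \oo --> complex.Im l.

Lemma ccvg_cst (c : R[i]) : ccvg (fun=> c) c.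
Proof. by split; exact: cvg_cst. Qed.

Lemma ccvgD u v k l : ccvg u k -> ccvg v l -> ccvg (fun n => u n + v n) (k + l).
Proof.
move=> [u1 u2] [v1 v2]; split.
  under eq_fun do rewrite Re_add; rewrite Re_add; exact: cvgD.
under eq_fun do rewrite Im_add; rewrite Im_add; exact: cvgD.
Qed.

Lemma ccvgM u v k l : ccvg u k -> ccvg v l -> ccvg (fun n => u n * v n) (k * l).
Proof.
move=> [u1 u2] [v1 v2]; split.
  by under eq_fun do rewrite Re_mul; rewrite Re_mul; apply: cvgB; apply: cvgM.
by under eq_fun do rewrite Im_mul; rewrite Im_mul; apply: cvgD; apply: cvgM.
Qed.

Lemma ccvgN u k : ccvg u k -> ccvg (fun n => - u n) (- k).
Proof.
move=> [u1 u2]; split.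
  by under eq_fun do rewrite Re_opp; rewrite Re_opp; apply: cvgN.
by under eq_fun do rewrite Im_opp; rewrite Im_opp; apply: cvgN.
Qed.

Lemma ccvg_sqr_normc u l : ccvg u l ->
  (fun n => normc (u n) ^+ 2) @ \oo --> normc l ^+ 2.
Proof.
move=> [u1 u2]; rewrite sqr_normcE; under eq_fun do rewrite sqr_normcE.
by apply: cvgD; rewrite expr2; under eq_fun do rewrite expr2; apply: cvgM.
Qed.

(** Monotonicity of [m] is not asked for: [m n] will be a number of groups picked by choice, known
    only to be at least [n]. *)
Lemma ccvg_subseq u l (m : nat -> nat) : (forall n, (n <= m n)%N) ->
  ccvg u l -> ccvg (fun n => u (m n)) l.
Proof.
move=> mn [u1 u2].
have H : m @ \oo --> \oo.
  move=> A [N _ HN]; exists N => // n /= Nn; apply: HN => /=.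
  exact: leq_trans Nn (mn n).
split.
  exact: (@cvg_comp _ _ _ m (fun n => complex.Re (u n)) _ _ _ H u1).
exact: (@cvg_comp _ _ _ m (fun n => complex.Im (u n)) _ _ _ H u2).
Qed.

Lemma ccvg_shift u l (N : nat) : ccvg (fun n => u (N + n)%N) l <-> ccvg u l.
Proof.
have H : forall f : nat -> R, forall x : R,
    ((fun n => f (N + n)%N) @ \oo --> x) <-> (f @ \oo --> x).
  move=> f x; rewrite (_ : (fun n => f (N + n)%N) = [sequence f (n + N)%N]_n).
    by rewrite cvg_shiftn.
  by apply/funext => n; rewrite addnC.
split=> -[h1 h2]; split.
- exact/(H (fun n => complex.Re (u n))).
- exact/(H (fun n => complex.Im (u n))).
- exact/(H (fun n => complex.Re (u n))).
- exact/(H (fun n => complex.Im (u n))).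
Qed.

Lemma ccvg_le u l (B : R) : (forall n, normc (u n) <= B) -> ccvg u l -> normc l <= B.
Proof.
move=> uB /ccvg_sqr_normc ul.
have B0 : 0 <= B := le_trans (normc_ge0 _) (uB 0%N).
rewrite -(@ler_pXn2r _ 2)// ?nnegrE ?normc_ge0//.
apply: (cvgr_to_le ul); apply: nearW => n.
by rewrite ler_pXn2r// ?nnegrE ?normc_ge0.
Qed.

Lemma ccvg_ge u l (B : R) : 0 <= B -> (forall n, B <= normc (u n)) -> ccvg u l ->
  B <= normc l.
Proof.
move=> B0 uB /ccvg_sqr_normc ul.
rewrite -(@ler_pXn2r _ 2)// ?nnegrE ?normc_ge0//.
apply: (cvgr_to_ge ul); apply: nearW => n.
by rewrite ler_pXn2r// ?nnegrE ?normc_ge0.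
Qed.

Lemma cvg_of_summable_steps (x : nat -> R) b : bounded_series b ->
  (forall n, `|x n.+1 - x n| <= b n) -> exists l : R, x @ \oo --> l.
Proof.
move=> bb xb; apply/cvg_ex.
have -> : x = (fun n => x 0%N + series (telescope x) n).
  by apply/funext => n; rewrite -eq_sum_telescope.
apply: is_cvgD; first exact: is_cvg_cst.
apply: normed_cvg; apply: (@series_le_cvg _ _ b) => //.
- by move=> n; exact: normr_ge0.
- by case: bb.
- exact: bounded_series_cvg.
Qed.

Lemma ccvg_of_summable_steps u b : bounded_series b ->
  (forall n, normc (u n.+1 - u n) <= b n) -> exists l, ccvg u l.
Proof.
move=> bb ub.
have [|k flux_majorant] := @cvg_of_summable_steps (fun n => complex.Re (u n)) b bb.
  by move=> n; rewrite (le_trans _ (ub n))// -Re_opp -Re_add normRe_le.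
have [|l hl] := @cvg_of_summable_steps (fun n => complex.Im (u n)) b bb.
  by move=> n; rewrite (le_trans _ (ub n))// -Im_opp -Im_add normIm_le.
by exists (k +i* l).
Qed.

(** Past an index [N] the deviations from 1 add up to at most 1/2, and there the product of the
    moduli is at least 1 minus their sum. So the partial products never drop below half of the
    nonzero [p N]. *)
Lemma inf_prod_neq0 u l : (forall n, u n != 0) ->
  bounded_series (fun n => normc (u n - 1)) ->
  ccvg (fun n => \prod_(0 <= i < n) u i) l -> l != 0.
Proof.
move=> u0 ub ul.
have h2 : 0 < (2^-1 : R) by rewrite invr_gt0.
have [N HN] := bounded_series_tail ub h2.
set p := fun n => \prod_(0 <= i < n) u i in ul.
have pN m : normc (p N) * (1 - \sum_(N <= i < N + m) normc (u i - 1)) <=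
    normc (p (N + m)%N).
  elim: m => [|m ih]; first by rewrite addn0 big_geq// subr0 mulr1.
  rewrite addnS /p !big_nat_recr ?leq_addr//= normcM.
  set t := \sum_(_ <= _ < _) _ in ih *; set x := normc (u _ - 1).
  have xu : 1 - x <= normc (u (N + m)%N).
    have := ge_normcB 1 (1 - u (N + m)%N).
    by rewrite subKr normc1 (normcBC 1).
  have x0 : 0 <= x := normc_ge0 _.
  have t0 : 0 <= t by apply: sumr_ge0 => i _; exact: normc_ge0.
  have : t + x <= 2^-1.
    by move: (HN m.+1); rewrite addnS big_nat_recr ?leq_addr.
  move=> tx; apply: (@le_trans _ _ (normc (p N) * (1 - t) * (1 - x))); last first.
    rewrite ler_pM// ?mulr_ge0 ?normc_ge0//; [by lra|by lra].
  rewrite -mulrA ler_wpM2l ?normc_ge0//; nra.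
have p0 : p N != 0 by rewrite prodf_seq_neq0; apply/allP => i _; rewrite u0 implybT.
rewrite -normc_gt0; apply: (@lt_le_trans _ _ (normc (p N) / 2)).
  by rewrite divr_gt0// normc_gt0.
move/(ccvg_shift p l N): ul; apply: ccvg_ge; first by rewrite divr_ge0// normc_ge0.
move=> n; apply: le_trans (pN n); rewrite ler_wpM2l ?normc_ge0//.
by have := HN n; lra.
Qed.

End ComplexSequences.

(** * Functions with explicit derivatives, and the convergence of their products *)

Section Jets.
Context {R : realType}.

(** The derivatives are formal data computed by algebraic rules; [jet_at] says where they are true
    derivatives. The second order bounds Taylor remainders in limits and enters the partial
    derivatives in Green's formula. *)
Record jet := Jet { j0 : R[i] -> R[i]; j1 : R[i] -> R[i]; j2 : R[i] -> R[i] }.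

Implicit Types (J : jet) (G : nat -> jet) (z w : R[i]).

(** Differentiability of [j2] provides its continuity, needed for the integrands of Green's
    formula. *)
Definition jet_at J z := [/\ qdiff (j0 J) z (j1 J z), qdiff (j1 J) z (j2 J z)
  & exists d, qdiff (j2 J) z d].

(* half of the second derivative makes this norm submultiplicative *)
Definition jsize J z := normc (j0 J z) + normc (j1 J z) + normc (j2 J z) / 2.

Definition jcst (c : R[i]) := Jet (fun=> c) (fun=> 0) (fun=> 0).

Definition jadd J K := Jet (fun z => j0 J z + j0 K z)
  (fun z => j1 J z + j1 K z) (fun z => j2 J z + j2 K z).

Definition jmul J K := Jet (fun z => j0 J z * j0 K z)
  (fun z => j1 J z * j0 K z + j0 J z * j1 K z)
  (fun z => j2 J z * j0 K z + 2 * (j1 J z * j1 K z) + j0 J z * j2 K z).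

Definition jinv J := Jet (fun z => (j0 J z)^-1)
  (fun z => - (j1 J z * (j0 J z)^-1 ^+ 2))
  (fun z => 2 * (j1 J z ^+ 2 * (j0 J z)^-1 ^+ 3) - j2 J z * (j0 J z)^-1 ^+ 2).

Definition jclog J := Jet (fun z => clog (j0 J z))
  (fun z => j1 J z * (j0 J z)^-1)
  (fun z => j2 J z * (j0 J z)^-1 - j1 J z ^+ 2 * (j0 J z)^-1 ^+ 2).

Fixpoint jprod G n := if n is m.+1 then jmul (jprod G m) (G m) else jcst 1.

Lemma jsize_ge0 J z : 0 <= jsize J z.
Proof. by rewrite !addr_ge0 ?divr_ge0 ?normc_ge0. Qed.

Lemma jet_at_cst c z : jet_at (jcst c) z.
Proof. by split=> /=; [exact: qdiff_cst|exact: qdiff_cst|exists 0; exact: qdiff_cst]. Qed.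

Lemma jet_at_add J K z : jet_at J z -> jet_at K z -> jet_at (jadd J K) z.
Proof.
move=> [a b [c d]] [e f [g h]].
by split=> /=; [exact: qdiffD|exact: qdiffD|exists (c + g); exact: qdiffD].
Qed.

Lemma jet_at_mul J K z : jet_at J z -> jet_at K z -> jet_at (jmul J K) z.
Proof.
move=> [a b [c d]] [e f [g h]]; split=> /=.
- exact: qdiffM.
- by apply: qdiff_eq; [apply: qdiffD; apply: qdiffM; eassumption|ring].
- eexists; apply: qdiffD; last by apply: qdiffM; eassumption.
  apply: qdiffD; first by apply: qdiffM; eassumption.
  by apply: qdiffM; [exact: qdiff_cst|apply: qdiffM; eassumption].
Qed.

Let qdiffN (f : R[i] -> R[i]) z d : qdiff f z d -> qdiff (fun x => - f x) z (- d).
Proof.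
move=> qf; have := qdiffM (qdiff_cst (-1) z) qf.
rewrite mul0r add0r mulN1r; congr qdiff.
by apply/funext => x; rewrite mulN1r.
Qed.

Let qdiffX (f : R[i] -> R[i]) z d n : qdiff f z d ->
  exists d', qdiff (fun x => f x ^+ n) z d'.
Proof.
move=> qf; elim: n => [|n [d' ih]]; first by exists 0; exact: qdiff_cst.
eexists; rewrite (_ : (fun x => _) = fun x => f x * f x ^+ n).
  by apply: qdiffM; eassumption.
by apply/funext => x; rewrite exprS.
Qed.

Lemma jet_at_inv J z : j0 J z != 0 -> jet_at J z -> jet_at (jinv J) z.
Proof.
move=> n0 [a b [c d]].
have q1 : qdiff (j0 (jinv J)) z (j1 (jinv J) z).
  by apply: qdiff_eq; [apply: (qdiff_comp (qdiffV n0) a)|rewrite /=; field].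
have [e q2] := qdiffX 2 q1; have [f q3] := qdiffX 3 q1; have [g q4] := qdiffX 2 b.
split=> //.
  have q5 : qdiff (fun x => (j0 J x)^-1 ^+ 2) z
      (j1 (jinv J) z * (j0 J z)^-1 + (j0 J z)^-1 * j1 (jinv J) z).
    rewrite (_ : (fun x => _) = fun x => j0 (jinv J) x * j0 (jinv J) x) //.
    exact: qdiffM.
  by apply: qdiff_eq; [apply/qdiffN/(qdiffM b q5)|rewrite /=; field].
eexists; apply: qdiffD; last by apply/qdiffN/qdiffM; eassumption.
by apply: qdiffM; [exact: qdiff_cst|apply: qdiffM; eassumption].
Qed.

Lemma jet_at_clog J z : 0 < complex.Re (j0 J z) -> jet_at J z -> jet_at (jclog J) z.
Proof.
move=> p0 [a b [c d]].
have n0 : j0 J z != 0.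
  by rewrite -normc_gt0 (lt_le_trans p0)// (le_trans _ (normRe_le _))// ler_norm.
have [i0 i1 [i2 i3]] := jet_at_inv n0 (And3 a b (ex_intro _ c d)).
have [g q4] := qdiffX 2 b; have [e q2] := qdiffX 2 i0.
split=> /=.
- by apply: qdiff_eq; [apply: (qdiff_comp (qdiff_clog p0) a)|rewrite mulrC].
- apply: qdiff_eq; [apply: (qdiffM b i0)|rewrite /=; ring].
- eexists; apply: qdiffD; last by apply/qdiffN/qdiffM; eassumption.
  by apply: qdiffM; eassumption.
Qed.

Lemma jet_at_prod G n z : (forall i, (i < n)%N -> jet_at (G i) z) -> jet_at (jprod G n) z.
Proof.
elim: n => [_|n ih H]; first exact: jet_at_cst.
by apply: jet_at_mul; [apply: ih => i ni; apply: H; exact: ltnW|exact: H].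
Qed.

Lemma jsize_mul J K z : jsize (jmul J K) z <= jsize J z * jsize K z.
Proof.
have h2 : normc (2 : R[i]) = 2 by rewrite (_ : 2 = (2 : R)%:C) ?normc_realE ?ger0_norm// rmorphMn.
rewrite /jsize /= normcM.
set a := normc (j0 J z); set b := normc (j1 J z); set c := normc (j2 J z).
set d := normc (j0 K z); set e := normc (j1 K z); set f := normc (j2 K z).
have s1 : normc (j1 J z * j0 K z + j0 J z * j1 K z) <= b * d + a * e.
  by rewrite (le_trans (le_normcD _ _))// !normcM.
have s2 : normc (j2 J z * j0 K z + 2 * (j1 J z * j1 K z) + j0 J z * j2 K z)
    <= c * d + 2 * (b * e) + a * f.
  apply: (le_trans (le_normcD _ _)); rewrite (normcM (j0 J z)) lerD2r.
  by rewrite (le_trans (le_normcD _ _))// !normcM h2.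
have bf : 0 <= b * f by rewrite mulr_ge0 ?normc_ge0.
have ce : 0 <= c * e by rewrite mulr_ge0 ?normc_ge0.
have cf : 0 <= c * f by rewrite mulr_ge0 ?normc_ge0.
have -> : (a + b + c / 2) * (d + e + f / 2) = a * d + (b * d + a * e) +
    (c * d + 2 * (b * e) + a * f) / 2 + (b * f / 2 + c * e / 2 + c * f / 4) by field.
lra.
Qed.

Lemma jsize_add J K z : jsize (jadd J K) z <= jsize J z + jsize K z.
Proof.
rewrite /jsize /=.
have := le_normcD (j0 J z) (j0 K z); have := le_normcD (j1 J z) (j1 K z).
have := le_normcD (j2 J z) (j2 K z); lra.
Qed.

Lemma jsize_cst c z : jsize (jcst c) z = normc c.
Proof. by rewrite /jsize [j0 _ _]/= [j1 _ _]/= [j2 _ _]/= normc0 mul0r !addr0. Qed.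

Lemma jprod_prod G n z : j0 (jprod G n) z = \prod_(0 <= i < n) j0 (G i) z.
Proof.
elim: n => [|n ih]; first by rewrite big_geq.
by rewrite big_nat_recr//= ih.
Qed.

(** The shape that drives convergence: [s] runs through a summable sequence and [J] through a
    locally bounded family. With [s = 0] the factor is switched off without changing the product's
    indexing. *)
Definition near_one (s : R) J := jadd (jcst 1) (jmul (jcst s%:C) J).

(** [jsize] is submultiplicative and [1 + x <= expR x]. *)
Lemma jsize_prod_near_one (s : nat -> R) G n z (C : R) : 0 <= C ->
  (forall n, 0 <= s n) -> (forall n, jsize (G n) z <= C) ->
  jsize (jprod (fun i => near_one (s i) (G i)) n) z <=
    expR (C * \sum_(0 <= i < n) s i).
Proof.
move=> C0 s0 GC; elim: n => [|n ih].
  by rewrite big_geq// mulr0 expR0 jsize_cst normc1.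
rewrite [jprod _ _]/=; apply: (le_trans (jsize_mul _ _ _)).
rewrite big_nat_recr// [C * _]mulrDr expRD.
apply: ler_pM; rewrite ?jsize_ge0//.
apply: le_trans (expR_ge1Dx _).
apply: (le_trans (jsize_add _ _ _)); rewrite jsize_cst normc1 lerD2l.
apply: (le_trans (jsize_mul _ _ _)); rewrite jsize_cst normc_realE ger0_norm// mulrC.
by rewrite ler_wpM2r.
Qed.

Lemma le_j0_jsize J z : normc (j0 J z) <= jsize J z.
Proof. by rewrite /jsize -addrA lerDl addr_ge0 ?divr_ge0 ?normc_ge0. Qed.

Lemma le_j1_jsize J z : normc (j1 J z) <= jsize J z.
Proof. by rewrite /jsize addrAC lerDr addr_ge0 ?divr_ge0 ?normc_ge0. Qed.

Lemma le_j2_jsize J z : normc (j2 J z) <= 2 * jsize J z.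
Proof.
by rewrite /jsize; have := normc_ge0 (j0 J z); have := normc_ge0 (j1 J z); lra.
Qed.

Definition loc_bounded G := forall rho : R, rho < 1 -> exists C, 0 <= C /\
  forall n z, normc z <= rho -> jsize (G n) z <= C.

Definition jet_on_disc J := forall z, unit_disc z -> jet_at J z.

Lemma near_one_jet s J : jet_on_disc J -> jet_on_disc (near_one s J).
Proof.
move=> HJ z dz; apply: jet_at_add (jet_at_cst _ _) _.
by apply: jet_at_mul (jet_at_cst _ _) _; exact: HJ.
Qed.

(** Consecutive partial products differ by [P n * s n * G n], whose [jsize] is at most
    [M * C * s n], so values and first derivatives converge pointwise. That the limit of the
    derivatives is the derivative of the limit follows by passing to the limit in [qdiff_taylor],
    whose constant is the same for all [n]. *)
Lemma infinite_product (s : nat -> R) G :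
  bounded_series s -> (forall n, jet_on_disc (G n)) -> loc_bounded G ->
  exists F F' : R[i] -> R[i], forall z, unit_disc z ->
   [/\ qdiff F z (F' z),
    ccvg (fun n => j0 (jprod (fun i => near_one (s i) (G i)) n) z) (F z) &
    ccvg (fun n => j1 (jprod (fun i => near_one (s i) (G i)) n) z) (F' z)].
Proof.
move=> bs JG lG; have [s0 [S HS]] := bs.
set P := jprod _.
have bound rho : rho < 1 -> exists C M, [/\ 0 <= C, 0 <= M,
    forall n z, normc z <= rho -> jsize (G n) z <= C &
    forall n z, normc z <= rho -> jsize (P n) z <= M].
  move=> /lG[C [C0 HC]]; exists C, (expR (C * S)); split; rewrite ?expR_ge0//.
  move=> n z zr; apply: (le_trans (jsize_prod_near_one _ C0 s0 (fun k => HC k z zr))).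
  by rewrite ler_expR ler_wpM2l.
have step z : unit_disc z -> exists b : nat -> R, bounded_series b /\
   forall n, normc (j0 (P n.+1) z - j0 (P n) z) <= b n /\
             normc (j1 (P n.+1) z - j1 (P n) z) <= b n.
  move=> /bound[C [M [C0 M0 HC HM]]].
  exists (fun n => M * C * s n); split; first by apply: bounded_seriesZ; rewrite ?mulr_ge0.
  move=> n.
  have H : jsize (jmul (P n) (jmul (jcst (s n)%:C) (G n))) z <= M * C * s n.
    apply: (le_trans (jsize_mul _ _ _)); rewrite -mulrA ler_pM ?jsize_ge0//.
      exact: HM.
    apply: (le_trans (jsize_mul _ _ _)); rewrite jsize_cst normc_realE ger0_norm// mulrC.
    by rewrite ler_wpM2r//; exact: HC.
  split.
    apply: le_trans H; apply: le_trans (le_j0_jsize _ _).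
    by rewrite le_eqVlt; apply/orP; left; apply/eqP; congr normc; rewrite /=; ring.
  apply: le_trans H; apply: le_trans (le_j1_jsize _ _).
  by rewrite le_eqVlt; apply/orP; left; apply/eqP; congr normc; rewrite /=; ring.
have lim z : exists l : R[i] * R[i], unit_disc z ->
    ccvg (fun n => j0 (P n) z) l.1 /\ ccvg (fun n => j1 (P n) z) l.2.
  have [dz|ndz] := pselect (unit_disc z); last by exists (0, 0) => /ndz.
  have [b [bb Hb]] := step z dz.
  have [k flux_majorant] := ccvg_of_summable_steps bb (fun n => (Hb n).1).
  have [l hl] := ccvg_of_summable_steps bb (fun n => (Hb n).2).
  by exists (k, l).
have [FF HFF] := choice lim.
exists (fst \o FF), (snd \o FF) => z dz.
have [h0 h1] := HFF z dz; split=> //.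
(* The midpoint between [normc z] and 1: increments shorter than [rho - normc z] stay in a smaller
   disc, on which the partial products are uniformly bounded. *)
pose rho := (1 + normc z) / 2.
have z1 : normc z < 1 by [].
have rho1 : rho < 1 by rewrite /rho; lra.
have [C [M [C0 M0 HC HM]]] := bound rho rho1.
(* The 4 is that of [qdiff_taylor]; [2 * M] bounds the second derivative, which [jsize] counts by
   half. *)
exists (4 * (2 * M)), (rho - normc z); split.
- by rewrite !mulr_ge0.
- by rewrite /rho; lra.
move=> h hz.
have zh : normc (z + h) <= rho.
  by rewrite (le_trans (le_normcD _ _))//; lra.
have dzh : unit_disc (z + h) by rewrite /unit_disc /= (le_lt_trans zh).
have [k0 _] := HFF _ dzh.
have lc : ccvg (fun n => j0 (P n) (z + h) - j0 (P n) z - h * j1 (P n) z)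
    ((FF (z + h)).1 - (FF z).1 - h * (FF z).2).
  apply: ccvgD; first by apply: ccvgD => //; apply: ccvgN.
  by apply/ccvgN/ccvgM => //; exact: ccvg_cst.
apply: (ccvg_le _ lc) => n.
have := @qdiff_taylor _ (j0 (P n)) (j1 (P n)) (j2 (P n)) z (z + h) (2 * M).
rewrite [z + h]addrC addrK => /(_ _)-> //; first by rewrite mulr_ge0.
move=> t t01.
have sr : normc (segment_pt z (h + z) t) <= rho.
  rewrite /segment_pt addrK (le_trans (le_normcD _ _))//.
  by have := normc_itv h t01; lra.
have [|q0 q1 _] := @jet_at_prod (fun i => near_one (s i) (G i)) n (segment_pt z (h + z) t).
  move=> i _; apply: near_one_jet; first exact: JG.
  by rewrite /unit_disc /= (le_lt_trans sr).
split=> //.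
by rewrite (le_trans (le_j2_jsize _ _))// ler_wpM2l//; exact: HM.
Qed.

End Jets.

(** * Blaschke and logarithmic factors *)

Section Factors.
Context {R : realType}.
Implicit Types (z w c : R[i]).

Lemma conjc_mul z w : (z * w)^* = z^* * w^*. Proof. exact: rmorphM. Qed.
Lemma conjc_sub z w : (z - w)^* = z^* - w^*. Proof. exact: rmorphB. Qed.

Lemma mulc_conj z : z * z^* = (normc z ^+ 2)%:C.
Proof. by rewrite -sqr_normc normc_normE rmorphXn. Qed.

Lemma unit_conj c : normc c = 1 -> c * c^* = 1.
Proof. by move=> c1; rewrite mulc_conj c1 expr1n. Qed.

Definition jaff (c d : R[i]) : jet := Jet (fun z => c + d * z) (fun=> d) (fun=> 0).

Lemma jet_at_aff c d z : jet_at (jaff c d) z.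
Proof.
split=> /=; [|exact: qdiff_cst|by exists 0; exact: qdiff_cst].
by apply: qdiff_eq; [apply: qdiffD (qdiff_cst _ _) (qdiffM (qdiff_cst _ _) (qdiff_id _))|rewrite /=; ring].
Qed.

(* Half the radial derivative of [|f|^2] at [z]; on the circle its mean is the
   Dirichlet integral of [f]. *)
Definition flux (J : jet) z : R := complex.Re (z * j1 J z * (j0 J z)^*).

Lemma flux_mul J K z :
  flux (jmul J K) z = flux J z * normc (j0 K z) ^+ 2 + flux K z * normc (j0 J z) ^+ 2.
Proof.
rewrite /flux /=.
have -> : z * (j1 J z * j0 K z + j0 J z * j1 K z) * (j0 J z * j0 K z)^* =
   z * j1 J z * (j0 J z)^* * (normc (j0 K z) ^+ 2)%:C +
   z * j1 K z * (j0 K z)^* * (normc (j0 J z) ^+ 2)%:C.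
  by rewrite -!mulc_conj conjc_mul; ring.
by rewrite Re_add !(Re_mul _ (_%:C)) /= !mulr0 !subr0.
Qed.

(* The Blaschke factor [(r - c z) / (1 - r c z)], with zero [r c^*], written as
   [1 - (1 - r) (1 + c z) / (1 - r c z)] to exhibit its distance to [1]. *)
Definition bl_e (r : R) c : jet :=
  jmul (jaff (-1) (- c)) (jinv (jaff 1 (- (r%:C * c)))).

Definition bl (r : R) c : jet := near_one (1 - r) (bl_e r c).

Section Blaschke.
Variables (r : R) (c : R[i]).
Hypotheses (r01 : 0 <= r < 1) (c1 : normc c = 1).

Let r0 : 0 <= r. Proof. by case/andP: r01. Qed.
Let r1 : r < 1. Proof. by case/andP: r01. Qed.

Lemma bl_den_ge z (rho : R) : normc z <= rho -> 1 - r * rho <= normc (1 - r%:C * c * z).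
Proof.
move=> zr; apply: le_trans (ge_normcB _ _).
rewrite normc1 !normcM c1 mulr1 normc_realE ger0_norm//.
by rewrite lerD2l lerN2 ler_wpM2l.
Qed.

Lemma bl_den_neq0 z : normc z <= 1 -> 1 - r%:C * c * z != 0.
Proof.
by move=> /bl_den_ge; rewrite mulr1 -normc_gt0; apply: lt_le_trans; rewrite subr_gt0.
Qed.

Lemma bl_e_jet z : normc z <= 1 -> jet_at (bl_e r c) z.
Proof.
move=> z1; apply: jet_at_mul (jet_at_aff _ _ _) _.
by apply: jet_at_inv (jet_at_aff _ _ _); rewrite /= mulNr bl_den_neq0.
Qed.

Lemma blE0 z : normc z <= 1 ->
  j0 (bl r c) z = (r%:C - c * z) / (1 - r%:C * c * z).
Proof.
move=> /bl_den_neq0 u0; rewrite /= rmorphB /= real_complex1 (mulNr (_ * c)).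
by field.
Qed.

Lemma blE1 z : normc z <= 1 ->
  j1 (bl r c) z = - (c * (1 - r%:C ^+ 2) / (1 - r%:C * c * z) ^+ 2).
Proof.
move=> /bl_den_neq0 u0; rewrite /= rmorphB /= real_complex1 (mulNr (_ * c)).
by field.
Qed.

(** With [w = c z], [|1 - r w|^2 - |r - w|^2 = (1 - r^2) (1 - |w|^2)]. *)
Lemma bl_le1 z : normc z <= 1 -> normc (j0 (bl r c) z) <= 1.
Proof.
move=> z1; rewrite blE0// normcM normcV ler_pdivrMr ?normc_gt0 ?bl_den_neq0// mul1r.
rewrite -(@ler_pXn2r _ 2)// ?nnegrE ?normc_ge0//.
have cz1 : normc (c * z) ^+ 2 <= 1 by rewrite normcM c1 mul1r expr_le1// normc_ge0.
rewrite -mulrA; move: cz1; case: (c * z) => a b.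
rewrite !sqr_normcE /= => cz1.
have r2 : r ^+ 2 <= 1 by rewrite expr_le1// ltW.
have : 0 <= (1 - r ^+ 2) * (1 - (a ^+ 2 + b ^+ 2)).
  by rewrite mulr_ge0// subr_ge0.
rewrite !mul0r !subr0 !sub0r ?addr0; lra.
Qed.

(** On the circle the factor has modulus 1 and its flux is the Poisson kernel of its zero
    [r c^*]. *)
Lemma bl_flux z : normc z = 1 ->
  flux (bl r c) z = (1 - r ^+ 2) / normc (1 - r%:C * c * z) ^+ 2.
Proof.
move=> z1; have zle : normc z <= 1 by rewrite z1.
have u0 := bl_den_neq0 zle.
rewrite /flux blE0// blE1//.
set u := 1 - _ in u0 *.
have uJ0 : u^* != 0 by rewrite conjc_eq0.
have zc : c * z * (c * z)^* = 1 by rewrite unit_conj// normcM c1 z1 mulr1.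
have uE : u = 1 - r%:C * (c * z) by rewrite /u mulrA.
have -> : z * - (c * (1 - r%:C ^+ 2) / u ^+ 2) * ((r%:C - c * z) / u)^* =
    ((1 - r ^+ 2) / normc u ^+ 2)%:C.
  have -> : ((1 - r ^+ 2) / normc u ^+ 2)%:C = (1 - r%:C ^+ 2) / (u * u^*).
    by rewrite mulc_conj [LHS]rmorphM /= fmorphV rmorphB /= rmorphXn real_complex1.
  have -> : ((r%:C - c * z) / u)^* = (r%:C - (c * z)^*) / u^*.
    by rewrite conjc_mul conjc_sub conjc_real conjc_inv.
  have -> : z * - (c * (1 - r%:C ^+ 2) / u ^+ 2) * ((r%:C - (c * z)^*) / u^*) =
     (1 - r%:C ^+ 2) * (c * z * (c * z)^* - r%:C * (c * z)) / (u ^+ 2 * u^*).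
    by field; rewrite u0 uJ0.
  by rewrite zc -uE; field; rewrite u0 uJ0.
by [].
Qed.

Lemma bl_den_dist z : normc z = 1 ->
  normc (1 - r%:C * c * z) = normc (z - r%:C * c^*).
Proof.
move=> z1.
have -> : 1 - r%:C * c * z = c * z * (c * (z - r%:C * c^*))^*.
  have zz := unit_conj z1; have cc := unit_conj c1.
  rewrite !conjc_mul conjc_sub conjc_mul conjcK conjc_real.
  rewrite (_ : c * z * (c^* * (z^* - r%:C * c)) =
    (c * c^*) * (z * z^*) - (c * c^*) * (r%:C * c * z)); last by ring.
  by rewrite zz cc !mul1r.
by rewrite !normcM normc_conj normcM c1 z1 !mul1r.
Qed.

(* In a Stolz angle [|l - z| <= 2 K |z - a|] on the circle, which compares the
   Poisson kernels of all zeros with that of the vertex. *)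
Lemma bl_flux_stolz z (l : R[i]) (K : R) : normc z = 1 -> 1 < K ->
  normc (l - r%:C * c^*) <= K * (1 - r) ->
  normc (l - z) ^+ 2 * flux (bl r c) z <= 8 * K ^+ 2 * (1 - r).
Proof.
move=> z1 K1 lK; have zle : normc z <= 1 by rewrite z1.
have u0 : 0 < normc (1 - r%:C * c * z) by rewrite normc_gt0 bl_den_neq0.
rewrite bl_flux// mulrA ler_pdivrMr ?exprn_gt0//.
have ur : 1 - r <= normc (1 - r%:C * c * z) by have := bl_den_ge zle; rewrite mulr1.
set u := normc (1 - _) in u0 ur *.
have lz : normc (l - z) <= 2 * K * u.
  have -> : l - z = (l - r%:C * c^*) - (z - r%:C * c^*) by ring.
  apply: (le_trans (le_normcB _ _)); rewrite -(bl_den_dist z1) -/u.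
  have : K * (1 - r) <= K * u by rewrite ler_wpM2l//; lra.
  have : u <= K * u by rewrite ler_peMl ?ltW//.
  lra.
have h : normc (l - z) ^+ 2 <= (2 * K * u) ^+ 2.
  by rewrite ler_pXn2r// nnegrE ?normc_ge0// !mulr_ge0 ?ltW//; lra.
have r2 : 0 <= 1 - r ^+ 2 by rewrite subr_ge0 expr_le1// ltW.
apply: (@le_trans _ _ ((2 * K * u) ^+ 2 * (1 - r ^+ 2))); first by rewrite ler_wpM2r.
(* Splitting [1 - r^2] as [(1 - r) (1 + r)] with [1 + r <= 2] is what turns the constant 4 into
   8. *)
have -> : (2 * K * u) ^+ 2 * (1 - r ^+ 2) = 4 * K ^+ 2 * (1 - r) * u ^+ 2 * (1 + r) by ring.
have -> : 8 * K ^+ 2 * (1 - r) * u ^+ 2 = 4 * K ^+ 2 * (1 - r) * u ^+ 2 * 2 by ring.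
apply: ler_wpM2l; last first.
  by rewrite (natrD _ 1 1) lerD2l ltW.
by apply: mulr_ge0 (sqr_ge0 _); apply: mulr_ge0; [apply: mulr_ge0 (sqr_ge0 _)|rewrite subr_ge0 ltW].
Qed.

Lemma bl_flux_ge0 z : normc z = 1 -> 0 <= flux (bl r c) z.
Proof.
by move=> z1; rewrite bl_flux// divr_ge0 ?sqr_ge0// subr_ge0 expr_le1// ltW.
Qed.

End Blaschke.

Lemma jsize_aff_le (a d : R[i]) z : normc z <= 1 -> jsize (jaff a d) z <= normc a + 2 * normc d.
Proof.
move=> z1; rewrite /jsize [j0 _ _]/= [j1 _ _]/= [j2 _ _]/= normc0 mul0r addr0.
have := le_normcD a (d * z); rewrite normcM.
have : normc d * normc z <= normc d by rewrite ler_piMr ?normc_ge0.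
lra.
Qed.

Lemma jsize_inv_aff_le (a d : R[i]) z (q : R) : 0 < q -> normc d <= 1 ->
  q <= normc (a + d * z) -> jsize (jinv (jaff a d)) z <= q^-1 + q^-1 ^+ 2 + q^-1 ^+ 3.
Proof.
move=> q0 d1 qu; rewrite /jsize /=.
have u0 : 0 < normc (a + d * z) := lt_le_trans q0 qu.
set u := a + d * z in qu u0 *.
have n0 := @normc_ge0 R.
have iu : normc u^-1 <= q^-1 by rewrite normcV lef_pV2// posrE.
have n2 : normc (2 : R[i]) = 2.
  by rewrite (_ : 2 = (2 : R)%:C) ?normc_realE ?ger0_norm// rmorphMn.
have p n : normc u^-1 ^+ n <= q^-1 ^+ n by rewrite lerXn2r// nnegrE// invr_ge0 ltW.
rewrite mul0r subr0 normcN (normcM d) (normcM 2) (normcM (d ^+ 2)) !normcX n2.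
have h1 : normc d * normc u^-1 ^+ 2 <= q^-1 ^+ 2.
  by rewrite (le_trans _ (p 2))// ler_piMl ?exprn_ge0.
have h2 : normc d ^+ 2 * normc u^-1 ^+ 3 <= q^-1 ^+ 3.
  by rewrite (le_trans _ (p 3))// ler_piMl ?exprn_ge0// expr_le1.
lra.
Qed.

Lemma loc_bounded_bl_e (r : nat -> R) (c : nat -> R[i]) :
  (forall n, 0 <= r n < 1) -> (forall n, normc (c n) = 1) ->
  loc_bounded (fun n => bl_e (r n) (c n)).
Proof.
move=> r01 c1 rho rho1.
(* [loc_bounded] admits negative [rho]; the lower bound [1 - r * m >= 1 - m] for the denominator
   requires [m >= 0]. *)
set q := 1 - Num.max rho 0.
have q0 : 0 < q by rewrite /q subr_gt0 gt_max rho1 ltr01.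
have Q0 : 0 <= q^-1 + q^-1 ^+ 2 + q^-1 ^+ 3.
  by rewrite !addr_ge0 ?exprn_ge0// invr_ge0 ltW.
exists (3 * (q^-1 + q^-1 ^+ 2 + q^-1 ^+ 3)); split; first by rewrite mulr_ge0.
move=> n z zr; have z1 : normc z <= 1 by rewrite (le_trans zr)// ltW.
have /andP[rn0 rn1] := r01 n.
apply: (le_trans (jsize_mul _ _ _)); apply: ler_pM; rewrite ?jsize_ge0//.
  apply: (le_trans (jsize_aff_le _ _ z1)); rewrite !normcN normc1 c1; lra.
have dn : normc (- ((r n)%:C * c n)) <= 1.
  by rewrite normcN normcM c1 mulr1 normc_realE ger0_norm// ltW.
apply: jsize_inv_aff_le => //.
rewrite mulNr; apply: (le_trans _ (bl_den_ge (r01 n) (c1 n) (_ : normc z <= Num.max rho 0))).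
  have m0 : 0 <= Num.max rho 0 by rewrite le_max lexx orbT.
  by rewrite /q lerD2l lerN2 ler_piMl// ltW.
by rewrite le_max zr.
Qed.

End Factors.

(** * The logarithmic factor *)

Section LogFactor.
Context {R : realType}.
Implicit Types (z w : R[i]).

Lemma norm_atan_le (x : R) : `|atan x| <= `|x|.
Proof.
wlog x0 : x / 0 <= x => [H|].
  have [/H//|/ltW x0] := leP 0 x.
  by rewrite -normrN -[leRHS]normrN -atanN H// oppr_ge0.
have a0 : 0 <= atan x by rewrite -atan0 le_atan.
rewrite !ger0_norm//.
have [||t _] := @MVT_segment _ (@atan R) (fun x => (1 + x ^+ 2)^-1) 0 x => //.
  by apply: derivable_within_continuous => t _; exact: derivable_atan.
rewrite atan0 !subr0 => ->; rewrite ler_piMl// invf_le1 ?ltr_wpDr ?sqr_ge0//.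
by rewrite lerDl sqr_ge0.
Qed.

Lemma atan_mul_ge0 (x : R) : 0 <= x * atan x.
Proof.
have [x0|/ltW x0] := leP 0 x.
  by rewrite mulr_ge0// -atan0 le_atan.
by rewrite mulr_le0// -atan0 le_atan.
Qed.

Lemma norm_atan_pi2 (x : R) : `|atan x| <= pi / 2.
Proof. by rewrite ler_norml !ltW ?atan_gtNpi2 ?atan_ltpi2. Qed.

Variables (d : R) (lam : R[i]).
Hypotheses (d0 : 0 < d) (lam1 : normc lam = 1).

Let pi0 : 0 < (pi : R). Proof. exact: pi_gt0. Qed.

(* [lf] is [leps * (log (1 + d - lam^* z) - ln d)]. Since [leps] normalises it to
   modulus at most [1] and [leps (ln (2 + d) - ln d + pi) = 1], it is also
   [1 + leps (log (1 + d - lam^* z) - ln (2 + d) - pi)], where the bracket is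
   locally bounded uniformly in [d]. It vanishes at [lam]. *)
Definition lnorm : R := ln ((2 + d) / d) + pi.
Definition leps : R := lnorm^-1.
Definition lv z : R[i] := (1 + d)%:C + (- lam^*) * z.
Definition ll z : R := complex.Re (clog (lv z)) - ln d.
Definition la z : R := complex.Im (clog (lv z)).
Definition lf_e : jet :=
  jadd (jclog (jaff (1 + d)%:C (- lam^*))) (jcst (- (ln (2 + d) + pi)%:C)).
Definition lf : jet := near_one leps lf_e.

Lemma ln_ratio_ge0 : 0 <= ln ((2 + d) / d).
Proof. by apply: ln_ge0; rewrite ler_pdivlMr// mul1r lerDr. Qed.

Lemma lnorm_ge_pi : pi <= lnorm.
Proof. by rewrite /lnorm lerDr ln_ratio_ge0. Qed.

Lemma leps_gt0 : 0 < leps.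
Proof. by rewrite invr_gt0 (lt_le_trans pi0 lnorm_ge_pi). Qed.

Lemma leps_ln_le : leps * (ln ((2 + d) / d) + pi) = 1.
Proof. by rewrite mulVf// gt_eqF// (lt_le_trans pi0 lnorm_ge_pi). Qed.

Lemma leps_le1 : leps <= 1.
Proof.
rewrite invf_le1 ?(lt_le_trans pi0 lnorm_ge_pi)//.
by apply: le_trans lnorm_ge_pi; have := pi_ge2 R; lra.
Qed.

Lemma norm_lam_mul z : normc (lam^* * z) = normc z.
Proof. by rewrite normcM normc_conj lam1 mul1r. Qed.

Lemma Re_lv z (rho : R) : normc z <= rho -> 1 + d - rho <= complex.Re (lv z).
Proof.
move=> zr; rewrite /lv mulNr Re_add Re_opp /= lerD2l lerN2 (le_trans _ zr)//.
by rewrite -norm_lam_mul (le_trans (ler_norm _))// normRe_le.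
Qed.

Lemma Re_lv_ge z : normc z <= 1 -> d <= complex.Re (lv z).
Proof. by move=> /Re_lv; rewrite addrAC subrr add0r. Qed.

Lemma Re_lv_gt0 z : normc z <= 1 -> 0 < complex.Re (lv z).
Proof. by move=> /Re_lv_ge; apply: lt_le_trans. Qed.

Lemma norm_lv_ge z (rho : R) : normc z <= rho -> 1 + d - rho <= normc (lv z).
Proof.
move=> /Re_lv h; rewrite (le_trans h)// (le_trans (ler_norm _))//.
exact: normRe_le.
Qed.

Lemma norm_lv_gt0 z : normc z <= 1 -> 0 < normc (lv z).
Proof. by move=> /norm_lv_ge; apply: lt_le_trans; rewrite addrAC subrr add0r. Qed.

Lemma norm_lv_le z : normc z <= 1 -> normc (lv z) <= 2 + d.
Proof.
move=> z1; rewrite /lv (le_trans (le_normcD _ _))// normcM normcN normc_conj lam1 mul1r.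
by rewrite normc_realE ger0_norm ?addr_ge0 ?(ltW d0)//; lra.
Qed.

Lemma Re_clog_lv z : normc z <= 1 -> complex.Re (clog (lv z)) = ln (normc (lv z)).
Proof.
move=> z1; rewrite /= /half_ln_sqr -sqr_normcE lnXn ?norm_lv_gt0//.
by field.
Qed.

Lemma ll_ge0 z : normc z <= 1 -> 0 <= ll z.
Proof.
move=> z1; rewrite /ll Re_clog_lv// subr_ge0 ler_ln ?posrE ?norm_lv_gt0//.
by have := norm_lv_ge z1; rewrite addrAC subrr add0r.
Qed.

Lemma ll_le z : normc z <= 1 -> ll z <= ln ((2 + d) / d).
Proof.
move=> z1; rewrite /ll Re_clog_lv// ln_div ?posrE ?addr_gt0// lerD2r.
by rewrite ler_ln ?posrE ?norm_lv_gt0 ?addr_gt0// norm_lv_le.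
Qed.

Lemma la_le z : `|la z| <= pi / 2.
Proof. exact: norm_atan_pi2. Qed.

Lemma leps_ll z : normc z <= 1 -> leps ^+ 2 * ll z <= leps.
Proof.
move=> z1; rewrite expr2 -mulrA ler_piMr ?(ltW leps_gt0)//.
rewrite -[leRHS]leps_ln_le ler_wpM2l ?(ltW leps_gt0)// (le_trans (ll_le z1))//.
by rewrite lerDl ltW.
Qed.

Lemma lf_e_jet z : normc z <= 1 -> jet_at lf_e z.
Proof.
move=> z1; apply: jet_at_add (jet_at_cst _ _).
by apply: jet_at_clog (jet_at_aff _ _ _); exact: Re_lv_gt0.
Qed.

Lemma lfE0 z : j0 lf z = leps%:C * (ll z +i* la z).
Proof.
have -> : ll z +i* la z = clog (lv z) - (ln d)%:C.
  by rewrite /ll /la; case: (clog (lv z)) => a b; apply/eqP; rewrite eq_complex /= subr0 !eqxx.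
have h : leps%:C * ((ln (2 + d) + pi)%:C - (ln d)%:C) = 1.
  rewrite -rmorphB -rmorphM /= -real_complex1; congr (_%:C).
  by rewrite -[RHS]leps_ln_le ln_div ?posrE ?addr_gt0// addrAC.
rewrite /= -/(lv z) -[X in X + _ = _]h; ring.
Qed.

Lemma lfE1 z : j1 lf z = - (leps%:C * (lam^* / lv z)).
Proof. by rewrite /= -/(lv z); ring. Qed.

Lemma norm_lf z : normc (j0 lf z) = leps * normc (ll z +i* la z).
Proof. by rewrite lfE0 normcM normc_realE ger0_norm// ltW// leps_gt0. Qed.

(** The real part lies between 0 and [ln ((2 + d) / d)] and the imaginary part is at most [pi / 2]
    in modulus; [leps] is the inverse of a number exceeding their sum. *)
Lemma lf_le1 z : normc z <= 1 -> normc (j0 lf z) <= 1.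
Proof.
move=> z1; rewrite norm_lf -[leRHS]leps_ln_le ler_wpM2l ?(ltW leps_gt0)//.
rewrite (le_trans (normc_le_ReIm _))//= lerD//.
  by rewrite ger0_norm ?ll_ge0// ll_le.
by rewrite (le_trans (la_le z))//; move: pi0; lra.
Qed.

(** Since [lv z = d + lam^* (lam - z)], with [x = |lam - z| / d] the real part is at most
    [ln (1 + x) <= x], and the angle is at most [|Im lv| / Re lv <= x] because [Re lv >= d]. The two
    coordinates give the factor 2. *)
Lemma lf_vanish z : normc z <= 1 -> normc (j0 lf z) <= 2 * leps / d * normc (lam - z).
Proof.
move=> z1; rewrite norm_lf.
have -> : 2 * leps / d * normc (lam - z) = leps * (normc (lam - z) / d + normc (lam - z) / d).
  by field; rewrite gt_eqF.
rewrite ler_wpM2l ?(ltW leps_gt0)//.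
have lvE : lv z = d%:C + lam^* * (lam - z).
  rewrite /lv mulrBr [lam^* * lam]mulrC unit_conj// [(1 + d)%:C]rmorphD /= real_complex1; ring.
have nE : normc (lam^* * (lam - z)) = normc (lam - z) by rewrite norm_lam_mul.
have t0 : 0 <= normc (lam - z) / d by rewrite divr_ge0 ?normc_ge0// ltW.
rewrite (le_trans (normc_le_ReIm _))//= lerD//.
  rewrite ger0_norm ?ll_ge0// /ll Re_clog_lv// -ln_div ?posrE ?norm_lv_gt0//.
  apply: le_trans (le_ln1Dx (lt_le_trans (ltrN10 R) t0)).
  rewrite ler_ln ?posrE ?divr_gt0 ?norm_lv_gt0 ?ltr_wpDr//.
  rewrite ler_pdivrMr// mulrDl mul1r divfK ?gt_eqF//.
  by rewrite lvE (le_trans (le_normcD _ _))// nE normc_realE ger0_norm// ltW.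
rewrite /la /= (le_trans (norm_atan_le _))// normrM ler_pM//.
  by rewrite lvE Im_add add0r -nE normIm_le.
by rewrite normfV lef_pV2 ?posrE ?normr_gt0 ?gt_eqF ?Re_lv_gt0// ger0_norm ?Re_lv_ge// ltW// Re_lv_gt0.
Qed.

(** [- lq z] is [z] times the derivative of [clog (lv z)]. *)
Definition lq z := lam^* * z / lv z.

Lemma lf_flux z : flux lf z =
  leps ^+ 2 * (- complex.Re (lq z) * ll z + - complex.Im (lq z) * la z).
Proof.
rewrite /flux lfE0 lfE1 conjc_mul conjc_real.
have -> : z * - (leps%:C * (lam^* / lv z)) * (leps%:C * (ll z +i* la z)^*) =
   (leps ^+ 2)%:C * (- lq z * (ll z +i* la z)^*).
  by rewrite [(_ ^+ 2)%:C]rmorphXn /= /lq; ring.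
rewrite Re_mul /= mul0r subr0; congr (_ * _); rewrite Re_mul Re_opp Im_opp /=; ring.
Qed.

(** This form exposes the signs: the only variable term is a positive multiple of [1 / lv z], and
    [lv z] lies in the right half-plane. *)
Lemma lqE z : normc z <= 1 -> lq z = (1 + d)%:C / lv z - 1.
Proof.
move=> z1; have n0 : lv z != 0 by rewrite -normc_gt0 norm_lv_gt0.
have -> : lq z = ((1 + d)%:C - lv z) / lv z by rewrite /lq /lv; congr (_ / _); ring.
by rewrite mulrBl divff.
Qed.

Lemma Re_lq_ge z : normc z <= 1 -> - complex.Re (lq z) <= 1.
Proof.
move=> z1; rewrite lqE// Re_add Re_opp Re_mul Re_inv /= mul0r subr0 opprD opprK.
rewrite gerDr oppr_le0 mulr_ge0// ?addr_ge0 ?(ltW d0)//.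
by rewrite divr_ge0 ?sqr_ge0// ltW// Re_lv_gt0.
Qed.

(** [- Im lq] is a positive multiple of [Im lv], and the angle [la] has the sign of [Im lv] because
    [Re lv > 0]. *)
Lemma Im_lq_la_ge0 z : normc z <= 1 -> 0 <= - complex.Im (lq z) * la z.
Proof.
move=> z1; rewrite lqE// Im_add Im_opp Im_mul Im_inv /= mul0r addr0 subr0.
have v0 := Re_lv_gt0 z1.
rewrite (mulNr (complex.Im _)) mulrN opprK.
have -> : complex.Im (lv z) / normc (lv z) ^+ 2 =
   (complex.Im (lv z) / complex.Re (lv z)) * (complex.Re (lv z) / normc (lv z) ^+ 2).
  by field; rewrite !gt_eqF// ?norm_lv_gt0.
rewrite (_ : _ * la z = (complex.Im (lv z) / complex.Re (lv z) * la z) *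
  ((1 + d) * (complex.Re (lv z) / normc (lv z) ^+ 2))); last by ring.
apply: mulr_ge0; first exact: atan_mul_ge0.
by apply: mulr_ge0; [rewrite addr_ge0// ltW|rewrite divr_ge0 ?sqr_ge0// ltW].
Qed.

(* Both terms of the upper bound are nonnegative, so it survives multiplication
   by the squared moduli of the other factors of a product. *)
Lemma lf_flux_le z (w : R) : normc z <= 1 -> 0 <= w <= 1 ->
  w * flux lf z <= leps + leps ^+ 2 * (- complex.Im (lq z) * la z).
Proof.
move=> z1 /andP[w0 w1]; rewrite lf_flux.
have := Re_lq_ge z1; have := Im_lq_la_ge0 z1; have := ll_ge0 z1; have := leps_ll z1.
set A := - complex.Re _; set B := - _ * la z; set L := ll z => eL L0 B0 A1.
have e2 : 0 <= leps ^+ 2 by rewrite sqr_ge0.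
rewrite mulrCA mulrDr mulrDr lerD//.
  apply: le_trans eL; rewrite ler_wpM2l// mulrA ler_piMl//.
  apply: (@le_trans _ _ (w * 1)); [by rewrite ler_wpM2l|by rewrite mulr1].
by rewrite ler_wpM2l// ler_piMl.
Qed.

End LogFactor.

(** The bound must not depend on [d n]. Subtracting [ln (2 + d)] achieves this: for [|z| <= m] the
    ratio [(2 + d) / |lv|] stays between 1 and [2 / (1 - m)], for small and large [d] alike. *)
Lemma loc_bounded_lf_e {R : realType} (d : nat -> R) (lam : nat -> R[i]) :
  (forall n, 0 < d n) -> (forall n, normc (lam n) = 1) ->
  loc_bounded (fun n => lf_e (d n) (lam n)).
Proof.
move=> d0 lam1 rho rho1.
set m := Num.max rho 0.
have m0 : 0 <= m by rewrite le_max lexx orbT.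
set q := 1 - m.
have q0 : 0 < q by rewrite /q subr_gt0 gt_max rho1 ltr01.
have p0 : 0 < (pi : R) by exact: pi_gt0.
exists (`|ln (2 / q)| + pi + pi / 2 + q^-1 + q^-1 ^+ 2); split.
  have iq0 : 0 <= q^-1 by rewrite invr_ge0 ltW.
  have := sqr_ge0 q^-1; have := normr_ge0 (ln (2 / q)); move: (ltW p0); lra.
move=> n z zr; have z1 : normc z <= 1 by rewrite (le_trans zr)// ltW.
have vq : q <= normc (lv (d n) (lam n) z).
  have zm : normc z <= m by rewrite le_max zr.
  apply: (le_trans _ (norm_lv_ge (d n) (lam1 n) zm)).
  by rewrite /q lerD2r lerDl ltW.
have vm : 1 + d n - m <= normc (lv (d n) (lam n) z).
  have zm : normc z <= m by rewrite le_max zr.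
  exact: (norm_lv_ge (d n) (lam1 n) zm).
have v0 := lt_le_trans q0 vq.
have iq : normc (lv (d n) (lam n) z)^-1 <= q^-1 by rewrite normcV lef_pV2// posrE.
have iq2 : normc (lv (d n) (lam n) z)^-1 ^+ 2 <= q^-1 ^+ 2.
  by rewrite lerXn2r// nnegrE ?normc_ge0// invr_ge0 ltW.
have d20 : 0 < 2 + d n by rewrite addr_gt0.
rewrite /jsize [j2 _ z]/= [j1 _ z]/= -/(lv (d n) (lam n) z).
have nl : normc (- (lam n)^*) = 1 by rewrite normcN normc_conj lam1.
have h1 : normc (- (lam n)^* * (lv (d n) (lam n) z)^-1 + 0) <= q^-1.
  by rewrite addr0 normcM nl mul1r.
have h2 : normc (0 * (lv (d n) (lam n) z)^-1 - (- (lam n)^*) ^+ 2 *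
    (lv (d n) (lam n) z)^-1 ^+ 2 + 0) <= q^-1 ^+ 2.
  by rewrite mul0r sub0r addr0 normcN (normcM (_ ^+ 2)) !normcX nl expr1n mul1r.
have h0 : normc (j0 (lf_e (d n) (lam n)) z) <= `|ln (2 / q)| + pi + pi / 2.
  have -> : j0 (lf_e (d n) (lam n)) z =
    clog (lv (d n) (lam n) z) - (ln (2 + d n) + pi)%:C by [].
  apply: (le_trans (normc_le_ReIm _)); apply: lerD; last first.
    by rewrite Im_add Im_opp /= oppr0 addr0; exact: norm_atan_pi2.
  rewrite Re_add Re_opp (Re_clog_lv (d0 n) (lam1 n) z1) /=.
  rewrite opprD addrA (le_trans (ler_normB _ _))// (ger0_norm (ltW p0)) lerD2r.
  rewrite distrC -ln_div ?posrE//.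
  have r1 : 1 <= (2 + d n) / normc (lv (d n) (lam n) z).
    by rewrite ler_pdivlMr// mul1r norm_lv_le.
  have r2 : (2 + d n) / normc (lv (d n) (lam n) z) <= 2 / q.
    rewrite ler_pdivrMr// mulrAC ler_pdivlMr//.
    apply: (@le_trans _ _ (2 * (1 + d n - m))); last by rewrite ler_wpM2l.
    rewrite /q; have := mulr_ge0 (ltW (d0 n)) m0; have := d0 n; lra.
  rewrite ger0_norm ?ln_ge0// ger0_norm ?ln_ge0 ?(le_trans r1)//.
  by rewrite ler_ln// posrE ?divr_gt0.
have := sqr_ge0 q^-1; lra.
Qed.

(** * The flux of the logarithmic factor along the four arcs *)

Section FluxOnCircle.
Context {R : realType}.

(* for [s, t = 1, -1] these four arcs cover the circle *)
Definition circle_arc (s t theta : R) : R[i] := (s * cos theta) +i* (t * sin theta).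

Variables (s t : R).
Hypotheses (s2 : s ^+ 2 = 1) (t2 : t ^+ 2 = 1).

Lemma normc_arc theta : normc (circle_arc s t theta) = 1.
Proof.
by rewrite /circle_arc /= !exprMn s2 t2 !mul1r cos2Dsin2 sqrtr1.
Qed.

Variables (d : R) (lam : R[i]).
Hypotheses (d0 : 0 < d) (lam1 : normc lam = 1).

Definition arc_lq theta := lq d lam (circle_arc s t theta).
Definition arc_ll theta := ll d lam (circle_arc s t theta).
Definition arc_la theta := la d lam (circle_arc s t theta).
(** The sign [s * t] is the orientation: the arc runs counterclockwise as [theta] grows exactly when
    it is 1. *)
Definition arc_der theta := s * t *
  (- complex.Re (arc_lq theta) * arc_ll theta + complex.Im (arc_lq theta) * arc_la theta).

Let x := complex.Re lam.
Let y := complex.Im lam.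
Let p theta := x * s * cos theta + y * t * sin theta.
Let q theta := x * t * sin theta - y * s * cos theta.
Let a theta := 1 + d - p theta.
Let b theta := - q theta.
Let N theta := a theta ^+ 2 + b theta ^+ 2.

Let zetaE theta : lam^* * circle_arc s t theta = p theta +i* q theta.
Proof.
rewrite /p /q /x /y /circle_arc; case: lam => u v; apply/eqP; rewrite eq_complex /=.
by apply/andP; split; apply/eqP; ring.
Qed.

Let lvE theta : lv d lam (circle_arc s t theta) = a theta +i* b theta.
Proof.
rewrite /lv mulNr zetaE /a /b; apply/eqP; rewrite eq_complex /=.
by apply/andP; split; apply/eqP; ring.
Qed.

Let a0 theta : 0 < a theta.
Proof.
have -> : a theta = complex.Re (lv d lam (circle_arc s t theta)) by rewrite lvE.
by apply: Re_lv_gt0 => //; rewrite normc_arc.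
Qed.

Let N0 theta : 0 < N theta.
Proof. by rewrite /N ltr_wpDr ?sqr_ge0// exprn_gt0. Qed.

Let Re_lqE theta : complex.Re (arc_lq theta) = (p theta * a theta + q theta * b theta) / N theta.
Proof. by rewrite /arc_lq /lq zetaE lvE /N /=; field; rewrite gt_eqF//; exact: N0. Qed.

Let Im_lqE theta : complex.Im (arc_lq theta) = (q theta * a theta - p theta * b theta) / N theta.
Proof. by rewrite /arc_lq /lq zetaE lvE /N /=; field; rewrite gt_eqF//; exact: N0. Qed.

Let llE : arc_ll = fun theta => half_ln_sqr (a theta) (b theta) - ln d.
Proof. by apply/funext => theta; rewrite /arc_ll /ll lvE. Qed.

Let laE : arc_la = fun theta => atan (b theta / a theta).
Proof. by apply/funext => theta; rewrite /arc_la /la lvE. Qed.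

Let dp (theta : R) : is_derive theta 1 p (- (s * t) * q theta).
Proof.
apply: (der_eq (derD (derM (derC (x * s) theta) (is_derive_cos theta))
  (derM (derC (y * t) theta) (is_derive_sin theta)))).
rewrite /q.
have -> : - (s * t) * (x * t * sin theta - y * s * cos theta) =
  - (x * s * (t ^+ 2) * sin theta) + y * t * (s ^+ 2) * cos theta by ring.
rewrite s2 t2; ring.
Qed.

Let dq (theta : R) : is_derive theta 1 q (s * t * p theta).
Proof.
apply: (der_eq (derB (derM (derC (x * t) theta) (is_derive_sin theta))
  (derM (derC (y * s) theta) (is_derive_cos theta)))).
rewrite /p.
have -> : s * t * (x * s * cos theta + y * t * sin theta) =
  x * t * (s ^+ 2) * cos theta + y * s * (t ^+ 2) * sin theta by ring.
rewrite s2 t2; ring.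
Qed.

Let da (theta : R) : is_derive theta 1 a (s * t * q theta).
Proof. by apply: (der_eq (derB (derC (1 + d) theta) (dp theta))); ring. Qed.

Let db (theta : R) : is_derive theta 1 b (- (s * t * p theta)).
Proof.
have -> : b = fun u => 0 - q u by apply/funext => u; rewrite /b sub0r.
by apply: (der_eq (derB (derC 0 theta) (dq theta))); ring.
Qed.

Let dll (theta : R) : is_derive theta 1 arc_ll (s * t * complex.Im (arc_lq theta)).
Proof.
rewrite llE; apply: (der_eq (derB (der_half_ln_sqr (a0 theta) (da theta) (db theta)) (derC (ln d) theta))).
by rewrite Im_lqE /N; field; rewrite gt_eqF//; exact: N0.
Qed.

Let dla (theta : R) : is_derive theta 1 arc_la (- (s * t * complex.Re (arc_lq theta))).
Proof.
rewrite laE; apply: (der_eq (der_atan_div (a0 theta) (da theta) (db theta))).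
by rewrite Re_lqE /N; field; rewrite gt_eqF//; exact: N0.
Qed.

(* By the Cauchy-Riemann equations along the circle, the unbounded part
   [- Im lq * la] of the flux equals a bounded term minus an exact derivative. *)
Lemma der_arc_ll_la (theta : R) :
  is_derive theta 1 (fun u => arc_ll u * arc_la u) (arc_der theta).
Proof.
apply: (der_eq (derM (dll theta) (dla theta))); rewrite /arc_der; ring.
Qed.

(** In [lf_flux_le] the term [- Im lq * la] is traded for [- Re lq * ll] minus the exact derivative.
    Since [- Re lq <= 1] and [leps ^+ 2 * ll <= leps], the trade costs one more [leps]. *)
Lemma arc_flux_le theta (w : R) : 0 <= w <= 1 ->
  w * flux (lf d lam) (circle_arc s t theta) <=
  2 * leps d - leps d ^+ 2 * (s * t) * arc_der theta.
Proof.
move=> w01; have z1 : normc (circle_arc s t theta) <= 1 by rewrite normc_arc.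
apply: (le_trans (lf_flux_le d0 lam1 z1 w01)).
have st2 : (s * t) ^+ 2 = 1 by rewrite exprMn s2 t2 mulr1.
have -> : leps d ^+ 2 * (s * t) * arc_der theta = leps d ^+ 2 * (s * t) ^+ 2 *
  (- complex.Re (arc_lq theta) * arc_ll theta + complex.Im (arc_lq theta) * arc_la theta).
  by rewrite /arc_der; ring.
rewrite st2 mulr1 -/(arc_lq theta) -/(arc_la theta).
have h1 : leps d ^+ 2 * arc_ll theta <= leps d := leps_ll d0 lam1 z1.
have h2 : - complex.Re (arc_lq theta) <= 1 := Re_lq_ge d0 lam1 z1.
have h3 : 0 <= arc_ll theta := ll_ge0 d0 lam1 z1.
have h4 : leps d ^+ 2 * (- complex.Re (arc_lq theta) * arc_ll theta) <= leps d.
  by apply: le_trans h1; rewrite ler_wpM2l ?sqr_ge0// -[leRHS]mul1r ler_wpM2r.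
have -> : leps d + leps d ^+ 2 * (- complex.Im (arc_lq theta) * arc_la theta) =
  leps d + leps d ^+ 2 * (- complex.Re (arc_lq theta) * arc_ll theta) -
  leps d ^+ 2 * (- complex.Re (arc_lq theta) * arc_ll theta +
    complex.Im (arc_lq theta) * arc_la theta) by ring.
lra.
Qed.

(** Controls the boundary terms left when [arc_der] is integrated. The constant uses only
    [pi <= 4]. *)
Lemma norm_arc_ll_la theta : `|leps d ^+ 2 * (arc_ll theta * arc_la theta)| <= 2 * leps d.
Proof.
have z1 : normc (circle_arc s t theta) <= 1 by rewrite normc_arc.
have h1 : leps d ^+ 2 * arc_ll theta <= leps d := leps_ll d0 lam1 z1.
have h3 : 0 <= arc_ll theta := ll_ge0 d0 lam1 z1.
have h5 : `|arc_la theta| <= pi / 2 := la_le d lam (circle_arc s t theta).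
have p4 : (pi : R) <= 4 by have := @pihalf_lt2 R; lra.
have h0 : 0 <= leps d ^+ 2 * arc_ll theta by rewrite mulr_ge0// sqr_ge0.
rewrite [X in `|X|]mulrA normrM (ger0_norm h0) [leRHS]mulrC.
by apply: ler_pM => //; rewrite (le_trans h5)//; lra.
Qed.

End FluxOnCircle.

(** * Green's formula on the disc *)

Section ProductMeasurability.
Context {R : realType}.

(** An open set is the union of the rational boxes that it contains. The union runs over all
    rational boxes, those not contained being replaced by the empty set. *)
Lemma open_measurable_prod (U : set (R * R)) : open U -> measurable U.
Proof.
move=> oU.
pose box (q : (rat * rat) * (rat * rat)) : set (R * R) :=
  [set` `]ratr q.1.1, ratr q.1.2[%R] `*` [set` `]ratr q.2.1, ratr q.2.2[%R].
pose F q := if pselect (box q `<=` U) then box q else set0.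
have -> : U = \bigcup_q F q.
  apply/seteqP; split=> [[x y] Uxy|p [q _]]; last first.
    by rewrite /F; case: pselect => [h /h|].
  have /nbhs_ballP[e /= e0 He] := oU _ Uxy.
  have [q1 /[!in_itv]/= /andP[q1l q1r]] := @rat_in_itvoo _ (x - e) x ltac:(by rewrite ltrBlDr ltrDl).
  have [q2 /[!in_itv]/= /andP[q2l q2r]] := @rat_in_itvoo _ x (x + e) ltac:(by rewrite ltrDl).
  have [q3 /[!in_itv]/= /andP[q3l q3r]] := @rat_in_itvoo _ (y - e) y ltac:(by rewrite ltrBlDr ltrDl).
  have [q4 /[!in_itv]/= /andP[q4l q4r]] := @rat_in_itvoo _ y (y + e) ltac:(by rewrite ltrDl).
  exists ((q1, q2), (q3, q4)) => //.
  have h : box ((q1, q2), (q3, q4)) `<=` U.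
    move=> [u v] []/=; rewrite !in_itv/= => /andP[u1 u2] /andP[v1 v2].
    by apply: He; split => /=; rewrite /ball/= ltr_distl; apply/andP; split; lra.
  rewrite /F; case: pselect => [?|/(_ h)//]; split; rewrite /= in_itv/= ?q1r ?q2l ?q3r ?q4l//.
apply: countable_bigcupT_measurable; first exact: countableP.
move=> q; rewrite /F; case: pselect => [?|? /=]; last exact: measurable0.
by apply: measurableX; exact: measurable_itv.
Qed.

Lemma continuous_measurable_prod (D : set (R * R)) (f : R * R -> R) :
  open D -> (forall p, D p -> {for p, continuous f}) -> measurable_fun D f.
Proof.
move=> oD cf; apply: (measurability _ (measurable_realfun.RGenOpens.measurableE R)).
move=> _ [_ [a [b ->] <-]]; apply: open_measurable_prod.
rewrite openE => p [Dp fp].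
have n1 : nbhs p D by exact: open_nbhs_nbhs.
have n2 : nbhs p (f @^-1` `]a, b[%classic).
  apply: (cf _ Dp); apply: open_nbhs_nbhs; split=> //; exact: interval_open.
exact: filterI n1 n2.
Qed.

End ProductMeasurability.

(** * Integrating a partial derivative over the disc by slices *)

Section Slices.
Context {R : realType}.
Local Notation mu := (@lebesgue_measure R).

Definition disc2 : set (R * R) := [set p | p.1 ^+ 2 + p.2 ^+ 2 < 1].

Lemma open_disc2 : open disc2.
Proof.
apply: (@open_comp _ _ (fun p : R * R => p.1 ^+ 2 + p.2 ^+ 2) [set x | x < 1]).
  move=> p _; apply: cvgD; rewrite expr2; apply: cvgM; first [exact: cvg_fst|exact: cvg_snd].
exact: open_lt.
Qed.

Lemma measurable_disc2 : measurable disc2.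
Proof. exact: open_measurable_prod open_disc2. Qed.

Lemma sqr_le1 (x : R) : (x ^+ 2 <= 1) = (-1 <= x <= 1).
Proof. by rewrite -ler_norml -[RHS](@expr_le1 _ 2)// -normrX ger0_norm ?sqr_ge0. Qed.

Lemma disc2_finite : ((mu \x mu) disc2 < +oo)%E.
Proof.
pose A : set R := `[-1, 1]%classic.
have mA : measurable A by exact: measurable_itv.
apply: (@le_lt_trans _ _ ((mu \x mu) (A `*` A))%E).
  apply: le_measure; [by apply: mem_set; exact: measurable_disc2|by apply: mem_set; exact: measurableX|].
  move=> [x y]; rewrite /disc2 /A /= !in_itv /= => xy.
  by rewrite -!sqr_le1; split=> /=; have := sqr_ge0 x; have := sqr_ge0 y; lra.
rewrite product_measure1E//.
have mA2 : mu A = (1 - -1)%:E.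
  by rewrite /A lebesgue_measure_itv /= lte_fin ifT ?EFinB//; lra.
by rewrite -[X in (X < _)%E]/(mu A * mu A)%E mA2 -EFinM ltry.
Qed.

Lemma continuous_eval2 (P : R -> R -> R) (a b : R -> R) (t : R) :
  {for (a t, b t), continuous (fun p : R * R => P p.1 p.2)} ->
  {for t, continuous a} -> {for t, continuous b} ->
  {for t, continuous (fun u => P (a u) (b u))}.
Proof.
move=> cP ca cb.
apply: (@cvg_comp _ _ _ (fun u => (a u, b u)) (fun p => P p.1 p.2) _ _ _ _ cP).
exact: (cvg_pair ca cb).
Qed.

Variables (P g : R -> R -> R) (M : R).
Hypothesis hd : forall x y : R, x ^+ 2 + y ^+ 2 <= 1 ->
  is_derive x 1 (fun u => P u y) (g x y).
Hypothesis cP : forall p : R * R, p.1 ^+ 2 + p.2 ^+ 2 <= 1 ->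
  {for p, continuous (fun p : R * R => P p.1 p.2)}.
Hypothesis cg : forall p : R * R, p.1 ^+ 2 + p.2 ^+ 2 <= 1 ->
  {for p, continuous (fun p : R * R => g p.1 p.2)}.
Hypothesis bg : forall x y : R, x ^+ 2 + y ^+ 2 <= 1 -> `|g x y| <= M.

(** The square root of a negative number is 0, so [chord_diff] vanishes for [y^2 >= 1], in agreement
    with the empty slices there. *)
Definition chord (y : R) : R := Num.sqrt (1 - y ^+ 2).

Definition chord_diff (y : R) : R := P (chord y) y - P (- chord y) y.

Lemma measurable_on_disc2 : measurable_fun disc2 (fun p : R * R => g p.1 p.2).
Proof.
apply: continuous_measurable_prod open_disc2 _ => p Dp; apply: cg; exact: ltW.
Qed.

Lemma integrable_on_disc2 :
  (mu \x mu)%E.-integrable disc2 (fun p : R * R => (g p.1 p.2)%:E).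
Proof.
apply: measurable_bounded_integrable.
- exact: measurable_disc2.
- exact: disc2_finite.
- exact: measurable_on_disc2.
- exists M; split; first exact: num_real.
  move=> N MN p Dp /=; apply: le_trans (ltW MN); apply: bg; exact: ltW.
Qed.

Lemma sqr_chord (y : R) : -1 <= y <= 1 -> chord y ^+ 2 = 1 - y ^+ 2.
Proof.
by rewrite -sqr_le1 => y1; rewrite sqr_sqrtr// subr_ge0.
Qed.

Lemma chord_ge0 y : 0 <= chord y. Proof. exact: sqrtr_ge0. Qed.

Lemma continuous_chord_diff (y : R) : -1 <= y <= 1 -> {for y, continuous chord_diff}.
Proof.
move=> y1.
have cc : {for y, continuous chord}.
  apply: (@cvg_comp _ _ _ (fun y : R => 1 - y ^+ 2) Num.sqrt _ _ _ _ (@sqrt_continuous _ _)).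
  apply: cvgB; first exact: cvg_cst.
  by rewrite expr2; apply: cvgM; exact: cvg_id.
have ci : {for y, continuous (fun u : R => u)} by exact: cvg_id.
apply: cvgB.
  apply: (continuous_eval2 (a := chord) (b := id)) => //.
  by apply: cP; rewrite /= sqr_chord//; lra.
apply: (continuous_eval2 (a := fun u => - chord u) (b := id)) => //.
  by apply: cP; rewrite /= sqrrN sqr_chord//; lra.
exact: cvgN.
Qed.

(** The fundamental theorem of calculus on the horizontal chord at height [y]. *)
Lemma inner_slice (y : R) :
  (\int[mu]_x ((fun p : R * R => (g p.1 p.2)%:E) \_ disc2) (x, y) = (chord_diff y)%:E)%E.
Proof.
have [y1|y1] := ltP (y ^+ 2) 1; last first.
  rewrite /chord_diff /chord ler0_sqrtr ?subr_le0// oppr0 subrr.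
  apply: integral0_eq => x _; rewrite patchE ifF//.
  apply/negbTE; rewrite notin_setE /disc2 /= => h.
  by have := sqr_ge0 x; lra.
have yy : -1 <= y <= 1.
  by rewrite -sqr_le1 ltW.
have s0 : 0 < chord y by rewrite sqrtr_gt0 subr_gt0.
have ss := sqr_chord yy.
have xs (x : R) : (x \in `]- chord y, chord y[) = (x ^+ 2 + y ^+ 2 < 1).
  rewrite in_itv/= -ltr_norml -(@ltr_pXn2r _ 2)// ?nnegrE ?chord_ge0//.
  by rewrite ss -normrX ger0_norm ?sqr_ge0// ltrBrDr.
transitivity (\int[mu]_(x in `](- chord y)%R, (chord y)%R[) (g x y)%:E)%E.
  rewrite [RHS]integral_mkcond; apply: eq_integral => x _.
  rewrite !patchE; congr (if _ then _ else _).
  by apply/idP/idP => /set_mem h; apply: mem_set; move: h; rewrite /disc2 /= xs.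
have xs' (x : R) : (x \in `[- chord y, chord y]) -> x ^+ 2 + y ^+ 2 <= 1.
  rewrite in_itv/= -ler_norml -(@ler_pXn2r _ 2)// ?nnegrE ?chord_ge0//.
  by rewrite ss -normrX ger0_norm ?sqr_ge0// lerBrDr.
have cx (x : R) : x ^+ 2 + y ^+ 2 <= 1 -> {for x, continuous (fun u => g u y)}.
  move=> xy; apply: (continuous_eval2 (a := id) (b := fun=> y)); first exact: cg.
    exact: cvg_id.
  exact: cvg_cst.
have cxP (x : R) : x ^+ 2 + y ^+ 2 <= 1 -> {for x, continuous (fun u => P u y)}.
  move=> xy; apply: (continuous_eval2 (a := id) (b := fun=> y)); first exact: cP.
    exact: cvg_id.
  exact: cvg_cst.
have cw : {within `[- chord y, chord y], continuous (fun u => g u y)}.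
  by apply: continuous_in_subspaceT => x /set_mem /xs'/cx.
have cc : - chord y < chord y by rewrite gtrN.
have e1 : `]- chord y, chord y[%classic `<=` `[- chord y, chord y]%classic.
  exact: subset_itv_oo_cc.
rewrite -(integral_itv_bndoo true false); last first.
  apply/measurable_EFinP; apply: open_continuous_measurable_fun.
    exact: interval_open.
  by move=> x /set_mem /= h; apply: cx; apply: ltW; rewrite -xs.
rewrite (continuous_FTC2 cc cw (F := fun u => P u y)).
- by rewrite -EFinB.
- split.
  + by move=> x; rewrite xs => /ltW/hd[].
  + by apply: cvg_at_right_filter; apply: cxP; rewrite sqrrN ss subrK.
  + by apply: cvg_at_left_filter; apply: cxP; rewrite ss subrK.
- by move=> x; rewrite xs => /ltW/hd[_ <-]; rewrite derive1E.
Qed.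

(** By Fubini the area integral is that of [chord_diff], and [Phi] is its indefinite integral from
    -1. A function is returned, not just a number, so that Green's formula can compose it with sine
    and cosine. *)
Lemma integral_by_slices : exists Phi : R -> R,
  [/\ {within `[-1, 1], continuous Phi},
      forall y : R, -1 < y < 1 -> is_derive y 1 Phi (chord_diff y) &
      (\int[mu \x mu]_(p in disc2) (g p.1 p.2)%:E = (Phi 1 - Phi (-1))%:E)%E].
Proof.
have N11 : (-1 : R) < 1 by lra.
have cw : {within `[-1, 1], continuous chord_diff}.
  apply: continuous_in_subspaceT => y /set_mem; rewrite /= in_itv /=.
  exact: continuous_chord_diff.
have iK : mu.-integrable `[-1, 1] (EFin \o chord_diff).
  by apply: continuous_compact_integrable => //; exact: segment_compact.
exists (fun y => parameterized_integral mu (-1) y chord_diff); split.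
- exact: parameterized_integral_continuous (ltW N11) iK.
- move=> y /andP[y0 y1].
  have := @continuous_FTC1_closed _ chord_diff (-1) y 1 y1 iK y0.
  move=> /(_ (continuous_chord_diff _))[|dP eP].
    by rewrite !ltW.
  exact: (DeriveDef dP (etrans (esym (derive1E _ _)) eP)).
- rewrite integral_mkcond -integral21_prod_meas1 /=; last first.
    by rewrite -integrable_mkcond; [exact: integrable_on_disc2|exact: measurable_disc2].
  rewrite /fubini_G.
  under eq_integral => y _ do rewrite inner_slice.
  rewrite /parameterized_integral [X in _ - X](_ : _ = 0) ?subr0; last first.
    by rewrite set_itv1 Rintegral_set1.
  rewrite /Rintegral fineK; last first.
    by apply: integrable_fin_num => //.
  rewrite [RHS]integral_mkcond; apply: eq_integral => y _; rewrite patchE.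
  case: ifPn => // /negP ny0; have ny : ~ (-1 <= y <= 1).
    by move=> h; apply: ny0; apply: mem_set; rewrite /= in_itv.
  rewrite /chord_diff /chord ler0_sqrtr ?oppr0 ?subrr//.
  rewrite subr_le0 leNgt; apply/negP => y1; apply: ny.
  by rewrite -sqr_le1 ltW.
Qed.

End Slices.

(** * From slices to the flux through the circle *)

Section Green.
Context {R : realType}.
Local Notation mu := (@lebesgue_measure R).

Lemma qdiff_continuous2 (f : R[i] -> R[i]) (p : R * R) d : qdiff f (p.1 +i* p.2) d ->
  {for p, continuous (fun p : R * R => complex.Re (f (p.1 +i* p.2)))} /\
  {for p, continuous (fun p : R * R => complex.Im (f (p.1 +i* p.2)))}.
Proof.
move=> /qdiff_lip[L [e [L0 e0 H]]].
have near_f (eps : R) : 0 < eps ->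
    \forall q \near p, normc (f (q.1 +i* q.2) - f (p.1 +i* p.2)) < eps.
  move=> eps0.
  pose eta := Num.min (e / 2) (eps / (2 * (L + 1))).
  have L1 : 0 < 2 * (L + 1) by rewrite mulr_gt0// ltr_wpDl.
  have eta0 : 0 < eta by rewrite lt_min !divr_gt0.
  apply/nbhs_ballP; exists eta => //= q [/= q1 q2].
  rewrite /ball/= distrC in q1; rewrite /ball/= distrC in q2.
  move: q1 q2; rewrite !lt_min => /andP[q1 q1'] /andP[q2 q2'].
  pose h := (q.1 +i* q.2) - (p.1 +i* p.2).
  have hE : q.1 +i* q.2 = (p.1 +i* p.2) + h by rewrite /h addrC subrK.
  have nh : normc h <= `|q.1 - p.1| + `|q.2 - p.2| by exact: normc_le_ReIm.
  rewrite hE (le_lt_trans (H _ _))//; first by rewrite (le_lt_trans nh)//; lra.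
  have q12 : (L + 1) * (`|q.1 - p.1| + `|q.2 - p.2|) < eps.
    move: q1' q2'; rewrite !ltr_pdivlMr//; lra.
  apply: le_lt_trans q12; apply: (@le_trans _ _ (L * (`|q.1 - p.1| + `|q.2 - p.2|))).
    by rewrite ler_wpM2l.
  by rewrite mulrDl lerDl mul1r addr_ge0.
split; apply/cvgrPdist_lt => eps /near_f; apply: filterS => q; rewrite normcBC.
  by apply: le_lt_trans; rewrite -Re_opp -Re_add normRe_le.
by apply: le_lt_trans; rewrite -Im_opp -Im_add normIm_le.
Qed.

(** Differentiation along 1 and along [i]; the coincidences among the four values are the
    Cauchy-Riemann equations. *)
Lemma qdiff_partials (f : R[i] -> R[i]) (x y : R) d : qdiff f (x +i* y) d ->
  [/\ is_derive x 1 (fun u => complex.Re (f (u +i* y))) (complex.Re d),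
      is_derive x 1 (fun u => complex.Im (f (u +i* y))) (complex.Im d),
      is_derive y 1 (fun v => complex.Re (f (x +i* v))) (- complex.Im d) &
      is_derive y 1 (fun v => complex.Im (f (x +i* v))) (complex.Re d)].
Proof.
move=> qf.
have ex (u : R) : u +i* y = (0 +i* y) + u%:C * 1.
  by apply/eqP; rewrite eq_complex /= !mulr1 !mulr0 subr0 !addr0 add0r !eqxx.
have ey (v : R) : x +i* v = (x +i* 0) + v%:C * 'i.
  apply/eqP; rewrite eq_complex /= ?mulr1 ?mulr0 ?mul0r ?subr0 ?add0r ?addr0.
  by rewrite !eqxx.
have Im_Re (w : R[i]) : complex.Im w = complex.Re (- 'i%C * w).
  by case: w => a b /=; rewrite oppr0 mul0r sub0r mulN1r opprK.
have dx c : is_derive x 1 (fun u => complex.Re (c * f (u +i* y))) (complex.Re (c * (1 * d))).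
  have -> : (fun u => complex.Re (c * f (u +i* y))) =
      fun u => complex.Re (c * f ((0 +i* y) + u%:C * 1)).
    by apply/funext => u; rewrite -ex.
  by apply: qdiff_line; rewrite -ex.
have dy c : is_derive y 1 (fun v => complex.Re (c * f (x +i* v))) (complex.Re (c * ('i%C * d))).
  have -> : (fun v => complex.Re (c * f (x +i* v))) =
      fun v => complex.Re (c * f ((x +i* 0) + v%:C * 'i)).
    by apply/funext => v; rewrite -ey.
  by apply: qdiff_line; rewrite -ey.
split.
- have := dx 1; rewrite !mul1r; congr (is_derive _ _ _ _).
  by apply/funext => u; rewrite mul1r.
- have := dx (- 'i%C); rewrite mul1r -Im_Re; congr (is_derive _ _ _ _).
  by apply/funext => u; rewrite -Im_Re.
- have := dy 1; rewrite mul1r mulrC ReiNIm; congr (is_derive _ _ _ _).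
  by apply/funext => u; rewrite mul1r.
- have := dy (- 'i%C); rewrite -Im_Re mulrC ImiRe; congr (is_derive _ _ _ _).
  by apply/funext => u; rewrite -Im_Re.
Qed.

Lemma within_continuous_comp (A : set R) (Phi h : R -> R) :
  {within A, continuous Phi} -> (forall t, A (h t)) -> continuous h ->
  continuous (fun t => Phi (h t)).
Proof.
move=> /subspace_continuousP cP Ah ch t S /(cP _ (Ah t)) HS.
have HS' : nbhs (h t) [set x | A x -> S (Phi x)] by exact: HS.
have Ht : nbhs t [set u | A (h u) -> S (Phi (h u))] by exact: (ch t _ HS').
suff : nbhs t [set u | S (Phi (h u))] by [].
by apply: filterS Ht => u /=; apply; exact: Ah.
Qed.

Variable J : jet (R := R).
Variable M : R.
Hypothesis hJ : forall z, normc z <= 1 -> jet_at J z.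
Hypothesis hM : forall z, normc z <= 1 ->
  [/\ normc (j0 J z) <= M, normc (j1 J z) <= M & normc (j2 J z) <= M].

Let u0 x y := complex.Re (j0 J (x +i* y)).
Let v0 x y := complex.Im (j0 J (x +i* y)).
Let u1 x y := complex.Re (j1 J (x +i* y)).
Let v1 x y := complex.Im (j1 J (x +i* y)).
Let u2 x y := complex.Re (j2 J (x +i* y)).
Let v2 x y := complex.Im (j2 J (x +i* y)).
(** [P] and [Q] are the components of half the gradient of [|j0 J|^2]. In the divergence [Px + Qy]
    the terms with [j2] cancel, leaving [2 |j1 J|^2]; this 2 is the one dividing in [green]. *)
Let P x y := u1 x y * u0 x y + v1 x y * v0 x y.
Let Q x y := u1 x y * v0 x y - v1 x y * u0 x y.
Let Px x y := (u1 x y * u1 x y + u0 x y * u2 x y) + (v1 x y * v1 x y + v0 x y * v2 x y).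
Let Qy x y := (u1 x y * u1 x y - v0 x y * v2 x y) + (v1 x y * v1 x y - u0 x y * u2 x y).

Let le1 (x y : R) : x ^+ 2 + y ^+ 2 <= 1 -> normc (x +i* y) <= 1.
Proof. by move=> h; rewrite -(@expr_le1 _ 2)// ?normc_ge0// sqr_normcE. Qed.

Let dP (x y : R) : x ^+ 2 + y ^+ 2 <= 1 -> is_derive x 1 (fun u => P u y) (Px x y).
Proof.
move=> /le1/hJ[/qdiff_partials[a b _ _] /qdiff_partials[c e _ _] _].
exact: (derD (derM c a) (derM e b)).
Qed.

Let dQ (x y : R) : x ^+ 2 + y ^+ 2 <= 1 -> is_derive y 1 (fun v => Q x v) (Qy x y).
Proof.
move=> /le1/hJ[/qdiff_partials[_ _ a b] /qdiff_partials[_ _ c e] _].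
by apply: (der_eq (derB (derM c b) (derM e a))); rewrite /Qy /u0 /v0 /u1 /v1 /u2 /v2; ring.
Qed.

Let cont (p : R * R) : p.1 ^+ 2 + p.2 ^+ 2 <= 1 ->
  [/\ {for p, continuous (fun p : R * R => P p.1 p.2)},
      {for p, continuous (fun p : R * R => Q p.1 p.2)},
      {for p, continuous (fun p : R * R => Px p.1 p.2)} &
      {for p, continuous (fun p : R * R => Qy p.1 p.2)}].
Proof.
move=> /le1/hJ[/qdiff_continuous2[a b] /qdiff_continuous2[c e] [d /qdiff_continuous2[f g]]].
split.
- by apply: cvgD; apply: cvgM.
- by apply: cvgB; apply: cvgM.
- by apply: cvgD; apply: cvgD; apply: cvgM.
- by apply: cvgD; apply: cvgB; apply: cvgM.
Qed.

Let bound4 (a b c d a' b' c' d' : R) : 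
  `|a| <= M -> `|b| <= M -> `|c| <= M -> `|d| <= M ->
  `|a'| <= M -> `|b'| <= M -> `|c'| <= M -> `|d'| <= M ->
  `|(a * a' + b * b') + (c * c' + d * d')| <= 4 * M ^+ 2.
Proof.
have prod (x y : R) : `|x| <= M -> `|y| <= M -> `|x * y| <= M ^+ 2.
  by move=> hx hy; rewrite normrM expr2 ler_pM.
move=> ha hb hc hd ha' hb' hc' hd'.
have -> : 4 * M ^+ 2 = (M ^+ 2 + M ^+ 2) + (M ^+ 2 + M ^+ 2) by ring.
rewrite (le_trans (ler_normD _ _))// lerD// (le_trans (ler_normD _ _))// lerD//;
  exact: prod.
Qed.

Let bounds (x y : R) : x ^+ 2 + y ^+ 2 <= 1 ->
  `|Px x y| <= 4 * M ^+ 2 /\ `|Qy x y| <= 4 * M ^+ 2.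
Proof.
move=> /le1/hM[m0 m1 m2].
have [a b c] : [/\ `|u0 x y| <= M, `|u1 x y| <= M & `|u2 x y| <= M].
  by split; rewrite (le_trans (normRe_le _)).
have [d e f] : [/\ `|v0 x y| <= M, `|v1 x y| <= M & `|v2 x y| <= M].
  by split; rewrite (le_trans (normIm_le _)).
split; first exact: bound4.
by rewrite /Qy -!mulNr; apply: bound4; rewrite ?normrN.
Qed.

Definition disc_energy := (\int[mu \x mu]_(p in disc2) (normc (j1 J (p.1 +i* p.2)) ^+ 2)%:E)%E.

Definition arc_flux theta := flux J (circle_arc 1 1 theta) + flux J (circle_arc 1 (-1) theta)
  + flux J (circle_arc (-1) 1 theta) + flux J (circle_arc (-1) (-1) theta).

Let swap_integral (g : R -> R -> R) :
  (mu \x mu)%E.-integrable disc2 (fun p : R * R => (g p.1 p.2)%:E) ->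
  (mu \x mu)%E.-integrable disc2 (fun p : R * R => (g p.2 p.1)%:E) ->
  (\int[mu \x mu]_(p in disc2) (g p.1 p.2)%:E = \int[mu \x mu]_(p in disc2) (g p.2 p.1)%:E)%E.
Proof.
move=> ig ig'; rewrite [LHS]integral_mkcond [RHS]integral_mkcond.
rewrite -integral12_prod_meas1 -?integral21_prod_meas1 /=; last 2 first.
- by rewrite -integrable_mkcond//; exact: measurable_disc2.
- by rewrite -integrable_mkcond//; exact: measurable_disc2.
apply: eq_integral => x _; apply: eq_integral => y _; rewrite !patchE /=.
congr (if _ then _ else _).
by apply/idP/idP => /set_mem h; apply: mem_set; move: h; rewrite /disc2 /= addrC.
Qed.

Lemma flux_arcE s t theta : flux J (circle_arc s t theta) =
  s * cos theta * P (s * cos theta) (t * sin theta) +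
  t * sin theta * Q (s * cos theta) (t * sin theta).
Proof.
rewrite /flux /circle_arc /P /Q /u0 /v0 /u1 /v1.
case: (j1 J _) => a b; case: (j0 J _) => c d /=; ring.
Qed.

(* [W] is assembled from the primitives of the two families of slices; reading
   the boundary terms as its derivative replaces a change of variables. *)
Lemma green : exists W : R -> R, [/\ continuous W,
  forall theta, 0 < theta < pi / 2 -> is_derive theta 1 W (arc_flux theta) &
  (disc_energy = ((W (pi / 2) - W 0) / 2)%:E)%E].
Proof.
have [Phi1 [cPhi1 dPhi1 iPhi1]] := @integral_by_slices _ P Px (4 * M ^+ 2) dP
  (fun p h => let: And4 a _ _ _ := cont h in a)
  (fun p h => let: And4 _ _ a _ := cont h in a) (fun x y h => (bounds h).1).
have swap1 (x y : R) : x ^+ 2 + y ^+ 2 <= 1 -> y ^+ 2 + x ^+ 2 <= 1 by rewrite addrC.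
have cswap (g : R -> R -> R) (p : R * R) :
    {for (p.2, p.1), continuous (fun p : R * R => g p.1 p.2)} ->
    {for p, continuous (fun p : R * R => g p.2 p.1)}.
  move=> cg; apply: (@cvg_comp _ _ _ (fun p : R * R => (p.2, p.1)) (fun p => g p.1 p.2) _ _ _ _ cg).
  have c1 : {for p, continuous (fun q : R * R => q.2)} by exact: cvg_snd.
  have c2 : {for p, continuous (fun q : R * R => q.1)} by exact: cvg_fst.
  exact: (cvg_pair c1 c2).
have cQ (p : R * R) : p.1 ^+ 2 + p.2 ^+ 2 <= 1 -> {for p, continuous (fun p : R * R => Q p.2 p.1)}.
  by move=> /swap1 h; apply: cswap; have [] := @cont (p.2, p.1) h.
have cQy (p : R * R) : p.1 ^+ 2 + p.2 ^+ 2 <= 1 -> {for p, continuous (fun p : R * R => Qy p.2 p.1)}.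
  by move=> /swap1 h; apply: cswap; have [] := @cont (p.2, p.1) h.
have bQ x y : x ^+ 2 + y ^+ 2 <= 1 -> `|Qy y x| <= 4 * M ^+ 2.
  by move=> /swap1/bounds[].
have [Phi2 [cPhi2 dPhi2 iPhi2]] := @integral_by_slices _ (fun x y => Q y x)
  (fun x y => Qy y x) (4 * M ^+ 2) (fun x y h => dQ (swap1 _ _ h)) cQ cQy bQ.
have iPx := @integrable_on_disc2 _ Px (4 * M ^+ 2)
  (fun p h => let: And4 _ _ a _ := cont h in a) (fun x y h => (bounds h).1).
have iQy := @integrable_on_disc2 _ Qy (4 * M ^+ 2)
  (fun p h => let: And4 _ _ _ a := cont h in a) (fun x y h => (bounds h).2).
have iQy' := @integrable_on_disc2 _ (fun x y => Qy y x) (4 * M ^+ 2) cQy bQ.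
(* Heights of horizontal slices are written [sin theta] and abscissas of vertical ones [cos theta].
   The values at 0 and [pi / 2] recover the two slice integrals; the minus sign compensates for the
   decrease of the cosine. *)
pose W theta := Phi1 (sin theta) - Phi1 (- sin theta) -
  (Phi2 (cos theta) - Phi2 (- cos theta)).
have s11 (t : R) : -1 <= sin t <= 1 by rewrite sin_geN1 sin_le1.
have c11 (t : R) : -1 <= cos t <= 1 by rewrite cos_geN1 cos_le1.
have N11 (x : R) : -1 <= x <= 1 -> -1 <= - x <= 1.
  by rewrite -!ler_norml normrN.
exists W; split.
- have wc (Phi : R -> R) (h : R -> R) : {within `[-1, 1], continuous Phi} ->
      (forall t, -1 <= h t <= 1) -> continuous h -> continuous (fun t => Phi (h t)).
    by move=> cPhi h1 ch; apply: (within_continuous_comp cPhi) => // t; rewrite /= in_itv /= h1.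
  have cN (h : R -> R) : continuous h -> continuous (fun t => - h t).
    by move=> ch t; apply: cvgN; exact: ch.
  move=> t; apply: cvgB; apply: cvgB; apply: wc => //; try exact: continuous_sin; try exact: continuous_cos.
  + by move=> u; exact: N11.
  + apply: cN; exact: continuous_sin.
  + by move=> u; exact: N11.
  + apply: cN; exact: continuous_cos.
- move=> t /andP[t0 t1].
  have p0 : 0 < (pi : R) := pi_gt0 R.
  have st : 0 < sin t by apply: sin_gt0_pi; rewrite t0/=; lra.
  have ct : 0 < cos t by apply: cos_gt0_pihalf; rewrite t1 andbT; lra.
  have sc := cos2Dsin2 t.
  (* Strict, because [Phi1] and [Phi2] are differentiated only inside []-1, 1[]; hence the open
     range of [theta]. *)
  have st1 : sin t < 1.
    by rewrite -(@ltr_pXn2r _ 2)// ?nnegrE ?ltW// expr1n; have := exprn_gt0 2 ct; lra.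
  have ct1 : cos t < 1.
    by rewrite -(@ltr_pXn2r _ 2)// ?nnegrE ?ltW// expr1n; have := exprn_gt0 2 st; lra.
  have chs : chord (sin t) = cos t.
    by rewrite /chord (_ : 1 - sin t ^+ 2 = cos t ^+ 2) ?sqrtr_sqr ?gtr0_norm//; lra.
  have chc : chord (cos t) = sin t.
    by rewrite /chord (_ : 1 - cos t ^+ 2 = sin t ^+ 2) ?sqrtr_sqr ?gtr0_norm//; lra.
  have chN (x : R) : chord (- x) = chord x by rewrite /chord sqrrN.
  have dN (h : R -> R) dh : is_derive t 1 h dh -> is_derive t 1 (fun u => - h u) (- dh).
    by move=> H; have := derB (derC 0 t) H; under eq_fun do rewrite sub0r; rewrite sub0r.
  have ds : is_derive t 1 (@sin R) (cos t) := is_derive_sin t.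
  have dc : is_derive t 1 (@cos R) (- sin t) := is_derive_cos t.
  have d1 : is_derive t 1 (fun u => Phi1 (sin u)) _ :=
    @der_comp _ Phi1 (@sin R) t _ _ (dPhi1 (sin t) ltac:(apply/andP; split; lra)) ds.
  have d2 : is_derive t 1 (fun u => Phi1 (- sin u)) _ :=
    @der_comp _ Phi1 (fun u => - sin u) t _ _ (dPhi1 (- sin t) ltac:(apply/andP; split; lra)) (dN _ _ ds).
  have d3 : is_derive t 1 (fun u => Phi2 (cos u)) _ :=
    @der_comp _ Phi2 (@cos R) t _ _ (dPhi2 (cos t) ltac:(apply/andP; split; lra)) dc.
  have d4 : is_derive t 1 (fun u => Phi2 (- cos u)) _ :=
    @der_comp _ Phi2 (fun u => - cos u) t _ _ (dPhi2 (- cos t) ltac:(apply/andP; split; lra)) (dN _ _ dc).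
  apply: (der_eq (derB (derB d1 d2) (derB d3 d4))).
  rewrite /arc_flux !flux_arcE /chord_diff !chN chs chc !mulN1r !mul1r; ring.
- rewrite /W sin_pihalf cos_pihalf sin0 cos0 oppr0 !subrr subr0 sub0r opprK.
  have e2 (p : R * R) : ((normc (j1 J (p.1 +i* p.2)) ^+ 2)%:E =
      2^-1%:E * ((Px p.1 p.2)%:E + (Qy p.1 p.2)%:E))%E.
    by rewrite -EFinD -EFinM; congr EFin; rewrite sqr_normcE /Px /Qy /u1 /v1; field.
  rewrite /disc_energy; under eq_integral => p _ do rewrite e2.
  rewrite integralZl; [|exact: measurable_disc2|].
    rewrite integralD; [|exact: measurable_disc2|exact: iPx|exact: iQy].
    rewrite iPhi1 (swap_integral iQy iQy') iPhi2 -EFinD -EFinM; congr EFin.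
    by rewrite mulrC.
  by apply: integrableD; [exact: measurable_disc2|exact: iPx|exact: iQy].
Qed.

(** [H - W] has nonnegative derivative, so the mean value theorem compares increments. A pointwise
    majorant with a known primitive is enough, and the integral over the circle is never formed. *)
Lemma disc_energy_le (H h : R -> R) :
  (forall theta : R, is_derive theta 1 H (h theta)) ->
  (forall theta, arc_flux theta <= h theta) ->
  (disc_energy <= ((H (pi / 2) - H 0) / 2)%:E)%E.
Proof.
move=> dH fh; have [W [cW dW ->]] := green.
have p0 : 0 < (pi : R) / 2 by rewrite divr_gt0// pi_gt0.
rewrite lee_fin ler_pM2r ?invr_gt0//.
have [||t] := @MVT _ (fun u => H u - W u) (fun u => h u - arc_flux u) 0 (pi / 2) p0.
- by move=> t; rewrite in_itv/= => /dW dWt; exact: (derB (dH t) dWt).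
- apply: continuous_subspaceT => t; apply: cvgB; last exact: cW.
  by apply/differentiable_continuous/derivable1_diffP; case: (dH t).
rewrite in_itv/= => /andP[t0 t1] e.
have : 0 <= (h t - arc_flux t) * (pi / 2 - 0).
  by rewrite mulr_ge0// ?subr_ge0//; lra.
by rewrite -e; lra.
Qed.

End Green.

(** * The energy of finite products *)

Section FiniteProducts.
Context {R : realType}.
Implicit Types (J : jet (R := R)) (z : R[i]).

(** A qualitative bound on the closed disc, as Green's formula requires for integrability; its size
    does not enter the energy estimate. *)
Definition jbounded J := exists M, forall z, normc z <= 1 -> jsize J z <= M.

Lemma jbounded_cst c : jbounded (jcst c).
Proof. by exists (normc c) => z _; rewrite jsize_cst. Qed.

Lemma jbounded_mul J K : jbounded J -> jbounded K -> jbounded (jmul J K).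
Proof.
move=> [M HM] [N HN]; exists (M * N) => z z1.
by rewrite (le_trans (jsize_mul _ _ _))// ler_pM ?jsize_ge0 ?HM ?HN.
Qed.

Lemma jbounded_near_one s J : jbounded J -> jbounded (near_one s J).
Proof.
move=> bJ; have [M HM] := jbounded_mul (jbounded_cst s%:C) bJ.
exists (1 + M) => z z1; rewrite (le_trans (jsize_add _ _ _))// lerD//.
  by rewrite jsize_cst normc1.
exact: HM.
Qed.

Lemma jbounded_prod (G : nat -> jet) n : (forall i, jbounded (G i)) -> jbounded (jprod G n).
Proof.
by move=> H; elim: n => [|n ih]; [exact: jbounded_cst|exact: jbounded_mul].
Qed.

Lemma jbounded_bl_e (r : R) c : 0 <= r < 1 -> normc c = 1 -> jbounded (bl_e r c).
Proof.
move=> r01 c1; have /andP[r0 r1] := r01.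
exists (3 * ((1 - r)^-1 + (1 - r)^-1 ^+ 2 + (1 - r)^-1 ^+ 3)) => z z1.
rewrite (le_trans (jsize_mul _ _ _))// ler_pM ?jsize_ge0//.
  by rewrite (le_trans (jsize_aff_le _ _ z1))// !normcN normc1 c1; lra.
apply: jsize_inv_aff_le; first by rewrite subr_gt0.
  by rewrite normcN normcM c1 mulr1 normc_realE ger0_norm// ltW.
by rewrite mulNr; have := bl_den_ge r01 c1 z1; rewrite mulr1.
Qed.

Lemma jbounded_lf_e (d : R) lam : 0 < d -> normc lam = 1 -> jbounded (lf_e d lam).
Proof.
move=> d0 lam1; have e0 := leps_gt0 d0.
exists (2 / leps d + d^-1 + d^-1 ^+ 2) => z z1.
have h0 : normc (j0 (lf_e d lam) z) <= 2 / leps d.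
  rewrite ler_pdivlMr// mulrC -{1}(gtr0_norm e0) -normc_realE -normcM.
  have -> : (leps d)%:C * j0 (lf_e d lam) z = j0 (lf d lam) z - 1.
    have -> : j0 (lf d lam) z = 1 + (leps d)%:C * j0 (lf_e d lam) z by [].
    by rewrite (addrC 1) addrK.
  by rewrite (le_trans (le_normcB _ _))// normc1; have := lf_le1 d0 lam1 z1; lra.
have vd : d <= normc (lv d lam z).
  by have := norm_lv_ge d lam1 z1; rewrite addrAC subrr add0r.
have v0 := lt_le_trans d0 vd.
have id : normc (lv d lam z)^-1 <= d^-1 by rewrite normcV lef_pV2// posrE.
have id2 : normc (lv d lam z)^-1 ^+ 2 <= d^-1 ^+ 2.
  by rewrite lerXn2r// nnegrE ?normc_ge0// invr_ge0 ltW.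
have nl : normc (- lam^*) = 1 by rewrite normcN normc_conj lam1.
have h1 : normc (j1 (lf_e d lam) z) <= d^-1.
  by rewrite /= -/(lv d lam z) addr0 normcM nl mul1r.
have h2 : normc (j2 (lf_e d lam) z) <= d^-1 ^+ 2.
  by rewrite /= -/(lv d lam z) mul0r sub0r addr0 normcN (normcM (_ ^+ 2)) !normcX nl expr1n mul1r.
by rewrite /jsize; have := normc_ge0 (j2 (lf_e d lam) z); lra.
Qed.

Lemma flux_cst c z : flux (jcst c) z = 0.
Proof. by rewrite /flux /= mulr0 mul0r. Qed.

Lemma prod_le1 (G : nat -> jet (R := R)) n z : (forall i, normc (j0 (G i) z) <= 1) ->
  normc (j0 (jprod G n) z) <= 1.
Proof.
move=> H; elim: n => [|n ih]; first by rewrite [j0 _ _]/= normc1.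
by rewrite /= normcM mulr_ile1 ?normc_ge0.
Qed.

(** By [flux_mul] each flux is multiplied by a weight in [[0, 1]]. Such a weight can raise a
    negative flux, but never above a nonnegative majorant. *)
Lemma flux_prod_le (G : nat -> jet (R := R)) (w : nat -> R) n z :
  (forall i, normc (j0 (G i) z) <= 1) -> (forall i, 0 <= w i) ->
  (forall i, flux (G i) z <= w i) ->
  flux (jprod G n) z <= \sum_(0 <= i < n) w i.
Proof.
move=> G1 w0 Gw; elim: n => [|n ih]; first by rewrite big_geq// flux_cst.
rewrite [jprod _ _]/= flux_mul big_nat_recr//=.
have wle (x y W : R) : 0 <= W -> x <= W -> 0 <= y <= 1 -> x * y <= W.
  move=> W0 xW /andP[y0 y1]; apply: (@le_trans _ _ (W * y)); first by rewrite ler_wpM2r.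
  by rewrite ler_piMr.
apply: lerD; apply: wle => //.
- exact: sumr_ge0.
- by rewrite sqr_ge0/= expr_le1 ?normc_ge0.
- by rewrite sqr_ge0/= expr_le1 ?normc_ge0// prod_le1.
Qed.

Lemma near_one0_j0 (J : jet (R := R)) z : j0 (near_one 0 J) z = 1.
Proof. by rewrite /= real_complex0 mul0r addr0. Qed.

Lemma near_one0_flux (J : jet (R := R)) z : flux (near_one 0 J) z = 0.
Proof. by rewrite /flux /= real_complex0 !mul0r !addr0 mulr0 mul0r. Qed.

End FiniteProducts.

(** * The energy of products arranged by groups *)

Section Engine.
Context {R : realType}.
(** The [n]-th zero is [r n * (c n)^*]; [act n] tells that the index [n] carries a zero, and
    [pk k n] that this zero lies in the [k]-th part. *)
Variables (r : nat -> R) (c : nat -> R[i]) (act : nat -> bool).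
Variables (pk : nat -> nat -> bool) (a K : nat -> R) (lam : nat -> R[i]).
Hypothesis r01 : forall n, 0 <= r n < 1.
Hypothesis c1 : forall n, normc (c n) = 1.
Hypothesis lam1 : forall k, normc (lam k) = 1.
Hypothesis K1 : forall k, 1 < K k.
Hypothesis a0 : forall k, 0 <= a k.
Hypothesis pk_act : forall k n, pk k n -> act n.
Hypothesis pk_stolz : forall k n, pk k n ->
  normc (lam k - (r n)%:C * (c n)^*) <= K k * (1 - r n).
Hypothesis pk_a : forall k n, pk k n -> 0 < a k.
Hypothesis pk_sum : forall k N,
  2 * K k ^+ 2 * (\sum_(0 <= n < N) if pk k n then 1 - r n else 0) <= a k.
Hypothesis pk_disj : forall k k' n, pk k n -> pk k' n -> k = k'.
Hypothesis pk_cover : forall n, act n -> exists k, pk k n.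
Hypothesis sum_a : bounded_series (fun k => inv_log (a k)).

(** When [a k = 0] the group is empty by [pk_a]. The value 1 merely keeps the scale positive, and
    [log_eps k = 0] switches the factor off. *)
Definition log_scale k := if a k == 0 then 1 else Num.sqrt (a k).
Definition log_eps k := if a k == 0 then 0 else leps (log_scale k).
Definition bl_weight n := if act n then 1 - r n else 0.
Definition log_jet k := near_one (log_eps k) (lf_e (log_scale k) (lam k)).
Definition bl_jet n := near_one (bl_weight n) (bl_e (r n) (c n)).

Lemma log_scale_gt0 k : 0 < log_scale k.
Proof. by rewrite /log_scale; case: eqP => // /eqP an; rewrite sqrtr_gt0 lt_neqAle eq_sym an a0. Qed.

Lemma log_eps_ge0 k : 0 <= log_eps k.
Proof. by rewrite /log_eps; case: eqP => // _; exact/ltW/leps_gt0/log_scale_gt0. Qed.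

Lemma log_eps_le1 k : log_eps k <= 1.
Proof. by rewrite /log_eps; case: eqP => // _; exact/leps_le1/log_scale_gt0. Qed.

Lemma log_jetE k : a k != 0 -> log_jet k = lf (log_scale k) (lam k).
Proof. by move=> ak; rewrite /log_jet /log_eps (negbTE ak). Qed.

Lemma bl_jetE n : act n -> bl_jet n = bl (r n) (c n).
Proof. by rewrite /bl_jet /bl_weight => ->. Qed.

Lemma bl_weight_ge0 n : 0 <= bl_weight n.
Proof. by rewrite /bl_weight; case: ifP => // _; have /andP[_ /ltW] := r01 n; rewrite subr_ge0. Qed.

(* [1 + 1/a <= (1 + 1/d)^2] for [d = sqrt a] *)
Lemma log_eps_le_inv_log k : log_eps k <= 2 * inv_log (a k).
Proof.
rewrite /log_eps /inv_log; case: eqP => [_|/eqP an]; first by rewrite mulr0.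
have ap : 0 < a k by rewrite lt_neqAle eq_sym an a0.
have d0 := log_scale_gt0 k.
have dd : log_scale k ^+ 2 = a k by rewrite /log_scale (negbTE an) sqr_sqrtr// a0.
have l0 : 0 < ln (1 + (a k)^-1) by rewrite ln_gt0// ltrDl invr_gt0.
have n0 : 0 < lnorm (log_scale k) by rewrite (lt_le_trans (pi_gt0 R))// lnorm_ge_pi.
rewrite /leps -[2 * _]invrK invfM invrK lef_pV2 ?posrE ?mulr_gt0 ?invr_gt0//.
rewrite mulrC ler_pdivrMr//.
apply: (@le_trans _ _ (ln ((1 + (log_scale k)^-1) ^+ 2))).
  rewrite ler_ln ?posrE ?exprn_gt0 ?addr_gt0 ?invr_gt0//.
  have id0 : 0 <= (log_scale k)^-1 by rewrite invr_ge0 ltW.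
  by rewrite -dd -exprVn sqrrD expr1n mul1r; lra.
rewrite lnXn ?addr_gt0 ?invr_gt0// mulr2n.
have -> : lnorm (log_scale k) * 2 = lnorm (log_scale k) + lnorm (log_scale k) by ring.
suff : ln (1 + (log_scale k)^-1) <= lnorm (log_scale k) by move=> h; exact: lerD.
rewrite /lnorm.
rewrite ler_wpDr ?pi_ge0// ler_ln ?posrE ?divr_gt0 ?addr_gt0 ?invr_gt0//.
by rewrite mulrDl divff ?gt_eqF// addrC lerD2r ler_peMl ?invr_ge0 ?ltW//; lra.
Qed.

(** From [ln (1 + x) <= x]. It makes the [a k] summable, and hence yields the Blaschke condition. *)
Lemma le_inv_log k : a k <= inv_log (a k).
Proof.
rewrite /inv_log; case: eqP => [->//|/eqP an].
have ap : 0 < a k by rewrite lt_neqAle eq_sym an a0.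
have l0 : 0 < ln (1 + (a k)^-1) by rewrite ln_gt0// ltrDl invr_gt0.
rewrite -[leLHS]invrK lef_pV2 ?posrE ?invr_gt0//.
by rewrite le_ln1Dx// (lt_trans (ltrN10 R))// invr_gt0.
Qed.

Lemma bounded_log_eps : bounded_series log_eps.
Proof.
apply: bounded_series_le (bounded_seriesZ (ler0n R 2) sum_a) => k.
by rewrite log_eps_ge0 log_eps_le_inv_log.
Qed.

(** The index of a zero gives no bound on that of its group, so [M] is chosen after [N]. Requiring
    [N <= M] forces the number of groups to infinity. *)
Lemma eventually_grouped N : exists M, (N <= M)%N /\
  forall n, (n < N)%N -> act n -> exists2 k, (k < M)%N & pk k n.
Proof.
elim: N => [|N [M [NM H]]]; first by exists 0%N.
have [/pk_cover[k pkN]|nact] := boolP (act N).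
  exists (maxn M.+1 k.+1); split; first by rewrite leq_max ltnS NM.
  move=> n; rewrite ltnS leq_eqVlt => /predU1P[->|nN] an.
    by exists k => //; rewrite leq_max ltnSn orbT.
  by have [l lM pl] := H _ nN an; exists l => //; rewrite leq_max ltnS (ltnW lM).
exists M.+1; split; first by rewrite ltnS.
move=> n; rewrite ltnS leq_eqVlt => /predU1P[->|nN] an; first by rewrite an in nact.
by have [l lM pl] := H _ nN an; exists l => //; rewrite ltnS ltnW.
Qed.

(** The group is cut off at index [N], with 1 in place of the other factors; the Stolz estimate
    persists because [pk_sum] bounds every partial sum. *)
Definition bl_group k N := jprod (fun n => if pk k n then bl_jet n else jcst 1) N.
Definition grouped M N := jprod (fun k => jmul (log_jet k) (bl_group k N)) M.

Lemma jet_at_log_jet k z : normc z <= 1 -> jet_at (log_jet k) z.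
Proof.
move=> z1; apply: jet_at_add (jet_at_cst _ _) _; apply: jet_at_mul (jet_at_cst _ _) _.
by apply: lf_e_jet => //; exact: log_scale_gt0.
Qed.

Lemma jet_at_bl_jet n z : normc z <= 1 -> jet_at (bl_jet n) z.
Proof.
move=> z1; apply: jet_at_add (jet_at_cst _ _) _; apply: jet_at_mul (jet_at_cst _ _) _.
exact: bl_e_jet.
Qed.

Lemma jet_at_bl_group k N z : normc z <= 1 -> jet_at (bl_group k N) z.
Proof.
move=> z1; apply: jet_at_prod => n _; case: ifP => _; first exact: jet_at_bl_jet.
exact: jet_at_cst.
Qed.

Lemma jet_at_grouped M N z : normc z <= 1 -> jet_at (grouped M N) z.
Proof.
by move=> z1; apply: jet_at_prod => k _; apply: jet_at_mul; [exact: jet_at_log_jet|exact: jet_at_bl_group].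
Qed.

Lemma grouped_bounded M N : jbounded (grouped M N).
Proof.
apply: jbounded_prod => k; apply: jbounded_mul.
  by apply: jbounded_near_one; apply: jbounded_lf_e; [exact: log_scale_gt0|exact: lam1].
apply: jbounded_prod => n; case: ifP => _; last exact: jbounded_cst.
by apply: jbounded_near_one; exact: jbounded_bl_e.
Qed.

Lemma log_jet_le1 k z : normc z <= 1 -> normc (j0 (log_jet k) z) <= 1.
Proof.
move=> z1; have [ak|ak] := eqVneq (a k) 0.
  by rewrite /log_jet /log_eps ak eqxx near_one0_j0 normc1.
by rewrite log_jetE// lf_le1 ?log_scale_gt0.
Qed.

Lemma bl_jet_le1 n z : normc z <= 1 -> normc (j0 (bl_jet n) z) <= 1.
Proof.
move=> z1; have [an|an] := boolP (act n); first by rewrite bl_jetE// bl_le1.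
by rewrite /bl_jet /bl_weight (negbTE an) near_one0_j0 normc1.
Qed.

Lemma bl_group_le1 k N z : normc z <= 1 -> normc (j0 (bl_group k N) z) <= 1.
Proof. by move=> z1; apply: prod_le1 => n; case: ifP => _; [exact: bl_jet_le1|rewrite [j0 _ _]/= normc1]. Qed.

Lemma bl_group_flux_le k N z : normc z = 1 -> a k != 0 ->
  flux (bl_group k N) z * normc (j0 (log_jet k) z) ^+ 2 <= 16 * log_eps k ^+ 2.
Proof.
move=> z1 ak; have zle : normc z <= 1 by rewrite z1.
have ap : 0 < a k by rewrite lt_neqAle eq_sym ak a0.
have d0 := log_scale_gt0 k.
have dd : log_scale k ^+ 2 = a k by rewrite /log_scale (negbTE ak) sqr_sqrtr// a0.
have ekE : log_eps k = leps (log_scale k) by rewrite /log_eps (negbTE ak).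
pose w n := if pk k n then flux (bl (r n) (c n)) z else 0.
have w0 n : 0 <= w n by rewrite /w; case: ifP => // _; exact: bl_flux_ge0.
have h1 : flux (bl_group k N) z <= \sum_(0 <= n < N) w n.
  apply: flux_prod_le => // n.
    by case: ifP => _; [exact: bl_jet_le1|rewrite [j0 _ _]/= normc1].
  by rewrite /w; case: ifP => [/pk_act/bl_jetE->//|_]; rewrite flux_cst.
have h2 : normc (lam k - z) ^+ 2 * (\sum_(0 <= n < N) w n) <= 4 * a k.
  apply: (@le_trans _ _ (4 * (2 * K k ^+ 2 * (\sum_(0 <= n < N) if pk k n then 1 - r n else 0)))); last first.
    by rewrite ler_wpM2l.
  rewrite !mulr_sumr; apply: ler_sum => n _; rewrite /w; case: ifPn => [pkn|_]; last by rewrite !mulr0.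
  have := bl_flux_stolz (r01 n) (c1 n) z1 (K1 k) (pk_stolz pkn).
  lra.
have v1 : normc (j0 (log_jet k) z) <= 2 * log_eps k / log_scale k * normc (lam k - z).
  by rewrite log_jetE// ekE; exact: lf_vanish.
apply: (@le_trans _ _ ((\sum_(0 <= n < N) w n) * (2 * log_eps k / log_scale k * normc (lam k - z)) ^+ 2)).
  apply: (@le_trans _ _ ((\sum_(0 <= n < N) w n) * normc (j0 (log_jet k) z) ^+ 2)).
    by rewrite ler_wpM2r// sqr_ge0.
  rewrite ler_wpM2l ?sumr_ge0// lerXn2r// nnegrE ?normc_ge0//.
  exact: le_trans (normc_ge0 _) v1.
have -> : (\sum_(0 <= n < N) w n) * (2 * log_eps k / log_scale k * normc (lam k - z)) ^+ 2 =
   (4 * log_eps k ^+ 2 / a k) * (normc (lam k - z) ^+ 2 * (\sum_(0 <= n < N) w n)).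
  by rewrite -dd; field; rewrite gt_eqF.
have -> : 16 * log_eps k ^+ 2 = (4 * log_eps k ^+ 2 / a k) * (4 * a k) by field.
by rewrite ler_wpM2l// divr_ge0// mulr_ge0// sqr_ge0.
Qed.

Definition flux_majorant (s t : R) k theta := if a k == 0 then 0 else
  2 * log_eps k + 16 * log_eps k ^+ 2 - log_eps k ^+ 2 * (s * t) * arc_der s t (log_scale k) (lam k) theta.

Definition flux_primitive (s t : R) k theta := if a k == 0 then 0 else
  (2 * log_eps k + 16 * log_eps k ^+ 2) * theta -
  log_eps k ^+ 2 * (s * t) * (arc_ll s t (log_scale k) (lam k) theta * arc_la s t (log_scale k) (lam k) theta).

Section Signs.
Variables s t : R.
Hypotheses (s2 : s ^+ 2 = 1) (t2 : t ^+ 2 = 1).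

Lemma der_flux_primitive k (theta : R) : is_derive theta 1 (flux_primitive s t k) (flux_majorant s t k theta).
Proof.
rewrite /flux_primitive /flux_majorant; case: ifP => ak; first exact: derC.
have D := der_arc_ll_la s2 t2 (log_scale_gt0 k) (lam1 k) theta.
apply: (der_eq (derB (derM (derC (2 * log_eps k + 16 * log_eps k ^+ 2) theta) (is_derive_id theta 1))
  (derM (derC (log_eps k ^+ 2 * (s * t)) theta) D))).
by rewrite !mulr0 !addr0 mulr1.
Qed.

Lemma flux_majorant_ge k N theta : 0 <= flux_majorant s t k theta /\
  flux (jmul (log_jet k) (bl_group k N)) (circle_arc s t theta) <= flux_majorant s t k theta.
Proof.
have z1 := normc_arc s2 t2 theta; set z := circle_arc s t theta in z1 *.
have zle : normc z <= 1 by rewrite z1.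
rewrite /flux_majorant; case: ifPn => [/eqP ak|ak].
  split=> //; rewrite flux_mul.
  have -> : log_jet k = near_one 0 (lf_e (log_scale k) (lam k)) by rewrite /log_jet /log_eps ak eqxx.
  rewrite near_one0_flux mul0r add0r near_one0_j0 normc1 expr1n mulr1.
  have : flux (bl_group k N) z <= \sum_(0 <= n < N) 0.
    apply: flux_prod_le => // n; case: ifP => [/pk_a|_]; rewrite ?ak ?ltxx//.
      by rewrite [j0 _ _]/= normc1.
    by rewrite flux_cst.
  by rewrite big1.
have ekE : log_eps k = leps (log_scale k) by rewrite /log_eps (negbTE ak).
have E w : 0 <= w <= 1 -> w * flux (log_jet k) z <=
    2 * log_eps k - log_eps k ^+ 2 * (s * t) * arc_der s t (log_scale k) (lam k) theta.
  by move=> w01; rewrite log_jetE// ekE; exact: (arc_flux_le s2 t2 (log_scale_gt0 k) (lam1 k) theta w01).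
have e2 : 0 <= log_eps k ^+ 2 by rewrite sqr_ge0.
split.
  (* The weight 0 in [E] shows that the logarithmic part of the majorant is nonnegative. *)
  by have := E 0; rewrite mul0r lexx ler01 => /(_ isT); lra.
rewrite flux_mul.
have := E (normc (j0 (bl_group k N) z) ^+ 2); rewrite sqr_ge0 expr_le1 ?normc_ge0// bl_group_le1// => /(_ isT).
have := bl_group_flux_le N z1 ak.
rewrite mulrC [_ * flux (log_jet k) z]mulrC; lra.
Qed.

(** The constant is 36 + 4: the linear part is at most [18 * log_eps k] times [pi / 2 <= 2], and
    each of the two boundary terms is at most [2 * log_eps k]. *)
Lemma flux_primitive_increment k : flux_primitive s t k (pi / 2) - flux_primitive s t k 0 <= 40 * log_eps k.
Proof.
rewrite /flux_primitive; case: ifPn => ak; first by rewrite subr0 mulr_ge0// log_eps_ge0.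
have ekE : log_eps k = leps (log_scale k) by rewrite /log_eps (negbTE ak).
have st : `|s * t| = 1.
  have : (s * t) ^+ 2 == 1 by rewrite exprMn s2 t2 mulr1.
  by rewrite sqrf_eq1 => /orP[]/eqP->; rewrite ?normrN normr1.
have B theta : `|log_eps k ^+ 2 * (s * t) * (arc_ll s t (log_scale k) (lam k) theta * arc_la s t (log_scale k) (lam k) theta)|
    <= 2 * log_eps k.
  rewrite mulrAC normrM st mulr1 ekE.
  exact: (norm_arc_ll_la s2 t2 (log_scale_gt0 k) (lam1 k) theta).
have := B (pi / 2); have := B 0; rewrite !ler_norml => /andP[b1 b2] /andP[b3 b4].
have e0 := log_eps_ge0 k; have e1 := log_eps_le1 k.
have e2 : log_eps k ^+ 2 <= log_eps k by rewrite expr2 ler_piMl.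
have p2 : (pi : R) / 2 <= 2 by exact/ltW/pihalf_lt2.
have : (2 * log_eps k + 16 * log_eps k ^+ 2) * (pi / 2) <= 18 * log_eps k * 2.
  apply: ler_pM => //; [by have := sqr_ge0 (log_eps k); lra|by rewrite divr_ge0 ?pi_ge0|lra].
lra.
Qed.

Lemma grouped_flux_le M N theta :
  flux (grouped M N) (circle_arc s t theta) <= \sum_(0 <= k < M) flux_majorant s t k theta.
Proof.
have zle : normc (circle_arc s t theta) <= 1 by rewrite normc_arc.
apply: flux_prod_le => k.
- by rewrite /= normcM mulr_ile1 ?normc_ge0 ?log_jet_le1 ?bl_group_le1.
- by have [] := flux_majorant_ge k 0%N theta.
- by have [] := flux_majorant_ge k N theta.
Qed.

End Signs.

Lemma der_sum (H h : nat -> R -> R) M (theta : R) :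
  (forall k, is_derive theta 1 (H k) (h k theta)) ->
  is_derive theta 1 (fun u => \sum_(0 <= k < M) H k u) (\sum_(0 <= k < M) h k theta).
Proof.
move=> dH; elim: M => [|M ih].
  by rewrite big_geq//; under eq_fun do rewrite big_geq//; exact: derC.
rewrite big_nat_recr//=; under eq_fun do rewrite big_nat_recr//=.
exact: derD.
Qed.

(** Four arcs contribute 40 each, and Green's formula halves the total. The bound is uniform in both
    [M] and [N] once the [log_eps] are summable. *)
Lemma grouped_energy M N :
  (disc_energy (grouped M N) <= (80 * \sum_(0 <= k < M) log_eps k)%:E)%E.
Proof.
have [B HB] := grouped_bounded M N.
have i1 : (1 : R) ^+ 2 = 1 by rewrite expr1n.
have iN1 : (-1 : R) ^+ 2 = 1 by rewrite sqrrN expr1n.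
pose S (f : R -> R -> nat -> R -> R) u := \sum_(0 <= k < M) f 1 1 k u +
  \sum_(0 <= k < M) f 1 (-1) k u + \sum_(0 <= k < M) f (-1) 1 k u +
  \sum_(0 <= k < M) f (-1) (-1) k u.
have -> : (80 * \sum_(0 <= k < M) log_eps k = (160 * \sum_(0 <= k < M) log_eps k) / 2) by lra.
apply: (@le_trans _ _ ((S flux_primitive (pi / 2) - S flux_primitive 0) / 2)%:E).
  apply: (@disc_energy_le _ _ (2 * B) _ _ (S flux_primitive) (S flux_majorant)).
  - by move=> z z1; exact: jet_at_grouped.
  - move=> z z1; have Bz := HB z z1; have B0 := le_trans (jsize_ge0 _ _) Bz.
    split.
    + by rewrite (le_trans (le_j0_jsize _ _))//; lra.
    + by rewrite (le_trans (le_j1_jsize _ _))//; lra.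
    + by rewrite (le_trans (le_j2_jsize _ _))//; lra.
  - by move=> theta; do !apply: derD; apply: der_sum => k; exact: der_flux_primitive.
  - by move=> theta; do !apply: lerD; exact: grouped_flux_le.
rewrite lee_fin ler_pM2r ?invr_gt0//.
have I s t : s ^+ 2 = 1 -> t ^+ 2 = 1 ->
    \sum_(0 <= k < M) flux_primitive s t k (pi / 2) - \sum_(0 <= k < M) flux_primitive s t k 0 <= 40 * \sum_(0 <= k < M) log_eps k.
  move=> s2 t2; rewrite -sumrB mulr_sumr; apply: ler_sum => k _; exact: flux_primitive_increment.
have := I _ _ i1 i1; have := I _ _ i1 iN1; have := I _ _ iN1 i1; have := I _ _ iN1 iN1.
rewrite /S; lra.
Qed.

End Engine.

(** * Zeros of the Blaschke product and passage to the limit *)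

Section NearOneProducts.
Context {R : realType}.

Lemma near_one_j0 (s : R) (J : jet (R := R)) z : j0 (near_one s J) z = 1 + s%:C * j0 J z.
Proof. by []. Qed.

Lemma jprodS (G : nat -> jet (R := R)) n z :
  j0 (jprod G n.+1) z = j0 (jprod G n) z * j0 (G n) z.
Proof. by []. Qed.

Lemma near_one_prod_neq0 (s : nat -> R) (G : nat -> jet (R := R)) z l : bounded_series s ->
  loc_bounded G -> unit_disc z -> (forall n, j0 (near_one (s n) (G n)) z != 0) ->
  ccvg (fun n => j0 (jprod (fun i => near_one (s i) (G i)) n) z) l -> l != 0.
Proof.
move=> bs lG dz nz.
have -> : (fun n => j0 (jprod (fun i => near_one (s i) (G i)) n) z) =
    (fun n => \prod_(0 <= i < n) j0 (near_one (s i) (G i)) z).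
  by apply/funext => n; exact: jprod_prod.
apply: inf_prod_neq0 => //.
have [C [C0 HC]] := lG _ dz.
apply: bounded_series_le (bounded_seriesZ C0 bs) => n; rewrite normc_ge0/=.
rewrite (addrC 1) addrK normcM normc_realE ger0_norm; last by case: bs.
rewrite mulrC ler_wpM2r//; first by case: bs.
by rewrite (le_trans (le_j0_jsize _ _))// HC.
Qed.

End NearOneProducts.

Section BlaschkeProduct.
Context {R : realType}.
Variables (r : nat -> R) (c : nat -> R[i]) (act : nat -> bool).
Hypothesis r01 : forall n, 0 <= r n < 1.
Hypothesis c1 : forall n, normc (c n) = 1.
Hypothesis bs : bounded_series (bl_weight r act).

Definition hits w n := act n && ((r n)%:C * (c n)^* == w).

(* [bl r c] divided by [z - r c^*] *)
Definition bl_quot n := jmul (jcst (- c n)) (jinv (jaff 1 (- ((r n)%:C * c n)))).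

(** A factor vanishing at [w] is divided by [z - w], yet the quotient [q] is kept as [1 + (1 - r) J]
    with [J = (q - 1) / (1 - r)], so that [infinite_product] applies with the same weights. *)
Definition bl_e_quot w n := if hits w n
  then jmul (jcst ((1 - r n)^-1)%:C) (jadd (bl_quot n) (jcst (-1)))
  else bl_e (r n) (c n).

Lemma bl_quot_jet n z : normc z <= 1 -> jet_at (bl_quot n) z.
Proof.
move=> z1; apply: jet_at_mul (jet_at_cst _ _) _.
by apply: jet_at_inv (jet_at_aff _ _ _); rewrite /= mulNr bl_den_neq0.
Qed.

(** Division by [1 - r n] occurs only when the zero is [w], and then [r n = normc w]: the constant
    [T] serves all these indices. *)
Lemma loc_bounded_bl_e_quot w : loc_bounded (bl_e_quot w).
Proof.
move=> rho rho1; have [C [C0 HC]] := loc_bounded_bl_e r01 c1 rho1.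
set m := Num.max rho 0.
have m0 : 0 <= m by rewrite le_max lexx orbT.
set q := 1 - m.
have q0 : 0 < q by rewrite /q subr_gt0 gt_max rho1 ltr01.
set S := q^-1 + q^-1 ^+ 2 + q^-1 ^+ 3.
have S0 : 0 <= S by rewrite !addr_ge0 ?exprn_ge0// invr_ge0 ltW.
pose T : R := `|(1 - normc w)^-1|.
have TS : 0 <= T * (S + 1) by apply: mulr_ge0; [exact: normr_ge0|exact: addr_ge0].
exists (C + T * (S + 1)); split; first exact: addr_ge0.
move=> n z zr; rewrite /bl_e_quot; case: ifPn => [/andP[_ /eqP wn]|_]; last first.
  by rewrite (le_trans (HC _ _ zr))// lerDl.
have rw : r n = normc w.
  rewrite -wn normcM normc_realE normc_conj c1 mulr1 ger0_norm//.
  by have /andP[] := r01 n.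
rewrite (le_trans (jsize_mul _ _ _))// -[leLHS]add0r lerD// ler_pM ?jsize_ge0//.
  by rewrite jsize_cst normc_realE /T rw.
rewrite (le_trans (jsize_add _ _ _))// lerD//; last by rewrite jsize_cst normcN normc1.
rewrite (le_trans (jsize_mul _ _ _))// jsize_cst normcN c1 mul1r.
have /andP[rn0 rn1] := r01 n.
apply: jsize_inv_aff_le => //.
  by rewrite normcN normcM c1 mulr1 normc_realE ger0_norm// ltW.
have zm : normc z <= m by rewrite le_max zr.
rewrite mulNr (le_trans _ (bl_den_ge (r01 n) (c1 n) zm))//.
by rewrite /q lerD2l lerN2 ler_piMl// ltW.
Qed.

Lemma bl_e_quot_jet w n z : normc z <= 1 -> jet_at (bl_e_quot w n) z.
Proof.
move=> z1; rewrite /bl_e_quot; case: ifP => _; last exact: bl_e_jet.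
apply: jet_at_mul (jet_at_cst _ _) _; apply: jet_at_add (jet_at_cst _ _).
exact: bl_quot_jet.
Qed.

Lemma bl_e_quot_hit w n z : hits w n ->
  j0 (near_one (bl_weight r act n) (bl_e_quot w n)) z = - c n / (1 - (r n)%:C * c n * z).
Proof.
move=> h; rewrite near_one_j0 /bl_e_quot h /bl_weight; have /andP[-> _] := h.
have rn : 1 - r n != 0 by have /andP[_ rn1] := r01 n; rewrite subr_eq0 gt_eqF.
have E : (1 - r n)%:C * ((1 - r n)^-1)%:C = 1 :> R[i].
  by rewrite -rmorphM mulfV// real_complex1.
have Q : j0 (bl_quot n) z = - c n / (1 - (r n)%:C * c n * z).
  by rewrite /= (mulNr (_ * _)).
have D : j0 (jmul (jcst ((1 - r n)^-1)%:C) (jadd (bl_quot n) (jcst (-1)))) z =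
  ((1 - r n)^-1)%:C * (j0 (bl_quot n) z - 1) by [].
by rewrite D -Q mulrA E mul1r addrC subrK.
Qed.

Lemma bl_factor w n z : unit_disc z -> hits w n ->
  j0 (bl_jet r c act n) z = (z - w) * j0 (near_one (bl_weight r act n) (bl_e_quot w n)) z.
Proof.
move=> dz h; rewrite bl_e_quot_hit//; have /andP[an /eqP wn] := h.
have z1 : normc z <= 1 by exact: ltW.
rewrite bl_jetE// blE0// -wn mulrA; congr (_ / _).
rewrite mulrN mulrBl opprB; have cc := unit_conj (c1 n).
by rewrite -mulrA [(c n)^* * _]mulrC cc mulr1 [z * _]mulrC.
Qed.

Lemma bl_miss w n : unit_disc w -> ~~ hits w n ->
  j0 (bl_jet r c act n) w != 0.
Proof.
move=> dw; rewrite /hits negb_and; case: (boolP (act n)) => [an h|an _]; last first.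
  by rewrite /bl_jet /bl_weight (negbTE an) near_one0_j0 oner_eq0.
have w1 : normc w <= 1 by exact: ltW.
have {}h : (r n)%:C * (c n)^* != w := h.
rewrite bl_jetE// blE0// mulf_neq0//; last by rewrite invr_eq0 bl_den_neq0.
apply: contra h; rewrite subr_eq0 => /eqP ->.
by rewrite mulrAC unit_conj// mul1r.
Qed.

(** [G] is the product with every factor [z - w] removed; none of its factors vanishes at [w], so
    neither does the limit. No removal happens from [N0] on, so the extracted power is constant
    along the tail and the limits can be compared. *)
Lemma blaschke_multiplicity w B N0 : unit_disc w ->
  (forall z, unit_disc z -> ccvg (fun n => j0 (jprod (bl_jet r c act) n) z) (B z)) ->
  (forall n, (N0 <= n)%N -> ~~ hits w n) ->
  exists G G' : R[i] -> R[i], [/\ forall z, unit_disc z -> qdiff G z (G' z), G w != 0 &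
    forall z, unit_disc z -> B z = (z - w) ^+ (\sum_(0 <= n < N0) hits w n)%N * G z].
Proof.
move=> dw HB HN.
have JE n : jet_on_disc (bl_e_quot w n).
  by move=> z dz; apply: bl_e_quot_jet; exact: ltW.
have [G [G' HG]] := infinite_product bs JE (loc_bounded_bl_e_quot w).
exists G, G'; split.
- by move=> z /HG[].
- have [_ cG _] := HG _ dw.
  apply: (near_one_prod_neq0 bs (loc_bounded_bl_e_quot w) dw _ cG) => n.
  have [h|h] := boolP (hits w n).
    rewrite bl_e_quot_hit// mulf_neq0// ?invr_eq0 ?bl_den_neq0//; last exact: ltW.
    by rewrite oppr_eq0 -normc_gt0 c1.
  by rewrite /bl_e_quot (negbTE h); exact: bl_miss.
- move=> z dz; have [_ cG _] := HG _ dz.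
  have E N : j0 (jprod (bl_jet r c act) N) z = (z - w) ^+ (\sum_(0 <= n < N) hits w n)%N *
      j0 (jprod (fun i => near_one (bl_weight r act i) (bl_e_quot w i)) N) z.
    elim: N => [|N ih]; first by rewrite big_geq// expr0 mul1r.
    rewrite big_nat_recr// !jprodS ih (exprD (z - w)).
    have [h|h] := boolP (hits w N); first by rewrite (bl_factor dz h) expr1; ring.
    have -> : bl_e_quot w N = bl_e (r N) (c N) by rewrite /bl_e_quot (negbTE h).
    by rewrite expr0 mulr1 mulrA.
  have HM N : (\sum_(0 <= n < N0 + N) hits w n = \sum_(0 <= n < N0) hits w n)%N.
    elim: N => [|N ih]; first by rewrite addn0.
    by rewrite addnS big_nat_recr//= ih (negbTE (HN _ _)) ?leq_addr// addn0.
  have c2 : ccvg (fun n => j0 (jprod (bl_jet r c act) (N0 + n)%N) z)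
      ((z - w) ^+ (\sum_(0 <= n < N0) hits w n)%N * G z).
    have -> : (fun n => j0 (jprod (bl_jet r c act) (N0 + n)%N) z) =
      fun n => (z - w) ^+ (\sum_(0 <= n < N0) hits w n)%N *
        j0 (jprod (fun i => near_one (bl_weight r act i) (bl_e_quot w i)) (N0 + n)%N) z.
      by apply/funext => n; rewrite E HM.
    apply: ccvgM; first exact: ccvg_cst.
    by apply/(ccvg_shift (fun n => j0 (jprod (fun i => near_one (bl_weight r act i) (bl_e_quot w i)) n) z)).
  have [{}c2 c2'] := (ccvg_shift (fun n => j0 (jprod (bl_jet r c act) n) z) _ N0).1 c2.
  have [c3 c3'] := HB z dz.
  apply/eqP; rewrite eq_complex; apply/andP; split; apply/eqP.
    exact: (cvg_unique _ c3 c2).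
  exact: (cvg_unique _ c3' c2').
Qed.

End BlaschkeProduct.

(** * Convergence of the grouped products and finiteness of the limit energy *)

Section EngineLimit.
Context {R : realType}.
Variables (r : nat -> R) (c : nat -> R[i]) (act : nat -> bool).
Variables (pk : nat -> nat -> bool) (a K : nat -> R) (lam : nat -> R[i]).
Hypothesis r01 : forall n, 0 <= r n < 1.
Hypothesis c1 : forall n, normc (c n) = 1.
Hypothesis lam1 : forall k, normc (lam k) = 1.
Hypothesis K1 : forall k, 1 < K k.
Hypothesis a0 : forall k, 0 <= a k.
Hypothesis pk_act : forall k n, pk k n -> act n.
Hypothesis pk_stolz : forall k n, pk k n ->
  normc (lam k - (r n)%:C * (c n)^*) <= K k * (1 - r n).
Hypothesis pk_a : forall k n, pk k n -> 0 < a k.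
Hypothesis pk_sum : forall k N,
  2 * K k ^+ 2 * (\sum_(0 <= n < N) if pk k n then 1 - r n else 0) <= a k.
Hypothesis pk_disj : forall k k' n, pk k n -> pk k' n -> k = k'.
Hypothesis pk_cover : forall n, act n -> exists k, pk k n.
Hypothesis sum_a : bounded_series (fun k => inv_log (a k)).


Local Notation mu := (@lebesgue_measure R).
Local Notation log_jets := (log_jet a lam).
Local Notation bl_jets := (bl_jet r c act).
Local Notation grouped' := (grouped r c act pk a lam).

(** An index lies in a single group, so one term survives. Stated for any commutative law, since it
    is used for the sum of the weights and for the product of the factors. *)
Lemma big_pick (T : Type) (idx : T) (op : Monoid.com_law idx) M k0 n (x : T) :
  (k0 < M)%N -> pk k0 n -> \big[op/idx]_(0 <= k < M) (if pk k n then x else idx) = x.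
Proof.
move=> kM p0; rewrite (bigD1_seq k0) ?mem_index_iota ?iota_uniq//= p0 big1 ?Monoid.mulm1// => k kk0.
by case: ifPn => // pkn; rewrite (pk_disj pkn p0) eqxx in kk0.
Qed.

(** The Blaschke condition: summed by groups, the [1 - r n] are at most the [a k], hence at most the
    [inv_log (a k)]. *)
Lemma bounded_bl_weight : bounded_series (bl_weight r act).
Proof.
split; first exact: bl_weight_ge0.
have [_ [S HS]] := sum_a; exists S => N.
have [M [_ HM]] := eventually_grouped pk_cover N.
apply: le_trans (HS M).
have -> : \sum_(0 <= n < N) bl_weight r act n =
    \sum_(0 <= n < N) \sum_(0 <= k < M) if pk k n then 1 - r n else 0.
  apply: eq_big_nat => n /andP[_ nN]; rewrite /bl_weight; case: ifPn => [/(HM _ nN)[k kM pkn]|nan].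
    by rewrite (big_pick _ _ kM pkn).
  by rewrite big1// => k _; case: ifPn => // /pk_act; rewrite (negbTE nan).
rewrite exchange_big_nat; apply: ler_sum => k _.
apply: le_trans (le_inv_log a0 k); apply: le_trans (pk_sum k N).
have s0 : 0 <= \sum_(0 <= n < N) (if pk k n then 1 - r n else 0).
  by apply: sumr_ge0 => n _; case: ifP => // _; have /andP[_ /ltW] := r01 n; rewrite subr_ge0.
by rewrite ler_peMl//; have := K1 k; nra.
Qed.

Lemma grouped_j0 M N z :
  (forall n, (n < N)%N -> act n -> exists2 k, (k < M)%N & pk k n) ->
  j0 (grouped' M N) z = j0 (jprod log_jets M) z * j0 (jprod bl_jets N) z.
Proof.
move=> HM; rewrite /grouped !jprod_prod.
transitivity (\prod_(0 <= k < M) (j0 (log_jets k) z *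
    \prod_(0 <= n < N) (if pk k n then j0 (bl_jets n) z else 1))).
  apply: eq_bigr => k _; rewrite [LHS]/=; congr (_ * _); rewrite /bl_group jprod_prod.
  by apply: eq_bigr => n _; case: ifP.
rewrite big_split; congr (_ * _); rewrite exchange_big_nat.
apply: eq_big_nat => n /andP[_ nN].
have [/(HM _ nN)[k kM pkn]|nan] := boolP (act n); first by rewrite (big_pick _ _ kM pkn).
rewrite big1 => [|k _]; last by case: ifPn => // /pk_act; rewrite (negbTE nan).
by rewrite /bl_jet /bl_weight (negbTE nan) near_one0_j0.
Qed.

(** Uniqueness of the derivative avoids reordering the sums that define [j1]: the values of the two
    jets agree everywhere by [grouped_j0]. *)
Lemma grouped_j1 M N z : unit_disc z ->
  (forall n, (n < N)%N -> act n -> exists2 k, (k < M)%N & pk k n) ->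
  j1 (grouped' M N) z =
    j1 (jprod log_jets M) z * j0 (jprod bl_jets N) z + j0 (jprod log_jets M) z * j1 (jprod bl_jets N) z.
Proof.
move=> dz HM; have z1 : normc z <= 1 by exact: ltW.
have [q1 _ _] : jet_at (grouped' M N) z by exact: jet_at_grouped.
have [q2 _ _] : jet_at (jmul (jprod log_jets M) (jprod bl_jets N)) z.
  apply: jet_at_mul; apply: jet_at_prod => k _.
    exact: jet_at_log_jet.
  exact: jet_at_bl_jet.
rewrite -(qdiff_cderive q1) -[RHS](qdiff_cderive q2); congr cderive.
by apply/funext => w; exact: grouped_j0.
Qed.

Lemma disc2P (p : R * R) : disc2 p -> unit_disc (p.1 +i* p.2).
Proof.
move=> h; rewrite /unit_disc /= -(@ltr_pXn2r _ 2)// ?nnegrE ?sqrtr_ge0// expr1n.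
by rewrite sqr_sqrtr// addr_ge0// sqr_ge0.
Qed.

Lemma measurable_grouped M N : measurable_fun disc2
  (fun p : R * R => (normc (j1 (grouped' M N) (p.1 +i* p.2)) ^+ 2)%:E).
Proof.
apply/measurable_EFinP; apply: continuous_measurable_prod open_disc2 _ => p /disc2P dp.
have [_ q _] : jet_at (grouped' M N) (p.1 +i* p.2) by apply: jet_at_grouped => //; exact: ltW.
have [c2 c3] := qdiff_continuous2 q.
have -> : (fun p : R * R => normc (j1 (grouped' M N) (p.1 +i* p.2)) ^+ 2) =
  fun p => complex.Re (j1 (grouped' M N) (p.1 +i* p.2)) * complex.Re (j1 (grouped' M N) (p.1 +i* p.2)) +
    complex.Im (j1 (grouped' M N) (p.1 +i* p.2)) * complex.Im (j1 (grouped' M N) (p.1 +i* p.2)).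
  by apply/funext => q'; rewrite sqr_normcE !expr2.
by apply: cvgD; apply: cvgM.
Qed.

(** The limit is kept as a zero-free factor [A] and a Blaschke product [B], so that zeros are
    studied on [B] alone; the last integrand is [|(A B)'|^2]. *)
Lemma energy_limit : exists A A' B B' : R[i] -> R[i],
  [/\ forall z, unit_disc z -> qdiff A z (A' z) /\ A z != 0,
      forall z, unit_disc z -> qdiff B z (B' z),
      forall z, unit_disc z -> ccvg (fun n => j0 (jprod bl_jets n) z) (B z) &
      (\int[mu \x mu]_(p in disc2) (normc (A' (p.1 +i* p.2)%C * B (p.1 +i* p.2)%C +
         A (p.1 +i* p.2)%C * B' (p.1 +i* p.2)%C) ^+ 2)%:E < +oo)%E].
Proof.
have JF n : jet_on_disc (lf_e (log_scale a n) (lam n)).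
  by move=> z dz; apply: lf_e_jet => //; [exact: log_scale_gt0|exact: ltW].
have JB n : jet_on_disc (bl_e (r n) (c n)).
  by move=> z dz; apply: bl_e_jet => //; exact: ltW.
have lF := loc_bounded_lf_e (log_scale_gt0 a0) lam1.
have be := bounded_log_eps a0 sum_a.
have [A [A' HA]] := infinite_product be JF lF.
have [B [B' HB]] := infinite_product bounded_bl_weight JB (loc_bounded_bl_e r01 c1).
exists A, A', B, B'; split.
- move=> z dz; have [qA cA _] := HA z dz; split=> //.
  apply: (near_one_prod_neq0 be lF dz _ cA) => n.
  have z1 : normc z <= 1 by exact: ltW.
  have [an|an] := eqVneq (a n) 0; first by rewrite /log_eps an eqxx near_one0_j0 oner_eq0.
  rewrite -/(log_jet a lam n) log_jetE// lfE0 ?log_scale_gt0//; apply: mulf_neq0.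
    by rewrite -normc_gt0 normc_realE gtr0_norm leps_gt0// log_scale_gt0.
  (* Inside the open disc [|lv| >= 1 + d - |z| > d], so the real part [ll] is strictly positive. *)
  rewrite -normc_gt0; apply: lt_le_trans (normRe_le _); rewrite /= ger0_norm ?ll_ge0 ?log_scale_gt0//.
  rewrite /ll Re_clog_lv ?log_scale_gt0// subr_gt0 ltr_ln ?posrE ?log_scale_gt0 ?norm_lv_gt0 ?log_scale_gt0//.
  apply: lt_le_trans (norm_lv_ge _ (lam1 n) (lexx (normc z))).
  by have : normc z < 1 := dz; lra.
- by move=> z /HB[].
- by move=> z /HB[].
have [Mf HMf] := choice (eventually_grouped pk_cover).
pose f N (p : R * R) := (normc (j1 (grouped' (Mf N) N) (p.1 +i* p.2)) ^+ 2)%:E.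
have [be0 [S HS]] := be.
have fS N : (\int[mu \x mu]_(p in disc2) f N p <= (80 * S)%:E)%E.
  apply: (@le_trans _ _ (80 * \sum_(0 <= k < Mf N) log_eps a k)%:E); first by apply: grouped_energy.
  by rewrite lee_fin ler_wpM2l.
have f0 N p : disc2 p -> (0 <= f N p)%E by move=> _; rewrite lee_fin sqr_ge0.
have := fatou (mu \x mu)%E measurable_disc2 (fun N => measurable_grouped (Mf N) N) f0.
rewrite -/f => Fatou.
apply: (@le_lt_trans _ _ (80 * S)%:E); last exact: ltry.
apply: (@le_trans _ _ (\int[mu \x mu]_(p in disc2) limn_einf (f^~ p))%E).
  (* Both derivative sequences converge at each point, so the lower limit in Fatou's lemma is the
     desired integrand. *)
  rewrite le_eqVlt; apply/orP; left; apply/eqP; apply: eq_integral => p /set_mem/disc2P dp.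
  have [_ cA cA'] := HA _ dp; have [_ cB cB'] := HB _ dp.
  have MN N : (N <= Mf N)%N by have [] := HMf N.
  have cf : ccvg (fun N => j1 (grouped' (Mf N) N) (p.1 +i* p.2))
      (A' (p.1 +i* p.2) * B (p.1 +i* p.2) + A (p.1 +i* p.2) * B' (p.1 +i* p.2)).
    have -> : (fun N => j1 (grouped' (Mf N) N) (p.1 +i* p.2)) = fun N =>
        j1 (jprod log_jets (Mf N)) (p.1 +i* p.2) * j0 (jprod bl_jets N) (p.1 +i* p.2) +
        j0 (jprod log_jets (Mf N)) (p.1 +i* p.2) * j1 (jprod bl_jets N) (p.1 +i* p.2).
      by apply/funext => N; apply: grouped_j1 => //; have [] := HMf N.
    apply: ccvgD; apply: ccvgM => //.
      exact: (ccvg_subseq MN cA').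
    exact: (ccvg_subseq MN cA).
  have ce : (f^~ p) @ \oo --> (normc (A' (p.1 +i* p.2) * B (p.1 +i* p.2) + A (p.1 +i* p.2) * B' (p.1 +i* p.2)) ^+ 2)%:E.
    by apply: cvg_EFin; [exact: nearW|exact: ccvg_sqr_normc].
  by have [-> _] := cvg_limn_einf_sup ce.
apply: (le_trans Fatou).
rewrite limn_einf_lim; apply: lime_le; first exact: is_cvg_einfs.
by apply: nearW => n; apply: le_trans (fS n); apply: ereal_inf_lbound; exists n => /=.
Qed.

End EngineLimit.

(** * Coding the given family by natural numbers *)

Section Indexing.
Context {R : realType} {I : countType}.
Variables (Z : I -> R[i]) (P : nat -> set I).

(* For [w = 0] the choice [-1] makes the Blaschke factor equal to [z]. *)
Definition bl_unit (w : R[i]) : R[i] := if w == 0 then -1 else w^* / (normc w)%:C.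

Lemma normc_bl_unit w : normc (bl_unit w) = 1.
Proof.
rewrite /bl_unit; case: eqVneq => [_|w0]; first by rewrite normcN normc1.
rewrite normcM normcV normc_conj normc_realE ger0_norm ?normc_ge0// divff//.
by rewrite normc_eq0.
Qed.

Lemma bl_unit_polar w : (normc w)%:C * (bl_unit w)^* = w.
Proof.
rewrite /bl_unit; case: eqVneq => [->|w0].
  by rewrite normc0 real_complex0 mul0r.
have nw : (normc w)%:C != 0 :> R[i].
  by rewrite -normc_gt0 normc_realE ger0_norm ?normc_ge0// normc_gt0.
by rewrite conjc_mul conjcK conjc_inv conjc_real mulrC divfK.
Qed.

(** Codes of no index get the point 0, which keeps [0 <= zmod n < 1] for every [n]; [zact] excludes
    them. *)
Definition zpt n : R[i] := oapp Z 0 (@pickle_inv I n).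
Definition zmod n : R := normc (zpt n).
Definition zunit n : R[i] := bl_unit (zpt n).
Definition zact n : bool := @pickle_inv I n : bool.
Definition zpart k n : bool := oapp (fun i => i \in P k) false (@pickle_inv I n).

Lemma zpt_polar n : (zmod n)%:C * (zunit n)^* = zpt n.
Proof. exact: bl_unit_polar. Qed.

Hypothesis hZ : disc_sequence Z.

Lemma zmod_itv n : 0 <= zmod n < 1.
Proof.
rewrite /zmod normc_ge0/= /zpt; case: pickle_inv => [i|] /=; first exact: hZ.1.
by rewrite expr0n addr0 sqrtr0.
Qed.

Lemma hits_pickle w (i : I) : hits zmod zunit zact w (choice.pickle i) = (Z i == w).
Proof. by rewrite /hits /zact zpt_polar /zpt pickleK_inv. Qed.

Lemma hitsP w n : hits zmod zunit zact w n -> exists2 i : I, n = choice.pickle i & Z i = w.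
Proof.
rewrite /hits /zact zpt_polar /zpt; have := @pickle_invK I n.
by case: pickle_inv => [i|]//= <- /eqP <-; exists i.
Qed.

(** [pickle] maps the finitely many occurrences of [w] one-to-one onto the hits; [N0] is one more
    than their largest code. *)
Lemma hits_multiplicity w : exists N0, (forall n, (N0 <= n)%N -> ~~ hits zmod zunit zact w n) /\
  (\sum_(0 <= n < N0) hits zmod zunit zact w n)%N = multiplicity Z w.
Proof.
have fw := hZ.2 w.
set X := fset_set (Z @^-1` [set w]).
have XP i : (i \in X) = (Z i == w).
  rewrite in_fset_set//; apply/idP/eqP => [/set_mem//|zi]; exact: mem_set.
pose N0 := (\max_(i <- X) choice.pickle i).+1.
have lt_N0 i : Z i = w -> (choice.pickle i < N0)%N.
  by move=> /eqP; rewrite -XP => iX; rewrite ltnS; exact: (leq_bigmax_seq (F := @choice.pickle I) (P := xpredT)).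
exists N0; split.
  by move=> n Nn; apply/negP => /hitsP[i ni /lt_N0]; rewrite -ni ltnNge Nn.
rewrite /multiplicity -/X.
rewrite -[RHS](size_map (@choice.pickle I)).
have -> : (\sum_(0 <= n < N0) hits zmod zunit zact w n)%N =
    size [seq n <- index_iota 0 N0 | hits zmod zunit zact w n].
  by rewrite size_filter -sum1_count [RHS]big_mkcond; apply: eq_bigr => n _; case: hits.
apply: perm_size; apply: uniq_perm.
- by rewrite filter_uniq// iota_uniq.
- rewrite map_inj_uniq ?fset_uniq//; exact: (pcan_inj (@pickleK_inv I)).
- move=> n; rewrite mem_filter mem_index_iota /=; apply/andP/mapP => [[/hitsP[i -> zi] _]|[i iX ->]].
    by exists i => //; rewrite XP zi.
  have /eqP zi : Z i == w by rewrite -XP.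
  by rewrite hits_pickle zi; split => //; exact: lt_N0.
Qed.

(** The codes below [N] decode to finitely many distinct indices of [P k], and a finite partial sum
    is at most the unordered sum. *)
Lemma stolz_size_sum k (K : R) N : (stolz_size Z (P k) K < +oo)%E ->
  2 * K ^+ 2 * (\sum_(0 <= n < N) if zpart k n then 1 - zmod n else 0)
    <= fine (stolz_size Z (P k) K).
Proof.
move=> hfin.
have K0 : 0 <= 2 * K ^+ 2 by rewrite mulr_ge0 ?sqr_ge0.
have z0 i : 0 <= 1 - normc (Z i) by rewrite subr_ge0 ltW//; exact: hZ.1.
have e0 : (0 <= \esum_(i in P k) (1 - normc (Z i))%:E)%E.
  by apply: esum_ge0 => i _; rewrite lee_fin.
have s0 : (0 <= stolz_size Z (P k) K)%E by rewrite mule_ge0// lee_fin.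
rewrite -lee_fin fineK ?ge0_fin_numE// EFinM lee_wpmul2l ?lee_fin//.
set s := pmap (@pickle_inv I) [seq n <- index_iota 0 N | zpart k n].
have us : uniq s by apply: (pmap_uniq (@pickle_invK I)); rewrite filter_uniq// iota_uniq.
apply: esum_ge; exists [set` s].
  split; first exact: finite_seq.
  move=> i /=; rewrite mem_pmap => /mapP[n]; rewrite mem_filter => /andP[+ _] ni.
  by rewrite /zpart -ni /= => /set_mem.
rewrite -fsbig_seq// sumEFin lee_fin big_pmap big_filter [leRHS]big_mkcond/=.
apply: ler_sum => n _; rewrite /zpart /zmod /zpt.
by case: (@pickle_inv I n) => [i|] /=.
Qed.

End Indexing.

(** * Assembly of the theorem *)

Lemma inv_log_ge0 {R : realType} (a : R) : 0 <= a -> 0 <= inv_log a.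
Proof.
move=> a0; rewrite /inv_log; case: eqP => // _.
by rewrite invr_ge0 ln_ge0// lerDl invr_ge0.
Qed.

Theorem theorem1p5 (R : realType) (I : countType) (Z : I -> complex R)
    (hZ : disc_sequence Z)
    (P : nat -> set I)
    (hPcover : \bigcup_k P k = [set: I])
    (hPdisj : trivIset [set: nat] P)
    (lambda : nat -> complex R) (K : nat -> R)
    (hlambda : forall k, unit_circle (lambda k))
    (hK : forall k, 1 < K k)
    (hstolz : forall k i, P k i -> stolz_angle (K k) (lambda k) (Z i))
    (hfin : forall k, (stolz_size Z (P k) (K k) < +oo)%E)
    (hsum : (\sum_(0 <= k <oo)
               (inv_log (fine (stolz_size Z (P k) (K k))))%:E < +oo)%E) :
  dirichlet_zero_set Z.
Proof.
pose a k := fine (stolz_size Z (P k) (K k)).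
have z0 i : 0 <= 1 - normc (Z i) by rewrite subr_ge0 ltW//; exact: hZ.1.
have a0 k : 0 <= a k.
  rewrite fine_ge0// mule_ge0//; first by rewrite lee_fin mulr_ge0 ?sqr_ge0.
  by apply: esum_ge0 => i _; rewrite lee_fin.
have r01 := zmod_itv hZ.
have zpartP k n : zpart P k n -> exists2 i : I, pickle_inv n = Some i & P k i.
  by rewrite /zpart; case: pickle_inv => [i|]//= /set_mem; exists i.
have pk_act k n : zpart P k n -> zact (I := I) n.
  by move=> /zpartP[i ni _]; rewrite /zact ni.
have pk_stolz k n : zpart P k n ->
    normc (lambda k - (zmod Z n)%:C%C * conjc (zunit Z n)) <= K k * (1 - zmod Z n).
  move=> /zpartP[i ni Pki]; rewrite zpt_polar /zmod /zpt ni /=.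
  by have [] := hstolz k i Pki.
have pk_sum k N := stolz_size_sum hZ N (hfin k).
(* A single point of the open disc already contributes a positive term, so [a k = 0] means an empty
   part. *)
have pk_a k n : zpart P k n -> 0 < a k.
  move=> pkn; apply: lt_le_trans (pk_sum k n.+1).
  have s1 : 0 < \sum_(0 <= m < n.+1) (if zpart P k m then 1 - zmod Z m else 0).
    rewrite big_nat_recr//= pkn ltr_wpDl//; last by have /andP[_] := r01 n; rewrite subr_gt0.
    apply: sumr_ge0 => m _; case: ifP => // _.
    by have /andP[_ /ltW] := r01 m; rewrite subr_ge0.
  by rewrite mulr_gt0// mulr_gt0// exprn_gt0// (lt_trans ltr01).
have pk_disj k k' n : zpart P k n -> zpart P k' n -> k = k'.
  move=> /zpartP[i ni Pki] /zpartP[i']; rewrite ni => -[<-] Pk'i.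
  by apply: hPdisj => //; exists i.
have pk_cover n : zact (I := I) n -> exists k, zpart P k n.
  rewrite /zact /zpart; case: pickle_inv => [i|]//= _.
  have : (\bigcup_k P k) i by rewrite hPcover.
  by move=> [k _ Pki]; exists k; exact: mem_set.
have sum_a : bounded_series (fun k => inv_log (a k)).
  split; first by move=> k; exact: inv_log_ge0.
  exists (fine (\sum_(0 <= k <oo) (inv_log (a k))%:E)%E) => n.
  have i0 k : (0 <= (inv_log (a k))%:E)%E by rewrite lee_fin inv_log_ge0.
  rewrite -lee_fin fineK; last first.
    by rewrite ge0_fin_numE// nneseries_ge0.
  by rewrite -sumEFin; apply: nneseries_lim_ge.
have c1 n : normc (zunit Z n) = 1 by exact: normc_bl_unit.
have [A [A' [B [B' [HA HB cB energy]]]]] :=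
  energy_limit r01 c1 hlambda hK a0 pk_act pk_stolz pk_a pk_sum pk_disj pk_cover sum_a.
have bs := bounded_bl_weight r01 hK a0 pk_act pk_sum pk_disj pk_cover sum_a.
have dF z : unit_disc z -> qdiff (fun z => A z * B z) z (A' z * B z + A z * B' z).
  by move=> dz; apply: qdiffM; [case: (HA z dz)|exact: HB].
(* Used at every point of the disc: off the range of [Z] the multiplicity is 0, and the
   factorisation then says that [B w] is nonzero. *)
have vanish w : unit_disc w -> exists G G' : R[i] -> R[i],
    [/\ forall z, unit_disc z -> qdiff G z (G' z), G w != 0 &
      forall z, unit_disc z -> B z = (z - w) ^+ multiplicity Z w * G z].
  move=> dw; have [N0 [HN <-]] := hits_multiplicity hZ w.
  exact: (blaschke_multiplicity r01 c1 bs dw cB HN).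
exists (fun z => A z * B z); split.
- split; first by move=> z /dF/qdiff_derivable.
  rewrite /dirichlet_integral lte_mul_pinfty//.
    by rewrite lee_fin invr_ge0 pi_ge0.
  have -> : [set p : R * R | unit_disc (p.1 +i* p.2)%C] = disc2.
    apply/seteqP; split=> p; last exact: disc2P.
    rewrite /unit_disc /disc2 /= => h.
    rewrite -[ltLHS]sqr_sqrtr ?addr_ge0 ?sqr_ge0//.
    by rewrite exprn_ilt1 ?sqrtr_ge0.
  apply: le_lt_trans energy; rewrite le_eqVlt; apply/orP; left; apply/eqP.
  by apply: eq_integral => p /set_mem/disc2P/dF/qdiff_cderive ->.
- move=> w [i _ zw]; have dw : unit_disc w by rewrite -zw; exact: hZ.1.
  have [G [G' [HG Gw BG]]] := vanish w dw.
  exists (fun z => A z * G z); split.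
  + move=> z dz; have [qA _] := HA z dz.
    exact: qdiff_derivable (qdiffM qA (HG z dz)).
  + by apply: mulf_neq0 => //; case: (HA w dw).
  + by move=> z dz; rewrite BG//; ring.
- move=> w dw nw; have [G [G' [_ Gw BG]]] := vanish w dw.
  have m0 : multiplicity Z w = 0%N.
    rewrite /multiplicity (_ : Z @^-1` [set w] = set0) ?fset_set0 ?cardfs0//.
    by apply/seteqP; split=> i //= zi; apply: nw; exists i.
  apply: mulf_neq0; first by case: (HA w dw).
  by rewrite BG// m0 expr0 mul1r.
Qed.
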